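(* Let $D\subset\mathbb{C}^d$ be a domain and let $p\in\partial D$ be a strongly pseudoconvex boundary point of $D$. Then there exist a neighborhood $U$ of $p$ and a constant $c>0$ such that $$k_D(z,w)\ge\log\left(1+\frac{c\,|(z-w)_n|}{\delta_D(z)^{1/2}\,\delta_D(w)^{1/2}}\right),\qquad z,w\in D\cap U.$$
   Context: $\Delta$ is the open unit disc in $\mathbb{C}$, $\mathcal{O}(\Delta,D)$ is the set of holomorphic maps $\Delta\to D$, and $\tanh^{-1}t=\frac12\log\frac{1+t}{1-t}$. The Lempert function of $D$ is $l_D(z,w)=\inf\{\tanh^{-1}|\alpha|:\exists\varphi\in\mathcal{O}(\Delta,D)\text{ with }\varphi(0)=z,\ \varphi(\alpha)=w\}$, and the Kobayashi distance $k_D$ is the largest pseudodistance on $D$ not exceeding $l_D$. $\delta_D(z)=\operatorname{dist}(z,\partial D)$ is the Euclidean distance to the boundary. For $z\in D$ near $p$, let $p(z)\in\partial D$ be the closest boundary point to $z$ (unique for $z$ close to $p$). $X_n$ denotes the projection of $X\in\mathbb{C}^d$ on the real normal line to $\partial D$ at $p(z)$; equivalently $|X_n|=|\operatorname{Re}\langle X,\nu_{p(z)}\rangle|$, where $\nu_{p(z)}$ is the unit outward normal to $\partial D$ at $p(z)$ and $\langle\cdot,\cdot\rangle$ is the standard Hermitian product. In the expression $(z-w)_n$ the projection is taken at $p(z)$. A strongly pseudoconvex boundary point $p$ is one near which $\partial D$ is $\mathcal{C}^2$-smooth and at which the Levi form of a defining function is positive definite on the complex tangent space. *)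

(* Defs.v *)
From HB Require Import structures.
From mathcomp Require Import all_boot all_order all_algebra.
From mathcomp Require Import complex.
From mathcomp Require Import all_classical all_reals all_analysis.

Set Implicit Arguments.
Unset Strict Implicit.
Unset Printing Implicit Defensive.

Import Order.TTheory GRing.Theory Num.Theory numFieldNormedType.Exports.
Local Open Scope classical_set_scope.
Local Open Scope ring_scope.

(* The complex numbers [R[i]], packaged so that they carry the topology the
   library puts on every [numFieldType], that of the modulus (which is itself
   an element of [C R]).  ['rV[C R]_d], our C^d, is then a normed space over
   [C R] for the sup norm; Euclidean lengths are given by [enorm] below. *)
Definition C (R : realType) : numClosedFieldType := R[i].

Definition is_domain (T : topologicalType) (D : set T) : Prop :=
  [/\ D !=set0, open D & connected D].

Definition boundary (T : topologicalType) (D : set T) : set T :=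
  closure D `\` interior D.

(* [dotmx u v] is the standard Hermitian product, linear in [u]. *)
Definition enorm (R : realType) (d : nat) (x : 'rV[C R]_d) : R :=
  Num.sqrt (complex.Re (dotmx x x)).

Definition bdist (R : realType) (d : nat) (D : set 'rV[C R]_d)
    (z : 'rV[C R]_d) : R :=
  inf [set enorm (z - q) | q in boundary D].

Definition atanh (R : realType) (t : R) : R := 2^-1 * ln ((1 + t) / (1 - t)).

(* Elements of O(Delta, D) are represented by total functions, of which only
   the restriction to the unit disc matters. [derivable] is over the scalar
   field [C R], hence is complex differentiability. *)
Definition holo_disc (R : realType) (d : nat) (D : set 'rV[C R]_d)
    (phi : C R -> 'rV[C R]_d) : Prop :=
  forall zeta : C R, `|zeta| < 1 -> derivable phi zeta 1 /\ D (phi zeta).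

(* [complex.Re] turns [`|alpha| : C R] into an element of [R]. *)
Definition lempert (R : realType) (d : nat) (D : set 'rV[C R]_d)
    (z w : 'rV[C R]_d) : \bar R :=
  ereal_inf [set (atanh (complex.Re `|alpha|))%:E | alpha in
    [set alpha : C R | `|alpha| < 1 /\
      exists phi, [/\ holo_disc D phi, phi 0 = z & phi alpha = w]]].

Definition pseudodistance_on (R : realType) (T : Type) (D : set T)
    (rho : T -> T -> R) : Prop :=
  [/\ forall x y, D x -> D y -> 0 <= rho x y,
      forall x, D x -> rho x x = 0,
      forall x y, D x -> D y -> rho x y = rho y x
    & forall x y z, D x -> D y -> D z -> rho x z <= rho x y + rho y z].

Definition below_lempert (R : realType) (d : nat) (D : set 'rV[C R]_d)
    (rho : 'rV[C R]_d -> 'rV[C R]_d -> R) : Prop :=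
  pseudodistance_on D rho /\
  forall x y, D x -> D y -> ((rho x y)%:E <= lempert D x y)%E.

(* The largest pseudodistance below the Lempert function is the pointwise
   supremum of all of them; see the lemmas that follow. *)
Definition kobayashi (R : realType) (d : nat) (D : set 'rV[C R]_d)
    (z w : 'rV[C R]_d) : \bar R :=
  ereal_sup [set (rho z w)%:E | rho in below_lempert D].

Section KobayashiLargest.
Variables (R : realType) (d : nat) (D : set 'rV[C R]_d).
Implicit Types x y z : 'rV[C R]_d.
Local Open Scope ereal_scope.

Lemma kobayashi_ub rho x y :
  below_lempert D rho -> (rho x y)%:E <= kobayashi D x y.
Proof. by move=> rhoD; apply: ereal_sup_ubound; exists rho. Qed.

Lemma kobayashi_le_lempert x y :
  D x -> D y -> kobayashi D x y <= lempert D x y.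
Proof.
by move=> Dx Dy; apply: ge_ereal_sup => _ [rho [_ rhoD]] <-; exact: rhoD.
Qed.

Lemma atanh_ge0 (t : R) : (0 <= t < 1)%R -> (0 <= atanh t)%R.
Proof.
move=> /andP[t0 t1]; rewrite mulr_ge0 ?invr_ge0 //.
rewrite ln_ge0 // ler_pdivlMr ?subr_gt0 // mul1r.
by rewrite lerD2l (le_trans _ t0) // oppr_le0.
Qed.

Lemma lempert_ge0 x y : 0 <= lempert D x y.
Proof.
apply: le_ereal_inf_tmp => _ [alpha [alpha1 _] <-].
rewrite lee_fin; apply: atanh_ge0.
by case: alpha alpha1 => a b; rewrite normcE /= ltcE /= => /andP[_ ->]; rewrite sqrtr_ge0.
Qed.

Lemma kobayashi_ge0 x y : 0 <= kobayashi D x y.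
Proof.
apply: ereal_sup_ubound; exists (fun _ _ => 0%R) => //; split.
  by split=> // *; rewrite addr0.
by move=> *; exact: lempert_ge0.
Qed.

Lemma kobayashi_xx x : D x -> kobayashi D x x = 0.
Proof.
move=> Dx; apply/eqP; rewrite eq_le kobayashi_ge0 andbT.
by apply: ge_ereal_sup => _ [rho [[_ rho0 _ _] _] <-]; rewrite rho0.
Qed.

Lemma kobayashi_sym x y : D x -> D y -> kobayashi D x y = kobayashi D y x.
Proof.
move=> Dx Dy; congr ereal_sup; apply/seteqP.
by split=> _ [rho rhoD <-]; exists rho => //; case: rhoD => -[_ _ rhoC _] _;
  rewrite rhoC.
Qed.

Lemma kobayashi_triangle x y z : D x -> D y -> D z ->
  kobayashi D x z <= kobayashi D x y + kobayashi D y z.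
Proof.
move=> Dx Dy Dz; apply: ge_ereal_sup => _ [rho rhoD <-].
have [[_ _ _ rhoT] _] := rhoD.
apply: (@le_trans _ _ ((rho x y)%:E + (rho y z)%:E)).
  by rewrite -EFinD lee_fin rhoT.
by apply: leeD; exact: kobayashi_ub.
Qed.

End KobayashiLargest.

(* C^d is only a vector space over [C R], so real partial derivatives are
   taken along the real line [t |-> z + t v]. *)
Definition along (R : realType) (d : nat) (f : 'rV[C R]_d -> R)
    (z v : 'rV[C R]_d) : R -> R :=
  fun t => f (z + (t%:C%C : C R) *: v).

Definition pderiv (R : realType) (d : nat) (v : 'rV[C R]_d)
    (f : 'rV[C R]_d -> R) (z : 'rV[C R]_d) : R :=
  derive1 (along f z v) 0.

Definition xdir (R : realType) (d : nat) (j : 'I_d) : 'rV[C R]_d :=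
  delta_mx 0 j.
Definition ydir (R : realType) (d : nat) (j : 'I_d) : 'rV[C R]_d :=
  'i *: delta_mx 0 j.
Arguments xdir {R d} j.
Arguments ydir {R d} j.

Definition real_basis (R : realType) (d : nat) : set 'rV[C R]_d :=
  range xdir `|` range ydir.

Fixpoint class_C (R : realType) (d : nat) (k : nat) (V : set 'rV[C R]_d)
    (f : 'rV[C R]_d -> R) : Prop :=
  (forall z, V z -> {for z, continuous f}) /\
  match k with
  | 0 => True
  | k'.+1 => forall v, real_basis v ->
      (forall z, V z -> derivable (along f z v) 0 1) /\
      class_C k' V (pderiv v f)
  end.

(* [df/dx_j + i df/dy_j]: the Euclidean gradient under R^(2d) = C^d. *)
Definition grad (R : realType) (d : nat) (f : 'rV[C R]_d -> R)
    (z : 'rV[C R]_d) : 'rV[C R]_d :=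
  \row_j (pderiv (xdir j) f z +i* pderiv (ydir j) f z)%C.

Definition pderivC (R : realType) (d : nat) (v : 'rV[C R]_d)
    (f : 'rV[C R]_d -> C R) (z : 'rV[C R]_d) : C R :=
  (pderiv v (fun x => complex.Re (f x)) z +i*
   pderiv v (fun x => complex.Im (f x)) z)%C.

Definition dz (R : realType) (d : nat) (j : 'I_d)
    (f : 'rV[C R]_d -> C R) (z : 'rV[C R]_d) : C R :=
  2^-1 * (pderivC (xdir j) f z - 'i * pderivC (ydir j) f z).

Definition dzbar (R : realType) (d : nat) (j : 'I_d)
    (f : 'rV[C R]_d -> C R) (z : 'rV[C R]_d) : C R :=
  2^-1 * (pderivC (xdir j) f z + 'i * pderivC (ydir j) f z).

Definition levi (R : realType) (d : nat) (r : 'rV[C R]_d -> R)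
    (z X : 'rV[C R]_d) : C R :=
  \sum_j \sum_k dz j (dzbar k (fun x => (r x)%:C%C : C R)) z * X 0 j * (X 0 k)^*.

Definition complex_tangent (R : realType) (d : nat) (r : 'rV[C R]_d -> R)
    (z : 'rV[C R]_d) : set 'rV[C R]_d :=
  [set X | \sum_j dz j (fun x => (r x)%:C%C : C R) z * X 0 j = 0].

(* [r] is a C^2 defining function of [D] on the neighbourhood [V] of [p]. *)
Definition defining_function (R : realType) (d : nat) (D : set 'rV[C R]_d)
    (p : 'rV[C R]_d) (V : set 'rV[C R]_d) (r : 'rV[C R]_d -> R) : Prop :=
  [/\ open V, V p, class_C 2 V r,
      D `&` V = [set z | V z /\ r z < 0]
    & forall z, V z -> grad r z != 0].

(* In [C R], [0 < x] means that [x] is real and positive; the Levi form of a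
   C^2 function is real-valued. *)
Definition strongly_pseudoconvex_at (R : realType) (d : nat)
    (D : set 'rV[C R]_d) (p : 'rV[C R]_d) : Prop :=
  boundary D p /\
  exists V r, defining_function D p V r /\
    forall X, complex_tangent r p X -> X != 0 -> 0 < levi r p X.

(* [closest] and [outer_normal] below are selected with [xget] among the points
   having the defining property.  The normal is unique where it exists; so is
   the closest point to [z] when [z] is close to a boundary point near which
   the boundary is C^2. *)

Definition is_closest (R : realType) (d : nat) (D : set 'rV[C R]_d)
    (z q : 'rV[C R]_d) : Prop :=
  boundary D q /\ enorm (z - q) = bdist D z.

Definition closest (R : realType) (d : nat) (D : set 'rV[C R]_d)
    (z : 'rV[C R]_d) : 'rV[C R]_d :=
  xget 0 [set q | is_closest D z q].

Definition is_outer_normal (R : realType) (d : nat) (D : set 'rV[C R]_d)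
    (q nu : 'rV[C R]_d) : Prop :=
  boundary D q /\
  exists V r, defining_function D q V r /\
    nu = ((enorm (grad r q))^-1%:C%C : C R) *: grad r q.

Definition outer_normal (R : realType) (d : nat) (D : set 'rV[C R]_d)
    (q : 'rV[C R]_d) : 'rV[C R]_d :=
  xget 0 [set nu | is_outer_normal D q nu].

(* [|X_n|], the projection being taken at the boundary point closest to [z]. *)
Definition normal_length (R : realType) (d : nat) (D : set 'rV[C R]_d)
    (z X : 'rV[C R]_d) : R :=
  `|complex.Re (dotmx X (outer_normal D (closest D z)))|.

(* Main.v *)
(* If the derivative at 0 of g o phi is bounded by 1 for every analytic disc phi
   in D, then |g z - g w| <= k_D(z, w): this is the invariance of discs under
   Moebius maps, integrated along a radius.

   Such g are built from local holomorphic peak functions.  Let H be holomorphic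
   near p with Re H > 0 on D, and large compared with b away from a boundary
   point q.  For a disc phi with h0 = Re H(phi 0) small, the function
   |H - H0| / |H + conj H0| |1 - kappa H| composed with phi can be extended by a
   constant to the whole disc so that it is locally minorized by moduli of
   holomorphic functions, and the Schwarz lemma for such functions gives
   |(H o phi)'(0)| <= 2 h0 (1 + O(h0)).  Hence g = (ln h - L h) / 2, with
   h = Re H truncated at a small level, is nonexpansive, and so is a difference
   of two of these when the sublevel sets are disjoint.

   Near a strongly pseudoconvex point, H is a quadratic polynomial, obtained from
   the Taylor expansion of a defining function r at the closest point q of z,
   with Re H x >= c (delta x + |x - q|^2) on D and Re H z <= C delta z.  Write
   X = |(z - w)_n|.
   - One peak at q gives k >= c X / (delta z + X) and
     k >= ln (delta w / delta z) / 2 - C.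
   - The difference of the peaks at the closest points of z and w, truncated at
     the level c |z - w|^2 / 16, gives
     k >= ln (|z - w|^2 / sqrt (delta z delta w)) - C
     as soon as |z - w|^2 >= 4 (delta z + delta w).
   The theorem follows since X <= A (delta z + delta w + |z - w|^2). *)

Require Import Defs.
From mathcomp Require Import all_boot all_order all_algebra.
From mathcomp Require Import complex.
From mathcomp Require Import all_classical all_reals all_analysis.
From mathcomp Require Import ring lra.
Import Order.TTheory GRing.Theory Num.Theory numFieldNormedType.Exports.
Local Open Scope classical_set_scope.
Local Open Scope ring_scope.

Set Implicit Arguments.
Unset Strict Implicit.
Unset Printing Implicit Defensive.

(** The coefficient 1 in front of the logarithm dictates the precision of the Schwarz bound: a
    relative error O(h0), integrated against dh / h, costs the bounded term L h, whereas a constant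
    factor above 1 would remain in front of ln h. The obstacle is that a disc may leave the set
    where H is controlled; the factor 1 - kappa H, with kappa a multiple of h0, pays for this within
    the allowed O(h0). One peak yields only half of a logarithm. Two peaks truncated at a common
    level of order |z - w|^2 have disjoint sublevel sets, so near each point at most one of them
    varies, and their gains ln (|z - w|^2 / delta z) / 2 and ln (|z - w|^2 / delta w) / 2 add up
    without doubling the Lipschitz constant. With u = X / sqrt (delta z delta w), the goal ln (1 + c
    u) asks for ln u - C when u is large and for a multiple of u when u is small. The bound c X /
    (delta z + X) gives the latter if delta z = O(sqrt (delta z delta w)); otherwise delta z is
    large compared with delta w, and the half logarithm with z and w exchanged gives k >= 1. *)

(** * Bisection, mean values and primitives *)

(** If [P] failed, repeated quartering would give nested boxes on which it fails, shrinking to a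
    point where [local] applies. This is the compactness argument behind Goursat's theorem, the
    integration along a radius, and the connectedness of a segment. *)
Lemma cousin_box (R : realType) (P : R -> R -> R -> R -> Prop) (a b c d : R) :
  a <= b -> c <= d ->
  (forall a b c d m n, a <= b -> c <= d -> m = (a + b) / 2 -> n = (c + d) / 2 ->
     P a m c n -> P m b c n -> P a m n d -> P m b n d -> P a b c d) ->
  (forall x y, a <= x <= b -> c <= y <= d -> exists2 e, 0 < e &
     forall a' b' c' d', a <= a' <= x -> x <= b' <= b -> c <= c' <= y ->
       y <= d' <= d -> b' - a' < e -> d' - c' < e -> P a' b' c' d') ->
  P a b c d.
Proof.
move=> ab cd split4 local; apply: contrapT => nP.
pose Q (t : R * R * R * R) := P t.1.1.1 t.1.1.2 t.1.2 t.2.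
pose mx (t : R * R * R * R) := (t.1.1.1 + t.1.1.2) / 2.
pose my (t : R * R * R * R) := (t.1.2 + t.2) / 2.
pose sub (t t' : R * R * R * R) :=
  [/\ t.1.1.1 <= t'.1.1.1, t'.1.1.2 <= t.1.1.2, t.1.2 <= t'.1.2, t'.2 <= t.2 &
   t'.1.1.2 - t'.1.1.1 = (t.1.1.2 - t.1.1.1) / 2 /\
   t'.2 - t'.1.2 = (t.2 - t.1.2) / 2].
have step t : exists t', t.1.1.1 <= t.1.1.2 -> t.1.2 <= t.2 -> ~ Q t ->
    sub t t' /\ ~ Q t'.
  case: (pselect (t.1.1.1 <= t.1.1.2 /\ t.1.2 <= t.2 /\ ~ Q t)); last first.
    by move=> h; exists t => h1 h2 h3; case: h.
  move=> [t1 [t2 nQ]].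
  case: (pselect (Q (t.1.1.1, mx t, t.1.2, my t))) => [q1|]; last first.
    move=> q1; exists (t.1.1.1, mx t, t.1.2, my t) => _ _ _; split => //.
    rewrite /sub /mx /my /=; split; lra.
  case: (pselect (Q (mx t, t.1.1.2, t.1.2, my t))) => [q2|]; last first.
    move=> q2; exists (mx t, t.1.1.2, t.1.2, my t) => _ _ _; split => //.
    rewrite /sub /mx /my /=; split; lra.
  case: (pselect (Q (t.1.1.1, mx t, my t, t.2))) => [q3|]; last first.
    move=> q3; exists (t.1.1.1, mx t, my t, t.2) => _ _ _; split => //.
    rewrite /sub /mx /my /=; split; lra.
  case: (pselect (Q (mx t, t.1.1.2, my t, t.2))) => [q4|]; last first.
    move=> q4; exists (mx t, t.1.1.2, my t, t.2) => _ _ _; split => //.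
    rewrite /sub /mx /my /=; split; lra.
  exists t => _ _ _; exfalso; apply: nQ.
  exact: (split4 _ _ _ _ (mx t) (my t)).
have {step} [next nextP] := choice step.
pose B n := iter n next (a, b, c, d).
have BS n : B n.+1 = next (B n) by [].
have Binv n : [/\ (B n).1.1.1 <= (B n).1.1.2, (B n).1.2 <= (B n).2 & ~ Q (B n)].
  elim: n => [|n [h1 h2 h3]] //.
  by rewrite BS; have [[? ? ? ? [? ?]] ?] := nextP _ h1 h2 h3; split => //; lra.
have Bsub n : sub (B n) (B n.+1).
  by have [h1 h2 h3] := Binv n; rewrite BS; have [] := nextP _ h1 h2 h3.
have Bmono n k : [/\ (B n).1.1.1 <= (B (n + k)%N).1.1.1,
    (B (n + k)%N).1.1.2 <= (B n).1.1.2,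
    (B n).1.2 <= (B (n + k)%N).1.2 & (B (n + k)%N).2 <= (B n).2].
  elim: k => [|k [h1 h2 h3 h4]]; first by rewrite addn0.
  by rewrite addnS; have [? ? ? ? _] := Bsub (n + k)%N; split; lra.
have Bcross n m : (B n).1.1.1 <= (B m).1.1.2 /\ (B n).1.2 <= (B m).2.
  have [k [nk mk]] : exists k, (n <= k)%N /\ (m <= k)%N.
    by exists (maxn n m); rewrite leq_maxl leq_maxr.
  have [h1 _ h2 _] := Bmono n (k - n)%N; have [_ h3 _ h4] := Bmono m (k - m)%N.
  rewrite subnKC // in h1 h2; rewrite subnKC // in h3 h4.
  by have [? ? _] := Binv k; lra.
pose x := sup (range (fun n => (B n).1.1.1)).
pose y := sup (range (fun n => (B n).1.2)).
have xP n : (B n).1.1.1 <= x <= (B n).1.1.2.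
  apply/andP; split.
    apply: ub_le_sup; last by exists n.
    by exists (B 0%N).1.1.2 => _ [m _ <-]; case: (Bcross m 0%N).
  apply: ge_sup; first by exists (B 0%N).1.1.1; exists 0%N.
  by move=> _ [m _ <-]; case: (Bcross m n).
have yP n : (B n).1.2 <= y <= (B n).2.
  apply/andP; split.
    apply: ub_le_sup; last by exists n.
    by exists (B 0%N).2 => _ [m _ <-]; case: (Bcross m 0%N).
  apply: ge_sup; first by exists (B 0%N).1.2; exists 0%N.
  by move=> _ [m _ <-]; case: (Bcross m n).
have [e e0 eP] := local x y (xP 0%N) (yP 0%N).
have Bw n : (B n).1.1.2 - (B n).1.1.1 = (b - a) / 2 ^+ n /\
            (B n).2 - (B n).1.2 = (d - c) / 2 ^+ n.
  elim: n => [|n [h1 h2]]; first by rewrite expr0 !divr1.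
  have [_ _ _ _ [-> ->]] := Bsub n; rewrite h1 h2.
  by rewrite exprS invfM; split; ring.
have [n nP'] : exists n : nat, b - a < e * 2 ^+ n /\ d - c < e * 2 ^+ n.
  (* Since n < 2^n, an integer above [M] also serves as the exponent. *)
  pose M := (`|b - a| + `|d - c|) / e.
  have M0 : 0 <= M by rewrite divr_ge0 // ?ltW // addr_ge0.
  exists (Num.bound M).
  have Mb : M < 2 ^+ Num.bound M.
    apply: (lt_le_trans (archi_boundP M0)).
    by rewrite -natrX ler_nat ltnW // ltn_expl.
  have Me : `|b - a| + `|d - c| < e * 2 ^+ Num.bound M.
    by rewrite mulrC -ltr_pdivrMr.
  have := ler_norm (b - a); have := ler_norm (d - c).
  have := normr_ge0 (b - a); have := normr_ge0 (d - c).
  by move=> *; split; lra.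
have [_ _ nQ] := Binv n; apply: nQ.
have [w1 w2] := Bw n; have [h1 h2 h3 h4] := Bmono 0%N n.
have p2 : 0 < 2 ^+ n :> R by rewrite exprn_gt0.
case/andP: (xP n) => x1 x2; case/andP: (yP n) => y1 y2.
apply: eP.
- by rewrite x1 andbT.
- by rewrite x2.
- by rewrite y1 andbT.
- by rewrite y2.
- by rewrite w1 ltr_pdivrMr //; case: nP'.
- by rewrite w2 ltr_pdivrMr //; case: nP'.
Qed.

Lemma cousin_segment (R : realType) (P : R -> R -> Prop) (a b : R) :
  a <= b ->
  (forall a b m, a <= b -> m = (a + b) / 2 -> P a m -> P m b -> P a b) ->
  (forall x, a <= x <= b -> exists2 e, 0 < e &
     forall a' b', a <= a' <= x -> x <= b' <= b -> b' - a' < e -> P a' b') ->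
  P a b.
Proof.
move=> ab split2 local.
apply: (@cousin_box R (fun a b _ _ => P a b) a b 0 0) => //.
  by move=> a' b' c d m n ab' _ mE _ p1 p2 _ _; exact: (split2 _ _ m).
move=> x y /local[e e0 eP] _; exists e => // a' b' c' d' h1 h2 _ _ h3 _.
exact: eP.
Qed.

Lemma mean_value_bound (R : realType) (f f' : R -> R) (a b k M : R) : a <= b ->
  (forall x, a <= x <= b -> is_derive x 1 f (f' x)) ->
  (forall x, a <= x <= b -> `|f' x - k| <= M) ->
  `|f b - f a - k * (b - a)| <= M * (b - a).
Proof.
move=> ab df bd.
have cf : {within `[a, b], continuous f}.
  apply: derivable_within_continuous => x; rewrite in_itv /= => /df [].
  by [].
have [|c cab ->] := @MVT_segment R f f' a b ab _ cf.
  by move=> x; rewrite in_itv /= => /andP[x1 x2]; apply: df; rewrite !ltW.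
move: cab; rewrite in_itv /= => cab.
rewrite -mulrBl normrM (ger0_norm (_ : 0 <= b - a)) ?subr_ge0 //.
by rewrite ler_wpM2r ?subr_ge0 // bd.
Qed.

Lemma ex_primitive (R : realType) (f : R -> R) (a b : R) :
  (forall x, a <= x <= b -> {for x, continuous f}) ->
  exists F, forall x, a < x < b -> is_derive x 1 F (f x).
Proof.
move=> cf; exists (fun x => (\int[lebesgue_measure]_(t in [set` `[a, x]]) f t)%R).
move=> x /andP[ax xb].
have intf : lebesgue_measure.-integrable `[a, b] (EFin \o f).
  apply: continuous_compact_integrable; first exact: segment_compact.
  apply: continuous_in_subspaceT => y; rewrite inE /= in_itv /=.
  by move=> /cf.
have [|dF FE] := @continuous_FTC1_closed R f a x b xb intf ax.
  by apply: cf; rewrite !ltW.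
by apply: DeriveDef; [exact: dF|rewrite -derive1E].
Qed.

(** * Real Cauchy-Riemann equations *)

(** Complex differentiability of u + i v at one point, with derivative [al] + i [be], in real
    terms. *)
Definition cauchy_riemann (R : realType) (u v : R -> R -> R) (x y : R) :=
  exists al be, forall e, 0 < e -> exists2 s, 0 < s &
    forall x' y', `|x' - x| < s -> `|y' - y| < s ->
      `|u x' y' - u x y - (al * (x' - x) - be * (y' - y))|
        <= e * (`|x' - x| + `|y' - y|) /\
      `|v x' y' - v x y - (be * (x' - x) + al * (y' - y))|
        <= e * (`|x' - x| + `|y' - y|).

(** The equation says that u dx - v dy, the real part of (u + i v) dz, has integral 0 along the
    boundary, the integrals being increments of the primitives [Pu] and [Pv]. A bound e (width^2 +
    height^2) is the same for a rectangle as for its four quarters together, so it need only be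
    checked on small rectangles. *)
Lemma Goursat_rectangle (R : realType) (u v Pu Pv : R -> R -> R)
    (a b c d : R) : a <= b -> c <= d ->
  (forall x y, a <= x <= b -> c <= y <= d ->
     [/\ is_derive x 1 (Pu ^~ y) (u x y), is_derive y 1 (Pv x) (v x y) &
     cauchy_riemann u v x y]) ->
  Pu b c - Pu a c - (Pu b d - Pu a d)
    = Pv b d - Pv b c - (Pv a d - Pv a c).
Proof.
move=> ab cd H.
pose Phi a b c d := Pu b c - Pu a c - (Pu b d - Pu a d)
    - (Pv b d - Pv b c - (Pv a d - Pv a c)).
suff K e : 0 < e -> `|Phi a b c d| <= e * ((b - a) ^+ 2 + (d - c) ^+ 2).
  apply/eqP; rewrite -subr_eq0 -/(Phi a b c d) -normr_le0.
  apply/ler_addgt0Pr => e e0; rewrite add0r.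
  set S := (b - a) ^+ 2 + (d - c) ^+ 2 in K.
  have S0 : 0 <= S by rewrite addr_ge0 // sqr_ge0.
  have S1 : 0 < S + 1 by lra.
  have := K (e / (S + 1)) (divr_gt0 e0 S1).
  move=> /le_trans; apply.
  rewrite mulrAC ler_pdivrMr //; apply: ler_wpM2l; first exact: ltW.
  lra.
move=> e0.
apply: (@cousin_box R (fun a b c d =>
  `|Phi a b c d| <= e * ((b - a) ^+ 2 + (d - c) ^+ 2))) => //.
  move=> {ab cd H} {}a {}b {}c {}d m n _ _ -> ->.
  set A := Phi _ _ _ _; set B := Phi _ _ _ _; set C1 := Phi _ _ _ _.
  set D := Phi _ _ _ _ => hA hB hC hD.
  have -> : Phi a b c d = A + B + C1 + D by rewrite /A/B/C1/D/Phi; ring.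
  apply: (@le_trans _ _ (`|A| + `|B| + `|C1| + `|D|)).
    have := ler_normD (A + B + C1) D; have := ler_normD (A + B) C1.
    by have := ler_normD A B; lra.
  apply: (le_trans (lerD (lerD (lerD hA hB) hC) hD)).
  rewrite -!mulrDr [X in _ * X <= _](_ : _ = (b - a) ^+ 2 + (d - c) ^+ 2) //.
  by field.
move=> x y xab ycd; have [_ _ [al [be]]] := H x y xab ycd.
have e4 : 0 < e / 4 by lra.
move=> /(_ _ e4)[s s0 hs]; exists s => // a' b' c' d' a'x xb' c'y yd' w l.
case/andP: a'x => aa' a'x; case/andP: xb' => xb' b'b.
case/andP: c'y => cc' c'y; case/andP: yd' => yd' d'd.
have absle t (h1 : a' <= t) (h2 : t <= b') : `|t - x| <= b' - a'.
  by rewrite ler_norml; lra.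
have abslt t (h1 : c' <= t) (h2 : t <= d') : `|t - y| <= d' - c'.
  by rewrite ler_norml; lra.
(* The affine part of u contributes [be] times the area to the horizontal sides, and that of v
   contributes the same to the vertical sides in [E2]; only the errors survive in the difference. *)
have E1 : `|(Pu b' c' - Pu b' d') - (Pu a' c' - Pu a' d') -
     (be * (d' - c')) * (b' - a')|
   <= (e / 2 * ((b' - a') + (d' - c'))) * (b' - a').
  apply: (@mean_value_bound R (fun t => Pu t c' - Pu t d')
    (fun t => u t c' - u t d')) => [|t /andP[t1 t2]|t /andP[t1 t2]]; first lra.
    have [||h1 _ _] := H t c'; [lra|lra|].
    have [||h2 _ _] := H t d'; [lra|lra|].
    exact: is_deriveB.
  have tx := absle t t1 t2.
  have cy : `|c' - y| <= d' - c' by apply: abslt => //; lra.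
  have dy : `|d' - y| <= d' - c' by apply: abslt => //; lra.
  have [h1 _] : _ /\ _ := hs t c' (le_lt_trans tx w) (le_lt_trans cy l).
  have [h2 _] : _ /\ _ := hs t d' (le_lt_trans tx w) (le_lt_trans dy l).
  set X1 := u t c' - _ - _ in h1; set X2 := u t d' - _ - _ in h2.
  have -> : u t c' - u t d' - be * (d' - c') = X1 - X2 by rewrite /X1 /X2; ring.
  apply: (le_trans (ler_normB _ _)); apply: (le_trans (lerD h1 h2)).
  rewrite -mulrDr [X in _ <= X](_ : _ = e / 4 * (2 * (b' - a' + (d' - c')))).
    by apply: ler_wpM2l; [exact: ltW|lra].
  by field.
have E2 : `|(Pv b' d' - Pv a' d') - (Pv b' c' - Pv a' c') -
     (be * (b' - a')) * (d' - c')|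
   <= (e / 2 * ((b' - a') + (d' - c'))) * (d' - c').
  apply: (@mean_value_bound R (fun t => Pv b' t - Pv a' t)
    (fun t => v b' t - v a' t)) => [|t /andP[t1 t2]|t /andP[t1 t2]]; first lra.
    have [||_ h1 _] := H b' t; [lra|lra|].
    have [||_ h2 _] := H a' t; [lra|lra|].
    exact: is_deriveB.
  have ty := abslt t t1 t2.
  have ax : `|a' - x| <= b' - a' by apply: absle => //; lra.
  have bx : `|b' - x| <= b' - a' by apply: absle => //; lra.
  have [_ h1] : _ /\ _ := hs b' t (le_lt_trans bx w) (le_lt_trans ty l).
  have [_ h2] : _ /\ _ := hs a' t (le_lt_trans ax w) (le_lt_trans ty l).
  set X1 := v b' t - _ - _ in h1; set X2 := v a' t - _ - _ in h2.
  have -> : v b' t - v a' t - be * (b' - a') = X1 - X2 by rewrite /X1 /X2; ring.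
  apply: (le_trans (ler_normB _ _)); apply: (le_trans (lerD h1 h2)).
  rewrite -mulrDr [X in _ <= X](_ : _ = e / 4 * (2 * (b' - a' + (d' - c')))).
    by apply: ler_wpM2l; [exact: ltW|lra].
  by field.
set X1 := _ - _ - _ in E1; set X2 := _ - _ - _ in E2.
have -> : Phi a' b' c' d' = X1 - X2 by rewrite /X1 /X2 /Phi; ring.
apply: (le_trans (ler_normB _ _)); apply: (le_trans (lerD E1 E2)).
set p := b' - a'; set q := d' - c'.
have -> : e / 2 * (p + q) * p + e / 2 * (p + q) * q = e / 2 * (p + q) ^+ 2 by ring.
have := sqr_ge0 (p - q) => pq.
rewrite [X in _ <= X](_ : _ = e / 2 * (2 * (p ^+ 2 + q ^+ 2))); last by field.
by apply: ler_wpM2l; [lra|nra].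
Qed.

Lemma cauchy_riemann_continuous (R : realType) (u v : R -> R -> R) x y :
  cauchy_riemann u v x y -> forall e, 0 < e -> exists2 s, 0 < s &
    forall x' y', `|x' - x| < s -> `|y' - y| < s ->
      `|u x' y' - u x y| < e /\ `|v x' y' - v x y| < e.
Proof.
move=> [al [be H]] e e0; have [s s0 hs] := H 1 ltr01.
pose M := `|al| + `|be| + 1.
have M0 : 0 < M by rewrite ltr_wpDl // addr_ge0.
exists (Num.min s (e / (2 * M))).
  by rewrite lt_min s0 divr_gt0 // mulr_gt0.
move=> x' y'; rewrite !lt_min => /andP[x1 x2] /andP[y1 y2].
have [] := hs x' y' x1 y1; rewrite mul1r.
set X := x' - x in x1 x2 *; set Y := y' - y in y1 y2 * => h1 h2.
have XYe : M * (`|X| + `|Y|) < e.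
  rewrite (_ : e = M * (e / (2 * M) + e / (2 * M))).
    by rewrite ltr_pM2l // ltrD.
  by field; rewrite gt_eqF.
have hX := ler_norm (al * X); have hX' := ler_norm (- (al * X)).
have hY := ler_norm (be * Y); have hY' := ler_norm (- (be * Y)).
have kX := ler_norm (al * Y); have kX' := ler_norm (- (al * Y)).
have kY := ler_norm (be * X); have kY' := ler_norm (- (be * X)).
rewrite !normrN !normrM in hX hX' hY hY' kX kX' kY kY'.
have EM : M * (`|X| + `|Y|) = `|al| * `|X| + `|al| * `|Y| +
  (`|be| * `|X| + `|be| * `|Y|) + (`|X| + `|Y|) by rewrite /M; ring.
have p1 : 0 <= `|al| * `|X| by rewrite mulr_ge0.
have p2 : 0 <= `|al| * `|Y| by rewrite mulr_ge0.
have p3 : 0 <= `|be| * `|X| by rewrite mulr_ge0.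
have p4 : 0 <= `|be| * `|Y| by rewrite mulr_ge0.
move: h1 h2; rewrite !ler_norml !ltr_norml => /andP[q1 q2] /andP[q3 q4].
clear - XYe EM hX hX' hY hY' kX kX' kY kY' p1 p2 p3 p4 q1 q2 q3 q4.
move: XYe; rewrite EM; move: p1 p2 p3 p4 hX hX' hY hY' kX kX' kY kY' q1 q2 q3 q4.
move: (`|al| * `|X|) (`|al| * `|Y|) (`|be| * `|X|) (`|be| * `|Y|) (al * X) (be * Y)
  (al * Y) (be * X) (`|X| + `|Y|) (u _ _) (u _ _) (v _ _) (v _ _); clear.
by move=> *; split; apply/andP; split; lra.
Qed.

(** Were [L] positive, [g] would vanish at [c] and be positive just to its right, so that [f] would
    exceed its maximum there. *)
Lemma second_derivative_at_max (R : realType) (f g : R -> R) (c r L : R) :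
  0 < r -> (forall x, `|x - c| < r -> is_derive x 1 f (g x)) ->
  (forall x, `|x - c| < r -> f x <= f c) ->
  (forall e, 0 < e -> exists2 s, 0 < s & forall x, `|x - c| < s ->
     `|g x - g c - L * (x - c)| <= e * `|x - c|) ->
  L <= 0.
Proof.
move=> r0 df fmax dg; rewrite leNgt; apply/negP => L0.
have gc : g c = 0.
  have h : is_derive c 1 f 0.
    apply: (@derive1_at_max _ f (c - r) (c + r)).
    - lra.
    - move=> t; rewrite in_itv /= => ht; have [] // : is_derive t 1 f (g t).
      by apply: df; rewrite ltr_norml; lra.
    - by rewrite in_itv /=; lra.
    - move=> t; rewrite in_itv /= => ht.
      by apply: fmax; rewrite ltr_norml; lra.
  have h2 : is_derive c 1 f (g c) by apply: df; rewrite subrr normr0.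
  by rewrite -(@derive_val _ _ _ _ _ _ _ h2) (@derive_val _ _ _ _ _ _ _ h).
have L2 : 0 < L / 2 by lra.
have [s s0 hs] := dg _ L2.
pose t := Num.min r s / 2.
have [t0 tr ts] : [/\ 0 < t, t < r & t < s].
  have h : 0 < Num.min r s by rewrite lt_min r0.
  have h1 : Num.min r s <= r by rewrite ge_min lexx.
  have h2 : Num.min r s <= s by rewrite ge_min lexx orbT.
  by rewrite /t; split; lra.
have gpos x : c < x <= c + t -> 0 < g x.
  move=> hx; have := hs x; rewrite gc ger0_norm; last lra.
  move=> /(_ _)/wrap[]; first lra.
  rewrite ler_norml => /andP[h1 h2].
  have : 0 < L / 2 * (x - c) by rewrite mulr_gt0 //; lra.
  by lra.
have df' x : c <= x <= c + t -> is_derive x 1 f (g x).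
  by move=> hx; apply: df; rewrite ltr_norml; lra.
have cf : {within `[c, c + t], continuous f}.
  apply: derivable_within_continuous => x; rewrite in_itv /= => /df' [].
  by [].
have ct : c < c + t by lra.
have [|x xc] := @MVT R f g c (c + t) ct _ cf.
  by move=> x; rewrite in_itv /= => hx; apply: df'; lra.
rewrite in_itv /= in xc => E.
have : f (c + t) <= f c by apply: fmax; rewrite ltr_norml; lra.
rewrite -subr_le0 E leNgt mulr_gt0 //; last lra.
by apply: gpos; lra.
Qed.

Lemma is_derive1_littleoP (K : numFieldType) (f : K -> K) (x l : K) :
  is_derive x 1 f l <->
  forall e, 0 < e -> exists2 s, 0 < s &
    forall y, `|y - x| < s -> `|f y - f x - l * (y - x)| <= e * `|y - x|.
Proof.
split=> [[df <-] e e0|H].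
  have /cvgrPdist_le/(_ e e0) : (fun h => h^-1 *: (f (h *: 1 + x) - f x))
    @ 0^' --> 'D_1 f x by exact: df.
  move=> [s /= s0 hs]; exists s => // y yx.
  have [->|yNx] := eqVneq y x; first by rewrite !subrr mulr0 subrr normr0 mulr0.
  have yx0 : y - x != 0 by rewrite subr_eq0.
  have := hs (y - x); rewrite /ball_ /= sub0r normrN yx => /(_ isT yx0).
  rewrite -[_ *: 1]/(_ * 1) -[_ *: (_ - _)]/(_ * _) mulr1 subrK => h.
  rewrite -ler_pdivrMr ?normr_gt0 // -normf_div; rewrite distrC in h.
  by rewrite (_ : _ / _ = (y - x)^-1 * (f y - f x) - 'D_1 f x) //; field.
have L : (fun h => h^-1 *: (f (h *: 1 + x) - f x)) @ 0^' --> l.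
  apply/cvgrPdist_le => e e0; have [s s0 hs] := H e e0.
  exists s => // h; rewrite /ball_ /= sub0r normrN => hh h0.
  have := hs (h + x); rewrite addrK => /(_ hh).
  rewrite -[_ *: 1]/(_ * 1) -[_ *: (_ - _)]/(_ * _) mulr1 => hb.
  rewrite -ler_pdivrMr ?normr_gt0 // -normf_div in hb; rewrite distrC.
  by rewrite (_ : _ - l = (f (h + x) - f x - l * h) / h) //; field.
by apply: DeriveDef; [apply: (cvgP l)|exact: cvg_lim].
Qed.

Lemma is_derive1_translate (K : numFieldType) (f : K -> K) (x a l : K) :
  is_derive (x + a) 1 f l -> is_derive x 1 (fun t => f (t + a)) l.
Proof.
move=> /is_derive1_littleoP H; apply/is_derive1_littleoP => e /H[s s0 hs].
have E (y : K) : y - x = y + a - (x + a) by ring.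
by exists s => // y; rewrite E => /hs.
Qed.

Lemma is_derive1_sub (K : numFieldType) (f g : K -> K) (x l m : K) :
  is_derive x 1 f l -> is_derive x 1 g m ->
  is_derive x 1 (fun t => f t - g t) (l - m).
Proof. by move=> df dg; have := is_deriveB df dg. Qed.

Lemma is_derive1_lincomb (K : numFieldType) (f g : K -> K) (k x l m : K) :
  is_derive x 1 f l -> is_derive x 1 g m ->
  is_derive x 1 (fun t => k * f t + g t) (k * l + m).
Proof. by move=> df dg; have := is_deriveD (is_deriveZ k df) dg. Qed.

Lemma is_derive1_square (K : numFieldType) (a c x : K) :
  is_derive x 1 (fun t => a * (t ^+ 2 + c)) (2 * a * x).
Proof.
apply/is_derive1_littleoP => e e0.
have a0 : 0 < `|a| + 1 by rewrite ltr_wpDl.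
exists (e / (`|a| + 1)); first by rewrite divr_gt0.
move=> y yx.
rewrite (_ : _ - _ - _ = a * (y - x) * (y - x)); last by ring.
rewrite normrM ler_wpM2r // normrM.
apply: (@le_trans _ _ ((`|a| + 1) * `|y - x|)).
  by rewrite ler_wpM2r // lerDl.
by rewrite mulrC -ler_pdivlMr // ltW.
Qed.

Lemma mean_value_dist (R : realType) (f f' : R -> R) (c x M : R) :
  (forall z, `|z - c| <= `|x - c| -> is_derive z 1 f (f' z)) ->
  (forall z, `|z - c| <= `|x - c| -> `|f' z| <= M) ->
  `|f x - f c| <= M * `|x - c|.
Proof.
move=> df bd; have [cx|xc] := leP c x.
  have := @mean_value_bound R f f' c x 0 M cx.
  rewrite mul0r subr0 ger0_norm ?subr_ge0 // in df bd *; apply.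
    by move=> z hz; apply: df; rewrite ger0_norm; lra.
  by move=> z hz; rewrite subr0; apply: bd; rewrite ger0_norm; lra.
have := @mean_value_bound R f f' x c 0 M (ltW xc).
rewrite mul0r subr0 [`|f c - _|]distrC.
rewrite ltr0_norm ?subr_lt0 // opprB in df bd *; apply.
  by move=> z hz; apply: df; rewrite ler0_norm; lra.
by move=> z hz; rewrite subr0; apply: bd; rewrite ler0_norm; lra.
Qed.

Section DerivablePointwise.
Variable K : numFieldType.
Implicit Types (f g : K -> K) (z : K).

Lemma derivable_add f g z : derivable f z 1 -> derivable g z 1 ->
  derivable (fun w => f w + g w) z 1.
Proof. exact: derivableD. Qed.

Lemma derivable_sub f g z : derivable f z 1 -> derivable g z 1 ->
  derivable (fun w => f w - g w) z 1.
Proof. exact: derivableB. Qed.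

Lemma derivable_mul f g z : derivable f z 1 -> derivable g z 1 ->
  derivable (fun w => f w * g w) z 1.
Proof. exact: derivableM. Qed.

Lemma derivable_exp f n z : derivable f z 1 ->
  derivable (fun w => f w ^+ n) z 1.
Proof.
move=> df; elim: n => [|n IH]; first exact: derivable_cst.
have -> : (fun w => f w ^+ n.+1) = (fun w => f w * f w ^+ n).
  by apply/funext => w; rewrite exprS.
exact: derivable_mul.
Qed.

Lemma derivable_inv f z : derivable f z 1 -> f z != 0 ->
  derivable (fun w => (f w)^-1) z 1.
Proof. by move=> df fz; exact: derivableV. Qed.

Lemma derivable_div f g z : derivable f z 1 -> derivable g z 1 ->
  g z != 0 -> derivable (fun w => f w / g w) z 1.
Proof. by move=> df dg gz; exact (derivable_mul df (derivable_inv dg gz)). Qed.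

End DerivablePointwise.

Section ContinuousPointwise.
Variables (T : topologicalType) (R : realType).
Implicit Types (f g : T -> R) (x : T).

Lemma continuous_mul f g x : {for x, continuous f} -> {for x, continuous g} ->
  {for x, continuous (fun y => f y * g y)}.
Proof. by move=> cf cg; exact: continuousM. Qed.

Lemma continuous_exp f n x : {for x, continuous f} ->
  {for x, continuous (fun y => f y ^+ n)}.
Proof.
move=> cf; elim: n => [|n IH]; first exact: cvg_cst.
rewrite (_ : (fun y => _) = (fun y => f y * f y ^+ n)).
  exact: continuous_mul.
by apply/funext => y; rewrite exprS.
Qed.

Lemma continuous_div f g x : {for x, continuous f} -> {for x, continuous g} ->
  g x != 0 -> {for x, continuous (fun y => f y / g y)}.
Proof.
by move=> cf cg gx; apply: continuous_mul => //; exact: continuousV.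
Qed.

End ContinuousPointwise.

Lemma ltr_norm_dist (R : realType) (x p s r : R) :
  `|x - p| < r -> r <= s - `|p| -> `|x| < s.
Proof. by have := ler_normD (x - p) p; rewrite subrK; lra. Qed.

(* Averaging [u] over [[x, x + h]] gives a function [Z / h] with first-order
   derivatives that are differentiable; by Goursat's theorem for the form
   [u dx - v dy], its second derivatives in [x] and [y] are opposite, which
   contradicts the second derivative test at an interior maximum of
   [Z / h + eps / 2 (x^2 + y^2)].  No integral is needed, only primitives. *)
Lemma cauchy_riemann_no_strict_max (R : realType) (u v : R -> R -> R)
    (rho eps : R) :
  0 < rho -> 0 < eps ->
  (forall x y, `|x| <= rho -> `|y| <= rho -> cauchy_riemann u v x y) ->
  (forall x y, `|x| <= rho -> `|y| <= rho ->
     u x y + eps * (x ^+ 2 + y ^+ 2) <= u 0 0) -> False.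
Proof.
move=> rho0 eps0 CR umax.
have n0 : `|0 : R| <= rho by rewrite normr0 ltW.
have cvx (x y : R) : `|x| <= rho -> `|y| <= rho -> {for x, continuous (u ^~ y)}.
  move=> hx hy; apply/cvgrPdist_lt => e e0.
  have [s s0 hs] := cauchy_riemann_continuous (CR _ _ hx hy) e0.
  exists s => // t /= ts; rewrite distrC; apply: (hs t y _ _).1.
    by rewrite distrC.
  by rewrite subrr normr0.
have cvy (x y : R) : `|x| <= rho -> `|y| <= rho -> {for y, continuous (v x)}.
  move=> hx hy; apply/cvgrPdist_lt => e e0.
  have [s s0 hs] := cauchy_riemann_continuous (CR _ _ hx hy) e0.
  exists s => // t /= ts; rewrite distrC; apply: (hs x t _ _).2.
    by rewrite subrr normr0.
  by rewrite distrC.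
have : forall y : R, exists F : R -> R, `|y| <= rho ->
    forall x : R, `|x| < rho -> is_derive x 1 F (u x y).
  move=> y; case: (pselect (`|y| <= rho)) => hy; last by exists (fun=> 0).
  have [F FP] : exists F : R -> R, forall x, - rho < x < rho -> is_derive x 1 F (u x y).
    by apply: ex_primitive => x hx; apply: cvx => //; rewrite ler_norml.
  by exists F => _ x; rewrite ltr_norml; exact: FP.
move=> /choice[Q QP].
have : forall x : R, exists F : R -> R, `|x| <= rho ->
    forall y : R, `|y| < rho -> is_derive y 1 F (v x y).
  move=> x; case: (pselect (`|x| <= rho)) => hx; last by exists (fun=> 0).
  have [F FP] : exists F : R -> R, forall y, - rho < y < rho -> is_derive y 1 F (v x y).
    by apply: ex_primitive => y hy; apply: cvy => //; rewrite ler_norml.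
  by exists F => _ y; rewrite ltr_norml; exact: FP.
move=> /choice[Pv PvP].
pose s := rho / 2.
have s0 : 0 < s by rewrite divr_gt0.
have rhoE : rho = 2 * s by rewrite /s; field.
have es0 : 0 < eps * s ^+ 2 / 8 by rewrite divr_gt0 // mulr_gt0 // exprn_gt0.
have [h0 h00 hh0] := cauchy_riemann_continuous (CR 0 0 n0 n0) es0.
(* Averaging over a length below [h0] changes u at the origin by at most eps s^2 / 8, and h <= s /
   16 keeps the shifted points well inside the square of half-side [rho]. *)
pose h := Num.min h0 (s / 8) / 2.
have [hp hh hs] : [/\ 0 < h, h < h0 & h <= s / 16].
  have m0 : 0 < Num.min h0 (s / 8) by rewrite lt_min h00; lra.
  have m1 : Num.min h0 (s / 8) <= h0 by rewrite ge_min lexx.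
  have m2 : Num.min h0 (s / 8) <= s / 8 by rewrite ge_min lexx orbT.
  by rewrite /h; split; lra.
(* [Z x y] is the integral of u over [x, x + h] at height y. The primitives [Q y] are chosen
   separately for each y, but their constants cancel here; by [ZT], [Z] + [T] is constant in y, so
   that [Z] can be differentiated in y through [T]. *)
pose Z x y := Q y (x + h) - Q y x.
pose T x y := Pv (x + h) y - Pv x y.
have ZT x y y' : `|x| < s + h -> `|y| < rho -> `|y'| < rho ->
    Z x y' - Z x y = - (T x y' - T x y).
  move=> hx.
  have G y1 y2 : `|y1| < rho -> `|y2| < rho -> y1 <= y2 ->
      Z x y2 - Z x y1 = - (T x y2 - T x y1).
    rewrite !ltr_norml => hy1 hy2 y12; rewrite ltr_norml in hx.
    have := @Goursat_rectangle R u v (fun x y => Q y x) Pv x (x + h) y1 y2.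
    move=> /(_ _ y12)/wrap[]; first lra.
    move=> /(_ _)/wrap[].
      move=> a b ha hb; split.
      - by apply: QP; rewrite ?ler_norml ?ltr_norml; lra.
      - by apply: PvP; rewrite ?ler_norml ?ltr_norml; lra.
      - by apply: CR; rewrite ler_norml; lra.
    by rewrite /Z /T => E; lra.
  move=> hy hy'; case: (leP y y') => yy'; first exact: G.
  by have := G y' y hy' hy (ltW yy'); lra.
have dZx (x y : R) : `|x| < s + h -> `|y| < rho ->
    is_derive x 1 (Z ^~ y) (u (x + h) y - u x y).
  rewrite !ltr_norml => hx hy; apply: is_derive1_sub.
    apply: is_derive1_translate.
    by apply: QP; rewrite ?ler_norml ?ltr_norml; lra.
  by apply: QP; rewrite ?ler_norml ?ltr_norml; lra.
have dTy (x y : R) : `|x| < s + h -> `|y| < rho ->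
    is_derive y 1 (T x) (v (x + h) y - v x y).
  rewrite !ltr_norml => hx hy; apply: is_derive1_sub.
    by apply: PvP; rewrite ?ler_norml ?ltr_norml; lra.
  by apply: PvP; rewrite ?ler_norml ?ltr_norml; lra.
(* An average of u is a value of u at a point shifted by at most [h]; in this way the hypothesis
   [umax] passes to [Z / h]. *)
have mean (x y : R) : `|x| <= s -> `|y| <= s ->
    exists2 xi, x <= xi <= x + h & Z x y / h = u xi y.
  rewrite !ler_norml => hx hy.
  have dQ t : x <= t <= x + h -> is_derive t 1 (Q y) (u t y).
    by move=> ht; apply: QP; rewrite ?ler_norml ?ltr_norml; lra.
  have cQ : {within `[x, x + h], continuous (Q y)}.
    apply: derivable_within_continuous => t; rewrite in_itv /= => /dQ [].
    by [].
  have [||xi] := @MVT_segment R (Q y) (u ^~ y) x (x + h) _ _ cQ.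
  - lra.
  - by move=> t; rewrite in_itv /= => ht; apply: dQ; lra.
  rewrite in_itv /= => hxi E; exists xi => //.
  by rewrite /Z E addrAC subrr add0r mulfK // gt_eqF.
(* Only half of [eps] is spent here; the other half of the strictness in [umax] keeps the maximum of
   [W] away from the sides of the square. *)
pose W (p : R * R) := Z p.1 p.2 / h + eps / 2 * (p.1 ^+ 2 + p.2 ^+ 2).
pose K : set (R * R) := `[- s, s] `*` `[- s, s].
have KP (p : R * R) : K p <-> `|p.1| <= s /\ `|p.2| <= s.
  by rewrite /K /= !in_itv /= !ler_norml.
have cW (p : R * R) : `|p.1| <= s -> `|p.2| <= s -> {for p, continuous W}.
  move=> hx hy.
  suff cZ : (fun q : R * R => Z q.1 q.2) @ p --> Z p.1 p.2.
    apply: cvgD; first by apply: cvgM => //; exact: cvg_cst.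
    apply: cvgM; first exact: cvg_cst.
    by apply: cvgD; apply: cvgM; first [exact: cvg_fst|exact: cvg_snd].
  have hx' : `|p.1| < s + h by lra.
  have hy' : `|p.2| < rho by lra.
  apply/cvgrPdist_lt => e e0.
  have [||s1 s10 hs1] := cauchy_riemann_continuous (CR (p.1 + h) p.2 _ _) ltr01.
  - by move: hx; clear - rhoE hs hp s0; rewrite !ler_norml; lra.
  - by clear - hy rhoE s0; lra.
  have [||s2 s20 hs2] := cauchy_riemann_continuous (CR p.1 p.2 _ _) ltr01.
  - by clear - hx rhoE s0; lra.
  - by clear - hy rhoE s0; lra.
  have e20 : 0 < e / 2 by clear - e0; lra.
  have /cvgrPdist_lt/(_ _ e20)[s3 /= s30 hs3] : {for p.1, continuous (Z ^~ p.2)}.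
    apply/differentiable_continuous/derivable1_diffP.
    by case: (dZx _ _ hx' hy').
  pose M := `|v (p.1 + h) p.2| + `|v p.1 p.2| + 2.
  have M0 : 0 < M by rewrite ltr_wpDl // addr_ge0.
  pose t := Num.min (Num.min (Num.min s1 s2) (Num.min s3 h)) (e / (2 * M)).
  have t0 : 0 < t.
    by rewrite !lt_min s10 s20 s30 hp /= divr_gt0 // mulr_gt0.
  apply: filterS (nbhsx_ballx p t t0) => q [/=].
  rewrite /ball /= distrC => q1; rewrite distrC => q2; rewrite distrC.
  move: q1 q2; rewrite !lt_min => /andP[/andP[/andP[a1 a2] /andP[a3 a4]] _].
  move=> /andP[/andP[/andP[b1 b2] /andP[_ b4]] b5].
  have hq : `|q.1| < s + h.
    by clear - a4 hx; move: a4 hx; rewrite !ltr_norml !ler_norml; lra.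
  have E1 : `|T q.1 q.2 - T q.1 p.2| <= M * `|q.2 - p.2|.
    apply: (@mean_value_dist R (T q.1) (fun z => v (q.1 + h) z - v q.1 z)).
      move=> z hz; apply: dTy => //.
      have := le_lt_trans hz b4; move: hy; clear - rhoE hs s0.
      by rewrite !ltr_norml ler_norml; lra.
    move=> z hz.
    have [|| _ k1] := hs1 (q.1 + h) z.
    - by rewrite opprD addrACA subrr addr0.
    - exact: le_lt_trans hz b1.
    have [|| _ k2] := hs2 q.1 z => //.
    - exact: le_lt_trans hz b2.
    apply: (le_trans (ler_normB _ _)).
    have := ler_normD (v (q.1 + h) z - v (p.1 + h) p.2) (v (p.1 + h) p.2).
    have := ler_normD (v q.1 z - v p.1 p.2) (v p.1 p.2).
    by rewrite !subrK /M; clear - k1 k2; lra.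
  have E2 : M * `|q.2 - p.2| < e / 2.
    by move: b5; rewrite invfM mulrA ltr_pdivlMr // mulrC.
  have E3 : `|Z q.1 p.2 - Z p.1 p.2| < e / 2.
    by rewrite distrC; apply: hs3; rewrite /ball_ /= distrC.
  have hq2 : `|q.2| < rho.
    by move: b4 hy; clear - rhoE hs s0; rewrite !ltr_norml ler_norml; lra.
  rewrite -(subrK (Z q.1 p.2) (Z q.1 q.2)) -addrA.
  apply: (le_lt_trans (ler_normD _ _)).
  by rewrite ZT // normrN; clear - E1 E2 E3; lra.
have [p Kp Wmax] : exists2 p, K p & forall q, K q -> W q <= W p.
  have [|||p] := @compact_EVT_max _ R W K.
  - by exists ((0, 0) : R * R); apply: (proj2 (KP (0, 0))); split; rewrite /= normr0 ltW.
  - by apply: compact_setX; exact: segment_compact.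
  - apply: continuous_in_subspaceT => q; rewrite inE => /KP[? ?]; exact: cW.
  rewrite inE => Kp pmax; exists p => // q Kq; apply: pmax; exact/mem_set.
have [x1 x2] : `|p.1| <= s /\ `|p.2| <= s by apply/KP.
have W0 : u 0 0 - eps * s ^+ 2 / 8 <= W p.
  apply: (@le_trans _ _ (W (0, 0))); last first.
    by apply: Wmax; apply: (proj2 (KP (0, 0))); split; rewrite /= normr0 ltW.
  rewrite /W /=; have [||xi hxi ->] := mean 0 0; rewrite ?normr0 ?(ltW s0) //.
  rewrite add0r in hxi.
  have [|| + _] := hh0 xi 0; rewrite ?subrr ?normr0 // ?subr0.
    by clear - hxi hh hp; rewrite ger0_norm; lra.
  by rewrite expr0n /= addr0 mulr0 addr0 ltr_norml; clear => hxi2; lra.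
have interior : `|p.1| < s /\ `|p.2| < s.
  suff : p.1 ^+ 2 + p.2 ^+ 2 < s ^+ 2.
    move=> lt; have h1 := sqr_ge0 p.1; have h2 := sqr_ge0 p.2.
    by split; rewrite -(ltr_pXn2r (n := 2)) ?nnegrE ?normr_ge0 ?ltW //
       -normrX ger0_norm ?sqr_ge0 //; clear - lt h1 h2; lra.
  rewrite ltNge; apply/negP => le.
  move: W0; rewrite /W; have [xi hxi ->] := mean _ _ x1 x2.
  move: x1 x2; rewrite !ler_norml => x1 x2.
  have hxi1 : `|xi| <= rho by clear - x1 hxi rhoE hs s0; rewrite ler_norml; lra.
  have hp2 : `|p.2| <= rho by clear - x2 rhoE s0; rewrite ler_norml; lra.
  move: (umax xi p.2 hxi1 hp2).
  clear - x1 x2 hxi hs hp s0 eps0 le.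
  have : p.1 ^+ 2 - 2 * (s * h) <= xi ^+ 2 by nra.
  have : s * h <= s ^+ 2 / 16 by nra.
  have : 0 < s ^+ 2 by rewrite exprn_gt0.
  set A := p.1 ^+ 2 in le *; set B := p.2 ^+ 2 in le *; set S := s ^+ 2 in le *.
  set X := xi ^+ 2; set SH := s * h => S0 h1 h2 h3.
  have E1 : eps * (X + B) >= eps * (A + B - S / 8) by rewrite ler_pM2l //; lra.
  have E2 : eps * (A + B) >= eps * S by rewrite ler_pM2l //; lra.
  have E3 : 0 < eps * S by rewrite mulr_gt0.
  by lra.
case: interior => i1 i2.
have srho : s < rho by rewrite rhoE mulr_natl mulr2n ltrDl.
have [al1 [be1 CR1]] : cauchy_riemann u v (p.1 + h) p.2.
  apply: CR; last by apply: ltW; exact: lt_trans srho.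
  by apply: (le_trans (ler_normD _ _)); rewrite (gtr0_norm hp); clear - i1 hs rhoE s0; lra.
have [al2 [be2 CR2]] : cauchy_riemann u v p.1 p.2.
  by apply: CR; apply: ltW; exact: lt_trans srho.
pose r := Num.min (s - `|p.1|) (s - `|p.2|).
have r0 : 0 < r by rewrite lt_min !subr_gt0 i1.
have r1 : r <= s - `|p.1| by rewrite ge_min lexx.
have r2 : r <= s - `|p.2| by rewrite ge_min lexx orbT.
have iu (x y al be : R) : (forall e : R, 0 < e -> exists2 s, 0 < s &
    forall x' y' : R, `|x' - x| < s -> `|y' - y| < s ->
      `|u x' y' - u x y - (al * (x' - x) - be * (y' - y))|
        <= e * (`|x' - x| + `|y' - y|) /\
      `|v x' y' - v x y - (be * (x' - x) + al * (y' - y))|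
        <= e * (`|x' - x| + `|y' - y|)) ->
    is_derive x 1 (u ^~ y) al /\ is_derive y 1 (v x) al.
  move=> CRxy; split; apply/is_derive1_littleoP => e /CRxy[d d0 hd].
    exists d => // t td; have [|+ _] := hd t y td; first by rewrite subrr normr0.
    by rewrite subrr normr0 mulr0 subr0 addr0.
  exists d => // t td; have [|_] := hd x t _ td; first by rewrite subrr normr0.
  by rewrite subrr normr0 mulr0 !add0r.
have [du1 dv1] := iu _ _ _ _ CR1; have [du2 dv2] := iu _ _ _ _ CR2.
(* [al1] and [al2] are the common values of u_x and v_y at the two ends of the averaging interval.
   The second derivatives of Z / h in x and in y are therefore opposite, while [W] has [eps] more in
   each direction; adding [D1] and [D2] gives 2 eps <= 0. *)
have D1 : (al1 - al2) / h + eps <= 0.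
  apply: (@second_derivative_at_max R (fun x => W (x, p.2))
    (fun x => (u (x + h) p.2 - u x p.2) / h + eps * x) p.1 r).
  - by [].
  - move=> x hx; have hx' : `|x| < s.
      exact: ltr_norm_dist hx r1.
    have hxh : `|x| < s + h by clear - hx' hp; lra.
    have hpr : `|p.2| < rho by clear - i2 rhoE s0; lra.
    have d0 := is_derive1_lincomb h^-1 (dZx x p.2 hxh hpr)
      (is_derive1_square (eps / 2) (p.2 ^+ 2) x).
    rewrite (_ : 2 * (eps / 2) = eps) in d0; last by field.
    rewrite [_^-1 * _]mulrC in d0.
    rewrite (_ : (fun t => _) = (fun x => W (x, p.2))) // in d0.
    by apply/funext => t; rewrite /W /= [_^-1 * _]mulrC.
  - move=> x hx; apply: Wmax; apply: (proj2 (KP _)); rewrite /= (ltW i2); split => //.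
    exact: ltW (ltr_norm_dist hx r1).
  - apply/is_derive1_littleoP.
    have d1 := is_derive1_lincomb h^-1 (is_derive1_sub (is_derive1_translate du1) du2)
      (is_deriveZ eps (is_derive_id p.1 1)).
    rewrite /GRing.scale /= mulr1 [_^-1 * _]mulrC in d1.
    rewrite (_ : (fun t => _) = (fun x => (u (x + h) p.2 - u x p.2) / h + eps * x)) // in d1.
    by apply/funext => t; rewrite mulrC.
have D2 : (al2 - al1) / h + eps <= 0.
  apply: (@second_derivative_at_max R (fun y => W (p.1, y))
    (fun y => - (v (p.1 + h) y - v p.1 y) / h + eps * y) p.2 r).
  - by [].
  - move=> y hy; have hy' : `|y| < s.
      exact: ltr_norm_dist hy r2.
    have hp1 : `|p.1| < s + h by apply: (lt_trans i1); rewrite ltrDl.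
    have n0r : `|0 : R| < rho by rewrite normr0.
    have hyr := lt_trans hy' srho.
    (* The constant added under the square is chosen so that the function differentiated is exactly
       [W] along the vertical line, with [Z] rewritten as a constant minus [T]. *)
    have d0 := is_derive1_lincomb (- h^-1) (dTy p.1 y hp1 hyr)
      (is_derive1_square (eps / 2) (p.1 ^+ 2 +
         (Z p.1 0 + T p.1 0) / h / (eps / 2)) y).
    rewrite (_ : 2 * (eps / 2) = eps) in d0; last by field.
    rewrite (_ : - h^-1 * _ + _ = - (v (p.1 + h) y - v p.1 y) / h + eps * y)
      in d0; last by ring.
    move/is_derive1_littleoP : d0 => d0; apply/is_derive1_littleoP => e.
    move=> /d0[d d0' hd]; exists (Num.min d (s - `|y|)).
      by rewrite lt_min d0' subr_gt0.
    have WE z : `|z| < s -> W (p.1, z) = - h^-1 * T p.1 z + eps / 2 *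
        (z ^+ 2 + (p.1 ^+ 2 + (Z p.1 0 + T p.1 0) / h / (eps / 2))).
      move=> hz; rewrite /W /=.
      have -> : Z p.1 z = Z p.1 0 + T p.1 0 - T p.1 z.
        have := ZT p.1 0 z hp1 n0r (lt_trans hz srho).
        by move: (Z p.1 z) (Z p.1 0) (T p.1 z) (T p.1 0); clear => *; lra.
      by field; rewrite !gt_eqF.
    move=> z; rewrite lt_min => /andP[z1 z2].
    have hz : `|z| < s by exact: ltr_norm_dist z2 (lexx _).
    by rewrite !WE //; exact: hd.
  - move=> y hy; apply: Wmax; apply: (proj2 (KP _)); rewrite /= (ltW i1); split => //.
    exact: ltW (ltr_norm_dist hy r2).
  - apply/is_derive1_littleoP.
    have d1 := is_derive1_lincomb (- h^-1) (is_derive1_sub dv1 dv2)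
      (is_deriveZ eps (is_derive_id p.2 1)).
    rewrite /GRing.scale /= mulr1 in d1.
    rewrite (_ : (_ - _) / h = - h^-1 * (al1 - al2)); last by ring.
    rewrite (_ : (fun t => _) = (fun y => - (v (p.1 + h) y - v p.1 y) / h + eps * y)) // in d1.
    apply/funext => t.
    change (- h^-1 * (v (p.1 + h) t - v p.1 t) + eps * t
      = - (v (p.1 + h) t - v p.1 t) / h + eps * t).
    by ring.
have E : (al1 - al2) / h + (al2 - al1) / h = 0.
  by rewrite -mulrDl addrA subrK subrr mul0r.
by clear - D1 D2 E eps0; lra.
Qed.

(** * Maximum principle and Schwarz lemma *)

Definition cmod (R : realType) (z : C R) : R := complex.Re `|z|.

Section Cmod.
Variable R : realType.
Implicit Types (x y z : C R) (e : R).

Lemma cmodE z : `|z| = (cmod z)%:C%C :> C R.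
Proof. by rewrite /cmod; case: z => a b; rewrite normc_def. Qed.

Lemma cmod_sqr z : cmod z ^+ 2 = complex.Re z ^+ 2 + complex.Im z ^+ 2.
Proof.
by rewrite /cmod normc_def /= sqr_sqrtr // addr_ge0 // sqr_ge0.
Qed.

Lemma cmod_ge0 z : 0 <= cmod z.
Proof. by rewrite /cmod normc_def /= sqrtr_ge0. Qed.

Lemma ReD x y : complex.Re (x + y) = complex.Re x + complex.Re y.
Proof. by case: x; case: y. Qed.
Lemma ImD x y : complex.Im (x + y) = complex.Im x + complex.Im y.
Proof. by case: x; case: y. Qed.
Lemma ReN x : complex.Re (- x) = - complex.Re x.
Proof. by case: x. Qed.
Lemma ImN x : complex.Im (- x) = - complex.Im x.
Proof. by case: x. Qed.
Lemma ReM x y : complex.Re (x * y) =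
  complex.Re x * complex.Re y - complex.Im x * complex.Im y.
Proof. by case: x; case: y. Qed.
Lemma ImM x y : complex.Im (x * y) =
  complex.Re x * complex.Im y + complex.Im x * complex.Re y.
Proof. by case: x => a b; case: y => c d /=; rewrite addrC. Qed.

Lemma complex_eq x y :
  complex.Re x = complex.Re y -> complex.Im x = complex.Im y -> x = y.
Proof. by case: x => a b; case: y => c d /= -> ->. Qed.

Lemma cmod_of_real e : 0 <= e -> cmod e%:C%C = e.
Proof.
move=> e0; apply/eqP; rewrite -(eqrXn2 (n := 2)) ?cmod_ge0 // cmod_sqr /=.
by rewrite expr0n addr0.
Qed.

Lemma cmodM x y : cmod (x * y) = cmod x * cmod y.
Proof.
apply/eqP; rewrite -(eqrXn2 (n := 2)) ?mulr_ge0 ?cmod_ge0 // exprMn !cmod_sqr.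
by rewrite ReM ImM; apply/eqP; ring.
Qed.

Lemma cmodD x y : cmod (x + y) <= cmod x + cmod y.
Proof.
have := ler_normD x y; rewrite !cmodE -rmorphD.
by rewrite lecR.
Qed.

Lemma cmodN x : cmod (- x) = cmod x.
Proof. by rewrite /cmod normrN. Qed.
Lemma cmodB x y : cmod (x - y) = cmod (y - x).
Proof. by rewrite /cmod distrC. Qed.
Lemma cmod0 : cmod (0 : C R) = 0.
Proof. by rewrite /cmod normr0. Qed.
Lemma cmod1 : cmod (1 : C R) = 1.
Proof. by rewrite /cmod normr1. Qed.
Lemma cmod_eq0 x : (cmod x == 0) = (x == 0).
Proof. by rewrite -(normr_eq0 x) cmodE eq_complex /= eqxx andbT. Qed.
Lemma cmod_gt0 x : (0 < cmod x) = (x != 0).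
Proof. by rewrite lt_def cmod_ge0 andbT cmod_eq0. Qed.
Lemma cmodV x : cmod (x^-1) = (cmod x)^-1.
Proof.
have [->|x0] := eqVneq x 0; first by rewrite invr0 cmod0 invr0.
apply: (mulfI (x := cmod x)); first by rewrite cmod_eq0.
by rewrite -cmodM !mulfV ?cmod1 // cmod_eq0.
Qed.
Lemma cmodX x n : cmod (x ^+ n) = cmod x ^+ n.
Proof. by elim: n => [|n IH]; rewrite ?expr0 ?cmod1 // !exprS cmodM IH. Qed.

Lemma Re_le_cmod x : `|complex.Re x| <= cmod x.
Proof.
rewrite -(ler_pXn2r (n := 2)) ?nnegrE ?cmod_ge0 // cmod_sqr.
by rewrite -normrX ger0_norm ?sqr_ge0 // lerDl sqr_ge0.
Qed.
Lemma Im_le_cmod x : `|complex.Im x| <= cmod x.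
Proof.
rewrite -(ler_pXn2r (n := 2)) ?nnegrE ?cmod_ge0 // cmod_sqr.
by rewrite -normrX ger0_norm ?sqr_ge0 // lerDr sqr_ge0.
Qed.
Lemma cmod_le x : cmod x <= `|complex.Re x| + `|complex.Im x|.
Proof.
rewrite -(ler_pXn2r (n := 2)) ?nnegrE ?addr_ge0 ?cmod_ge0 // cmod_sqr sqrrD.
rewrite -!normrX !(ger0_norm (sqr_ge0 _)) -addrA lerD2l.
by rewrite lerDr mulrn_wge0 // mulr_ge0.
Qed.

Lemma ltc_cmod x e : (`|x| < e%:C%C :> C R) = (cmod x < e).
Proof. by rewrite cmodE ltcR. Qed.
Lemma gt0_complexP (e : C R) : 0 < e -> exists2 r, 0 < r & e = r%:C%C.
Proof.
case: e => a b; rewrite ltcE /= => /andP[/eqP -> a0].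
by exists a.
Qed.

Lemma nbhs_complexP (z : C R) (A : set (C R)) :
  nbhs z A <-> exists2 e, 0 < e & forall y, cmod (y - z) < e -> A y.
Proof.
split=> [/nbhs_ballP[e /= /gt0_complexP[r r0 ->] h]|[e e0 h]].
  by exists r => // y yz; apply: h; rewrite /ball /= distrC ltc_cmod.
apply/nbhs_ballP; exists e%:C%C; first by rewrite /= ltcR.
by move=> y; rewrite /ball /= distrC ltc_cmod; exact: h.
Qed.

Lemma is_derive1_cmodP (f : C R -> C R) z l :
  is_derive z 1 f l <->
  forall e, 0 < e -> exists2 s, 0 < s &
    forall y, cmod (y - z) < s ->
      cmod (f y - f z - l * (y - z)) <= e * cmod (y - z).
Proof.
rewrite is_derive1_littleoP; split=> H e e0.
  have [|s /gt0_complexP[r r0 ->] hs] := H e%:C%C; first by rewrite ltcR.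
  exists r => // y; rewrite -ltc_cmod => /hs.
  by rewrite !cmodE -rmorphM lecR.
have {e0} [r r0 ->] := gt0_complexP e0.
have [s s0 hs] := H r r0; exists s%:C%C; first by rewrite ltcR.
by move=> y; rewrite ltc_cmod => /hs; rewrite !cmodE -rmorphM lecR.
Qed.

Lemma continuous_complexP (f : C R -> R) (z : C R) :
  {for z, continuous f} <->
  forall e, 0 < e -> exists2 s, 0 < s &
    forall y, cmod (y - z) < s -> `|f y - f z| < e.
Proof.
split=> [cf e e0|H P /nbhs_ballP[e /= e0 he]].
  have /nbhs_complexP[s s0 hs] : nbhs z (f @^-1` ball (f z) e).
    by apply: cf; exact: nbhsx_ballx.
  by exists s => // y /hs; rewrite /ball /= distrC.
have [s s0 hs] := H e e0; apply/nbhs_complexP; exists s => // y /hs yz.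
by apply: he; rewrite /ball /= distrC.
Qed.

Lemma continuous_cmod (z : C R) : {for z, continuous (fun y : C R => cmod y)}.
Proof.
apply/continuous_complexP => e e0; exists e => // y yz.
apply: le_lt_trans yz; rewrite ler_norml.
have := cmodD (y - z) z; have := cmodD (z - y) y.
by rewrite !subrK (cmodB z); lra.
Qed.

End Cmod.

Section MaxPrinciple.
Variable R : realType.
Implicit Types (z : C R) (e : R).

Lemma holo_no_strict_max (f : C R -> C R) z0 eps rho : 0 < eps -> 0 < rho ->
  (forall z, cmod (z - z0) < rho -> derivable f z 1) ->
  (forall z, cmod (z - z0) < rho ->
     complex.Re (f z) + eps * cmod (z - z0) ^+ 2 <= complex.Re (f z0)) -> False.
Proof.
move=> eps0 rho0 df fmax.
pose pt (x y : R) : C R := z0 + (x +i* y)%C.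
have ptE x y : pt x y - z0 = (x +i* y)%C by rewrite /pt addrAC subrr add0r.
have ptB x y x' y' : pt x' y' - pt x y = ((x' - x) +i* (y' - y))%C.
  by apply: complex_eq; rewrite /pt !(ReD, ReN, ImD, ImN) /=; ring.
have small x y r : 0 < r -> `|x| < r / 2 -> `|y| < r / 2 ->
    cmod (x +i* y : C R)%C < r.
  by move=> *; apply: (le_lt_trans (cmod_le _)) => /=; lra.
apply: (@cauchy_riemann_no_strict_max R (fun x y => complex.Re (f (pt x y)))
  (fun x y => complex.Im (f (pt x y))) (rho / 4) eps) => //.
- by lra.
- move=> x y hx hy.
  have dz : derivable f (pt x y) 1.
    by apply: df; rewrite ptE; apply: small => //; lra.
  have [l dl] : exists l, is_derive (pt x y) 1 f l.
    by exists ('D_1 f (pt x y)); exact: DeriveDef.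
  exists (complex.Re l), (complex.Im l) => e e0.
  have /is_derive1_cmodP/(_ e e0)[s s0 hs] := dl.
  exists (s / 2); first by lra.
  move=> x' y' hx' hy'.
  have := hs (pt x' y'); rewrite ptB => /(_ _)/wrap[]; first exact: small.
  set w := f _ - f _ - _ => hw.
  have hw' : cmod w <= e * (`|x' - x| + `|y' - y|).
    by apply: (le_trans hw); rewrite ler_wpM2l ?(ltW e0) // (le_trans (cmod_le _)).
  have := Re_le_cmod w; have := Im_le_cmod w.
  rewrite /w !(ReD, ImD, ReN, ImN, ReM, ImM) /= => h1 h2; split.
    exact: le_trans h2 hw'.
  by rewrite (addrC (complex.Im l * _)); exact: le_trans h1 hw'.
- move=> x y hx hy.
  have := fmax (pt x y); rewrite ptE => /(_ _)/wrap[].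
    by apply: small => //; lra.
  rewrite cmod_sqr /= (_ : pt 0 0 = z0) // /pt.
  by apply: complex_eq; rewrite ?ReD ?ImD /= addr0.
Qed.

Lemma unimodular_to_cmod z : exists c, cmod c = 1 /\ c * z = (cmod z)%:C%C.
Proof.
have [->|z0] := eqVneq z 0.
  by exists 1; rewrite cmod1 mul1r cmod0.
have cz : (cmod z)%:C%C != 0 :> C R.
  by rewrite -cmodE normr_eq0.
exists ((cmod z)%:C%C / z); split; last by rewrite mulfVK.
by rewrite cmodM cmodV cmod_of_real ?cmod_ge0 // mulfV // cmod_eq0.
Qed.

(* Stands in for subharmonicity: it passes to maxima and makes the maximum
   principle a statement about a single holomorphic function. *)
Definition holo_minorant_at (A : set (C R)) (u : C R -> R) z :=
  exists f rho, [/\ 0 < rho, cmod (f z) = u z &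
    forall z', cmod (z' - z) < rho ->
      [/\ A z', derivable f z' 1 & cmod (f z') <= u z']].

(** [eps] is so small that u still exceeds [K] at a maximum point of u + eps |z|^2 on [A]. There u
    has a holomorphic minorant, and this contradicts [holo_no_strict_max]. *)
Lemma max_principle (A : set (C R)) (u : C R -> R) (B K : R) :
  compact A -> (forall z, A z -> cmod z <= B) -> {within A, continuous u} ->
  (forall z, A z -> u z <= K \/ holo_minorant_at A u z) ->
  forall z, A z -> u z <= K.
Proof.
move=> cA AB cu H z1 Az1; rewrite leNgt; apply/negP => Kz1.
have B0 : 0 <= B by rewrite (le_trans (cmod_ge0 _) (AB _ Az1)).
pose eps := (u z1 - K) / (2 * (B ^+ 2 + 1)).
have B1 : 0 < B ^+ 2 + 1 by rewrite ltr_wpDl // sqr_ge0.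
have eps0 : 0 < eps by rewrite divr_gt0 ?mulr_gt0 // subr_gt0.
have epsB z : A z -> eps * cmod z ^+ 2 < u z1 - K.
  move=> Az; apply: (@le_lt_trans _ _ (eps * (B ^+ 2 + 1))).
    rewrite ler_wpM2l ?(ltW eps0) //.
    by rewrite ler_wpDr // lerXn2r ?nnegrE ?cmod_ge0 // AB.
  by rewrite /eps invfM mulrA mulfVK ?gt_eqF //; lra.
have ccont : {within A, continuous (fun z : C R => cmod z)}.
  by apply: continuous_subspaceT => z; exact: continuous_cmod.
have [||| z] := @compact_EVT_max _ R (fun z => u z + eps * cmod z ^+ 2) A.
- by exists z1.
- by [].
- move=> z; apply: cvgD; first exact: cu.
  apply: cvgM; first exact: cvg_cst.
  by apply: cvgM; exact: ccont.
rewrite inE => Az zmax.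
have Kz : K < u z.
  have := zmax z1; rewrite inE => /(_ Az1).
  have := epsB z Az; have := mulr_ge0 (ltW eps0) (sqr_ge0 (cmod z1)).
  by lra.
have [|[f [rho [rho0 fz fmin]]]] := H z Az; first by rewrite leNgt Kz.
have [c [c1 cfz]] := unimodular_to_cmod (f z).
(* The rotation [c] makes the minorant real and nonnegative at z. As |w|^2 = |z|^2 + 2 Re (conj z (w
   - z)) + |w - z|^2, the linear term turns the perturbation eps |w|^2 into the eps |w - z|^2 of a
   strict maximum. *)
pose g (w : C R) := c * f w + (2 * eps)%:C%C * (conjc z) * (w - z).
apply: (@holo_no_strict_max g z eps rho eps0 rho0).
  move=> w /fmin[_ dw _]; apply: derivable_add.
    by apply: derivable_mul; [exact: derivable_cst|exact: dw].
  apply: derivable_mul; first exact: derivable_cst.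
  by apply: derivable_sub; [exact: derivable_id|exact: derivable_cst].
move=> w /fmin[Aw _ fw].
have := zmax w; rewrite inE => /(_ Aw); rewrite -fz => le.
rewrite /g subrr mulr0 addr0 cfz !cmod_sqr /= in le *.
rewrite ReD.
have := Re_le_cmod (c * f w); rewrite cmodM c1 mul1r => h1.
have h2 := ler_norm (complex.Re (c * f w)).
have E : eps * (complex.Re w ^+ 2 + complex.Im w ^+ 2) -
   eps * (complex.Re z ^+ 2 + complex.Im z ^+ 2) =
   complex.Re ((2 * eps)%:C%C * conjc z * (w - z) : C R) +
   eps * (complex.Re (w - z) ^+ 2 + complex.Im (w - z) ^+ 2).
  by case: (z) (w) => a b [a' b'] /=; ring.
by lra.
Qed.

End MaxPrinciple.

Section Schwarz.
Variable R : realType.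
Implicit Types (z : C R) (e : R).

(** A bounded set lies in the image of a compact real square under (x, y) -> x + i y. *)
Lemma bounded_closed_compact_complex (A : set (C R)) (B : R) :
  closed A -> (forall z, A z -> cmod z <= B) -> compact A.
Proof.
move=> cA AB; pose j (p : R * R) : C R := (p.1 +i* p.2)%C.
have cj : continuous j.
  move=> p P /nbhs_complexP[e e0 he].
  have e2 : 0 < e / 2 by lra.
  apply: filterS (nbhsx_ballx p (e / 2) e2) => q [/=].
  rewrite /ball /= distrC => q1; rewrite distrC => q2.
  apply: he; apply: (le_lt_trans (cmod_le _)).
  by rewrite !(ReD, ImD, ReN, ImN) /=; lra.
apply: (subclosed_compact cA (B := j @` (`[- B, B] `*` `[- B, B]))).
  apply: continuous_compact; first exact: continuous_subspaceT.
  by apply: compact_setX; exact: segment_compact.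
move=> z /AB zB; exists (complex.Re z, complex.Im z); last by case: z {zB}.
rewrite /= !in_itv /= -!ler_norml.
by split; [have := Re_le_cmod z|have := Im_le_cmod z]; lra.
Qed.

Lemma compact_annulus (s t : R) : compact [set z : C R | s <= cmod z <= t].
Proof.
apply: (@bounded_closed_compact_complex _ t); last by move=> z /= /andP[].
have -> : [set z : C R | s <= cmod z <= t] = (@cmod R) @^-1` `[s, t].
  by apply/seteqP; split=> z /=; rewrite in_itv.
apply: preimage_closed; last exact: itv_closed.
by move=> z _; exact: continuous_cmod.
Qed.

(** By Bernoulli's inequality; it replaces taking n-th roots and letting n tend to infinity. *)
Lemma expr_bounded_le1 (a K : R) : 0 <= a -> (forall n, a ^+ n <= K) -> a <= 1.
Proof.
move=> a0 H; rewrite leNgt; apply/negP => a1.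
pose h := a - 1; have h0 : 0 < h by rewrite subr_gt0.
have bern n : 1 + n%:R * h <= a ^+ n.
  elim: n => [|n IH]; first by rewrite mul0r addr0 expr0.
  rewrite exprS -natr1.
  apply: (@le_trans _ _ (a * (1 + n%:R * h))); last by rewrite ler_wpM2l.
  have : 0 <= n%:R * h ^+ 2 by rewrite mulr_ge0 ?ler0n ?sqr_ge0.
  by rewrite (_ : a = 1 + h); [nra|rewrite /h; ring].
have K0 : 0 <= K by have := H 0%N; rewrite expr0; lra.
have := archi_boundP (divr_ge0 K0 (ltW h0)).
rewrite ltr_pdivrMr // => Kn.
by have := bern (Num.bound (K / h)); have := H (Num.bound (K / h)); lra.
Qed.

(* [u / cmod z] is controlled near [0] only by the unrelated constant [L], so
   the maximum principle is applied to [u ^+ n.+1 / cmod z ^+ n], which tends to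
   [0] there. *)
Lemma schwarz_minorant (u : C R -> R) (M L d : R) : 0 < M -> 0 < d ->
  (forall z, cmod z < 1 -> {for z, continuous u}) ->
  (forall z, cmod z < 1 -> 0 <= u z <= M) ->
  (forall z, cmod z < d -> u z <= L * cmod z) ->
  (forall z, cmod z < 1 -> holo_minorant_at [set z | cmod z < 1] u z) ->
  forall z, cmod z < 1 -> u z <= M * cmod z.
Proof.
move=> M0 d0 cu uM uL um z z1.
have [->|zn0] := eqVneq z 0.
  by have := uL 0; rewrite cmod0 !mulr0; exact.
have cz : 0 < cmod z by rewrite cmod_gt0.
have [uz|] := ltP 0 (u z); last first.
  by move=> h; apply: (le_trans h); rewrite mulr_ge0 ?ltW.
suff K t : cmod z < t < 1 -> u z * t <= M * cmod z.
  apply/ler_addgt0Pr => e e0.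
  pose t := Num.max ((1 + cmod z) / 2) (1 - e / u z).
  have t1 : t < 1.
    by rewrite gt_max; apply/andP; split; [lra|rewrite ltrBlDr ltrDl divr_gt0].
  have t2 : (1 + cmod z) / 2 <= t by rewrite le_max lexx.
  have t3 : 1 - e / u z <= t by rewrite le_max lexx orbT.
  have := K t; rewrite t1 andbT => /(_ _)/wrap[]; first by lra.
  have : u z * (1 - e / u z) <= u z * t by rewrite ler_wpM2l ?(ltW uz).
  by rewrite mulrBr mulr1 mulrCA mulfV ?gt_eqF // mulr1; lra.
move=> /andP[zt t1].
have t0 : 0 < t by lra.
(* Taken for all n, these bounds say that the powers of u t / (M |z|) stay below M / u, so that this
   quotient is at most 1. *)
suff H n : u z ^+ n.+1 / cmod z ^+ n <= M ^+ n.+1 / t ^+ n.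
  pose a := u z * t / (M * cmod z).
  have Mz : 0 < M * cmod z by rewrite mulr_gt0.
  rewrite -[_ * cmod z]mul1r -ler_pdivrMr // -/a.
  apply: (@expr_bounded_le1 _ (M / u z)).
    by rewrite /a divr_ge0 ?ltW // mulr_gt0.
  move=> n; rewrite ler_pdivlMr //.
  have := H n; rewrite ler_pdivrMr ?exprn_gt0 // mulrAC ler_pdivlMr ?exprn_gt0 //.
  rewrite /a expr_div_n !exprMn mulrAC ler_pdivrMr; last first.
    by rewrite mulr_gt0 // exprn_gt0.
  rewrite !exprS; set x := u z ^+ n; set y := t ^+ n.
  by set X := M ^+ n; set Y := cmod z ^+ n; lra.
pose K := M ^+ n.+1 / t ^+ n.
have K0 : 0 < K by rewrite divr_gt0 // exprn_gt0.
pose L1 := Num.max L 1.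
have L10 : 0 < L1 by rewrite lt_max ltr01 orbT.
(* On the inner circle u <= L1 s, so that u^(n+1) / s^n <= L1^(n+1) s; the last entry of the minimum
   makes this at most [K]. *)
pose s := Num.min (Num.min (d / 2) (cmod z)) (K / L1 ^+ n.+1).
have s0 : 0 < s.
  by rewrite !lt_min cz divr_gt0 // ?divr_gt0 // exprn_gt0.
have [s1 s2 s3] : [/\ s <= d / 2, s <= cmod z & s <= K / L1 ^+ n.+1].
  by split; rewrite !ge_min lexx ?orbT.
pose A := [set z : C R | s <= cmod z <= t].
have A1 w : A w -> 0 < cmod w /\ cmod w < 1.
  by move=> /andP[h1 h2]; split; [exact: lt_le_trans h1|exact: le_lt_trans t1].
pose w z := u z ^+ n.+1 / cmod z ^+ n.
apply: (@max_principle R A w t K _ _ _ _ z).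
- exact: compact_annulus.
- by move=> y /andP[].
- apply: continuous_in_subspaceT => y; rewrite inE => /A1[y0 y1].
  have c1 := @continuous_exp _ _ _ n.+1 _ (cu y y1).
  have c2 := @continuous_exp _ _ _ n _ (@continuous_cmod R y).
  by refine (continuous_div c1 c2 _); rewrite expf_neq0 // gt_eqF.
- move=> y Ay; have [y0 y1] := A1 y Ay.
  have /andP[uy0 uyM] := uM y y1.
  case/andP: (Ay); rewrite le_eqVlt => /orP[/eqP sy _|sy].
    left; rewrite /w -sy ler_pdivrMr ?exprn_gt0 //.
    have hu : u y <= L1 * s.
      rewrite sy; apply: (le_trans (uL y _)); first by rewrite -sy; lra.
      by rewrite ler_wpM2r ?(ltW y0) // le_max lexx.
    apply: (@le_trans _ _ ((L1 * s) ^+ n.+1)).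
      by rewrite lerXn2r // nnegrE // mulr_ge0 // ltW.
    rewrite exprMn [s ^+ n.+1]exprS mulrA ler_wpM2r ?exprn_ge0 ?(ltW s0) //.
    by rewrite mulrC -ler_pdivlMr // exprn_gt0.
  rewrite le_eqVlt => /orP[/eqP yt|yt].
    left; rewrite /w yt ler_pM2r ?invr_gt0 ?exprn_gt0 //.
    by rewrite lerXn2r // nnegrE ltW.
  right; have [f [rho [rho0 fy hf]]] := um y y1.
  pose r := Num.min rho (Num.min (cmod y - s) (t - cmod y)).
  have r0 : 0 < r by rewrite !lt_min rho0 !subr_gt0 sy.
  exists (fun x => f x ^+ n.+1 / x ^+ n), r; split => //.
    by rewrite cmodM cmodV !cmodX fy.
  move=> x; rewrite !lt_min => /and3P[x1 x2 x3].
  have Ax : A x.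
    have := cmodD (x - y) y; have := cmodD (y - x) x.
    by rewrite !subrK (cmodB y) /A /= => *; apply/andP; split; lra.
  have [x0 _] := A1 x Ax; have [_ dfx fx] := hf x x1.
  split; first exact: Ax.
    refine (@derivable_div _ (fun x => f x ^+ n.+1) (fun x => x ^+ n) x
      (@derivable_exp _ f n.+1 x dfx)
      (@derivable_exp _ (fun x => x) n x (@derivable_id _ _ x 1)) _).
    by rewrite expf_neq0 // -cmod_gt0.
  rewrite cmodM cmodV !cmodX ler_pM2r ?invr_gt0 ?exprn_gt0 //.
  by rewrite lerXn2r // nnegrE ?cmod_ge0 // (le_trans _ fx) // cmod_ge0.
- by apply/andP; split => //; exact: ltW.
Qed.

End Schwarz.

(** * The Schwarz bound for a disc near a peak *)

Section DiscPeak.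
Variable R : realType.
Implicit Types (z : C R) (e : R).

Lemma derivable_cmod_continuous (f : C R -> C R) z : derivable f z 1 ->
  forall e, 0 < e -> exists2 s, 0 < s &
    forall y, cmod (y - z) < s -> cmod (f y - f z) < e.
Proof.
move=> df e e0.
have dl : is_derive z 1 f ('D_1 f z) by apply: DeriveDef.
have /is_derive1_cmodP/(_ 1 ltr01)[s s0 hs] := dl.
set l := 'D_1 f z in hs.
have M0 : 0 < cmod l + 1 by rewrite ltr_wpDl // cmod_ge0.
exists (Num.min s (e / (cmod l + 1))); first by rewrite lt_min s0 divr_gt0.
move=> y; rewrite lt_min => /andP[/hs h1]; rewrite ltr_pdivlMr // => h2.
apply: le_lt_trans h2.
have := cmodD (f y - f z - l * (y - z)) (l * (y - z)).
by rewrite subrK cmodM; lra.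
Qed.

(** The squares differ by 4 Re x Re y: the Cayley transform centred at y maps the right half-plane
    into the disc. *)
Lemma cmod_cayley (x y : C R) : 0 <= complex.Re x -> 0 <= complex.Re y ->
  cmod (x - y) <= cmod (x + conjc y).
Proof.
move=> x0 y0; rewrite -(ler_pXn2r (n := 2)) ?nnegrE ?cmod_ge0 // !cmod_sqr.
case: x y x0 y0 => a b [c d] /= x0 y0.
by have := mulr_ge0 x0 y0; nra.
Qed.

(** For given real parts, the pseudohyperbolic distance in the half-plane is least when the
    imaginary parts agree. *)
Lemma cmod_cayley_ge (x y : C R) : 0 <= complex.Re y <= complex.Re x ->
  (complex.Re x - complex.Re y) * cmod (x + conjc y) <=
  (complex.Re x + complex.Re y) * cmod (x - y).
Proof.
move=> /andP[y0 yx].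
rewrite -(ler_pXn2r (n := 2)) ?nnegrE ?mulr_ge0 ?cmod_ge0 //; [|lra..].
rewrite !exprMn !cmod_sqr; case: x y y0 yx => a b [c d] /= y0 yx.
rewrite -subr_ge0 (_ : _ - _ = 4 * a * c * (b - d) ^+ 2); last by ring.
by rewrite mulr_ge0 ?sqr_ge0 // !mulr_ge0 //; lra.
Qed.

(** In the application [F] is H o phi for a disc phi, and [beta] z means that phi z lies in [B]. By
    [Fshell] the disc can leave [beta] only through values with Re F > 2 b. *)
Variables (F : C R -> C R) (beta : C R -> Prop) (b S : R).
Hypotheses (b0 : 0 < b) (bS : b <= S) (S1 : 1 <= S).
Hypothesis dF : forall z, cmod z < 1 -> derivable F z 1.
Hypothesis Fbeta : forall z, cmod z < 1 -> beta z ->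
  0 < complex.Re (F z) /\ cmod (F z) <= S.
Hypothesis beta_open : forall z, cmod z < 1 -> beta z ->
  exists2 s, 0 < s & forall y, cmod (y - z) < s -> beta y.
Hypothesis Fshell : forall z, cmod z < 1 -> ~ beta z ->
  exists2 s, 0 < s & forall y, cmod (y - z) < s -> beta y ->
    2 * b < complex.Re (F y).
Hypothesis beta0 : beta 0.
Let h0 := complex.Re (F 0).
Hypothesis h0small : h0 <= b ^+ 3 / (64 * S ^+ 2).

(* The factor [1 - kap F] pushes [uin] below the constant [kk] where
   [Re F >= 2 b] and above it where [Re F = b], so that [u], extended by [kk]
   outside [beta], stays continuous and keeps local holomorphic minorants; at
   [0] it costs only a factor [1 + O(h0)]. *)
Let kap := 8 * h0 / b ^+ 2.
Let kk := 1 - 3 / 2 * kap * b.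
Let fin z := (F z - F 0) / (F z + conjc (F 0)) * (1 - kap%:C%C * F z).
Let uin z := cmod (fin z).
Let u z := if `[< beta z /\ complex.Re (F z) < b >] then uin z
           else if `[< beta z >] then Num.max (uin z) kk else kk.

Let h0_gt0 : 0 < h0.
Proof. by have [] := Fbeta (z := 0) _ beta0; rewrite ?cmod0. Qed.

Let h0b : 64 * h0 <= b.
Proof.
have ? := b0; have ? := bS; have ? := h0_gt0.
have S0 : 0 < S ^+ 2 by rewrite exprn_gt0 //; lra.
have : b ^+ 3 / (64 * S ^+ 2) * 64 <= b.
  rewrite (_ : _ * 64 = b ^+ 3 / S ^+ 2); last by field; rewrite gt_eqF //; lra.
  rewrite ler_pdivrMr // exprS; apply: ler_wpM2l; first exact: ltW.
  by rewrite lerXn2r // nnegrE; lra.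
by move=> le; rewrite mulrC; apply: (le_trans _ le); rewrite ler_wpM2r.
Qed.

Let kap_gt0 : 0 < kap.
Proof. by rewrite /kap divr_gt0 ?exprn_gt0 // mulr_gt0. Qed.

Let kapS : kap * S ^+ 2 <= b / 8.
Proof.
have ? := b0; have ? := bS.
have S0 : 0 < S ^+ 2 by rewrite exprn_gt0 //; lra.
have b20 : 0 < b ^+ 2 by rewrite exprn_gt0.
have : h0 * (64 * S ^+ 2) <= b ^+ 3 by rewrite -ler_pdivlMr // mulr_gt0.
rewrite /kap mulrAC ler_pdivrMr // (_ : b / 8 * b ^+ 2 = b ^+ 3 / 8).
  by lra.
by field.
Qed.

Let kapb : kap * b = 8 * h0 / b.
Proof. by rewrite /kap; field; rewrite gt_eqF. Qed.

Let h0b' : h0 / b <= 1 / 64.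
Proof. by have := h0b; rewrite ler_pdivrMr //; lra. Qed.

Let kk0 : 0 < kk.
Proof. by have := h0b'; rewrite /kk -mulrA kapb -mulrA; lra. Qed.

Let kapS1 : kap * S <= 1 / 8.
Proof.
have ? := kapS; have ? := b0; have ? := bS; have ? := S1.
have : kap * S * S <= 1 / 8 * S by rewrite -mulrA -expr2; lra.
by rewrite ler_pM2r //; lra.
Qed.

Ltac facts := have ? := b0; have ? := bS; have ? := S1; have ? := h0_gt0;
  have ? := h0b; have ? := kap_gt0; have ? := kapS; have ? := kapb;
  have ? := h0b'; have ? := kk0; have ? := kapS1.

Let den z : cmod z < 1 -> beta z -> F z + conjc (F 0) != 0.
Proof.
move=> z1 /(Fbeta z1)[Fz _]; apply/eqP => /(congr1 (@complex.Re R)).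
rewrite ReD /= => E; have : 0 < complex.Re (F z) + h0 by rewrite addr_gt0.
by move: E; rewrite /h0; case: (F 0) => c d /= ->; rewrite ltxx.
Qed.

Let dfin z : cmod z < 1 -> beta z -> derivable fin z 1.
Proof.
move=> z1 bz.
have dFz := dF z1.
have d1 := derivable_sub dFz (@derivable_cst _ _ _ (F 0) z 1).
have d2 := derivable_add dFz (@derivable_cst _ _ _ (conjc (F 0) : C R) z 1).
have d3 := derivable_mul (@derivable_cst _ _ _ (kap%:C%C : C R) z 1) dFz.
have d4 := derivable_sub (@derivable_cst _ _ _ (1 : C R) z 1) d3.
exact (derivable_mul (derivable_div d1 d2 (den z1 bz)) d4).
Qed.

Let uinE z : uin z = cmod (F z - F 0) / cmod (F z + conjc (F 0)) *
  cmod (1 - kap%:C%C * F z).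
Proof. by rewrite /uin /fin !cmodM cmodV. Qed.

Let cmod_factor z : cmod z < 1 -> beta z ->
  1 - kap * S <= cmod (1 - kap%:C%C * F z) <= 1 + kap * S.
Proof.
facts.
move=> z1 /(Fbeta z1)[_ FS].
have k1 : cmod (kap%:C%C * F z) <= kap * S.
  by rewrite cmodM cmod_of_real ?(ltW kap_gt0) // ler_wpM2l ?(ltW kap_gt0).
have := cmodD (1 - kap%:C%C * F z) (kap%:C%C * F z).
have := cmodD 1 (- (kap%:C%C * F z)).
by rewrite subrK cmodN cmod1 => *; apply/andP; split; lra.
Qed.

Let cayley_le1 z : cmod z < 1 -> beta z ->
  cmod (F z - F 0) / cmod (F z + conjc (F 0)) <= 1.
Proof.
move=> z1 bz; have [Fz _] := Fbeta z1 bz.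
rewrite ler_pdivrMr ?cmod_gt0 ?den // mul1r.
by apply: cmod_cayley; apply: ltW.
Qed.

Let uin_le z : cmod z < 1 -> beta z -> uin z <= 1 + kap * S.
Proof.
move=> z1 bz; have /andP[_ h] := cmod_factor z1 bz.
rewrite uinE -[X in _ <= X]mul1r ler_pM ?cmod_ge0 //.
  by rewrite divr_ge0 ?cmod_ge0.
exact: cayley_le1.
Qed.

(** With t = h0 / b one has kap b = 8 t, and the claim reduces to (1 - t) (1 - 8 t) > (1 + t) (1 -
    12 t), where the difference is 2 t + 20 t^2. The Cayley factor loses about 2 t; the coefficient
    8 in [kap] makes the margin kap b / 2 = 4 t exceed this loss. *)
Let uin_b z : cmod z < 1 -> beta z -> complex.Re (F z) = b -> kk < uin z.
Proof.
facts.
move=> z1 bz Fzb; rewrite uinE.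
have := @cmod_cayley_ge (F z) (F 0); rewrite Fzb -/h0 => /(_ _)/wrap[].
  by lra.
have cd : 0 < cmod (F z + conjc (F 0)) by rewrite cmod_gt0 den.
move=> hc.
have bh : 0 < b + h0 by lra.
set q := cmod (F z - F 0) / _.
have hq : (b - h0) / (b + h0) <= q.
  by rewrite ler_pdivrMr // /q mulrAC ler_pdivlMr // [X in _ <= X]mulrC.
have f1 : 1 - kap * b <= cmod (1 - kap%:C%C * F z).
  apply: (le_trans _ (Re_le_cmod _)); apply: (le_trans _ (ler_norm _)).
  by rewrite ReD ReN ReM /= mul0r subr0 Fzb.
have p1 : 0 <= 1 - kap * b by rewrite kapb -mulrA; lra.
apply: (@lt_le_trans _ _ ((b - h0) / (b + h0) * (1 - kap * b))); last first.
  by rewrite ler_pM // divr_ge0 //; lra.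
rewrite mulrAC ltr_pdivlMr // /kk -[3 / 2 * _ * _]mulrA kapb.
rewrite -subr_gt0 (_ : _ - _ = 2 * h0 + 20 * h0 ^+ 2 / b); last first.
  by field; rewrite gt_eqF.
by rewrite addr_gt0 // ?divr_gt0 // mulr_gt0 // exprn_gt0.
Qed.

(** The Cayley factor is at most 1, and kap S^2 <= b / 8 gives |1 - kap F|^2 <= 1 - 4 kap b + kap b
    / 8, below kk^2 >= 1 - 3 kap b. The value [kk] is midway between 1 - kap b and 1 - 2 kap b. *)
Let uin_2b z : cmod z < 1 -> beta z -> 2 * b <= complex.Re (F z) ->
  uin z <= kk.
Proof.
facts.
move=> z1 bz Fz2; have [Fz FS] := Fbeta z1 bz.
rewrite uinE -[kk]mul1r ler_pM ?cmod_ge0 ?divr_ge0 ?cmod_ge0 //.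
  exact: cayley_le1.
rewrite -(ler_pXn2r (n := 2)) ?nnegrE ?cmod_ge0 ?(ltW kk0) // cmod_sqr.
have FS2 : complex.Re (F z) ^+ 2 + complex.Im (F z) ^+ 2 <= S ^+ 2.
  by rewrite -cmod_sqr lerXn2r // nnegrE ?cmod_ge0 //; lra.
rewrite !(ReD, ImD, ReN, ImN, ReM, ImM) /= !mul0r subr0 add0r addr0.
rewrite (_ : _ + _ = 1 - 2 * (kap * complex.Re (F z)) +
  kap * (kap * (complex.Re (F z) ^+ 2 + complex.Im (F z) ^+ 2))); last by ring.
have h1 : kap * (kap * (complex.Re (F z) ^+ 2 + complex.Im (F z) ^+ 2)) <= kap * (b / 8).
  rewrite ler_wpM2l ?(ltW kap_gt0) //; apply: le_trans kapS.
  by rewrite ler_wpM2l ?(ltW kap_gt0).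
have h2 : kap * (2 * b) <= kap * complex.Re (F z) by rewrite ler_wpM2l ?(ltW kap_gt0).
have h3 : 0 <= (kap * b) ^+ 2 by apply: sqr_ge0.
have h4 : 0 < kap * b by rewrite mulr_gt0.
by rewrite /kk; nra.
Qed.

Let u_uin z : beta z -> complex.Re (F z) < b -> u z = uin z.
Proof. by move=> bz hz; rewrite /u asboolT. Qed.

Let u_max z : beta z -> b <= complex.Re (F z) -> u z = Num.max (uin z) kk.
Proof.
move=> bz hz; rewrite /u asboolF; first by rewrite asboolT.
by case=> _; rewrite ltNge hz.
Qed.

Let u_kk z : ~ beta z -> u z = kk.
Proof. by move=> bz; rewrite /u asboolF ?asboolF // => -[]. Qed.

Let near_disc z : cmod z < 1 -> exists2 s, 0 < s & forall y, cmod (y - z) < s -> cmod y < 1.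
Proof.
facts.
move=> z1; exists (1 - cmod z); first by rewrite subr_gt0.
by move=> y h; have := cmodD (y - z) z; rewrite subrK; lra.
Qed.

(** Two transitions matter. Where Re F = b, the strict inequality [uin_b] persists nearby, so both
    branches equal [uin]. Outside [beta], the nearby points of [beta] have Re F > 2 b, where [uin]
    is at most [kk]. *)
Let u_local z : cmod z < 1 -> exists2 s, 0 < s &
  [\/ beta z /\ forall y, cmod (y - z) < s -> [/\ cmod y < 1, beta y & u y = uin y],
      beta z /\ forall y, cmod (y - z) < s ->
         [/\ cmod y < 1, beta y & u y = Num.max (uin y) kk]
    | forall y, cmod (y - z) < s -> u y = kk].
Proof.
facts.
move=> z1; have [s1 s10 hs1] := near_disc z1.
case: (pselect (beta z)) => bz; last first.
  have [s2 s20 hs2] := Fshell z1 bz.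
  exists (Num.min s1 s2); first by rewrite lt_min s10.
  apply: Or33 => y; rewrite lt_min => /andP[y1 y2].
  case: (pselect (beta y)) => [by_|]; last exact: u_kk.
  have h2 := hs2 y y2 by_.
  rewrite u_max //; last by lra.
  by apply: max_r; apply: uin_2b => //; [exact: hs1|exact: ltW].
have [s2 s20 hs2] := beta_open z1 bz.
have [hz|hz|hz] := ltgtP (complex.Re (F z)) b.
- have hz' : 0 < b - complex.Re (F z) by rewrite subr_gt0.
  have [s3 s30 hs3] := derivable_cmod_continuous (dF z1) hz'.
  exists (Num.min s1 (Num.min s2 s3)); first by rewrite !lt_min s10 s20.
  apply: Or31; split => // y; rewrite !lt_min => /and3P[y1 y2 y3].
  split; [exact: hs1|exact: hs2|apply: u_uin; first exact: hs2].
  have := Re_le_cmod (F y - F z); rewrite ReD ReN ler_norml.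
  by have := hs3 y y3; lra.
- have hz' : 0 < complex.Re (F z) - b by rewrite subr_gt0.
  have [s3 s30 hs3] := derivable_cmod_continuous (dF z1) hz'.
  exists (Num.min s1 (Num.min s2 s3)); first by rewrite !lt_min s10 s20.
  apply: Or32; split => // y; rewrite !lt_min => /and3P[y1 y2 y3].
  split; [exact: hs1|exact: hs2|apply: u_max; first exact: hs2].
  have := Re_le_cmod (F y - F z); rewrite ReD ReN ler_norml.
  by have := hs3 y y3; lra.
- have hz' : 0 < uin z - kk by rewrite subr_gt0 uin_b.
  have [s3 s30 hs3] := derivable_cmod_continuous (dfin z1 bz) hz'.
  exists (Num.min s1 (Num.min s2 s3)); first by rewrite !lt_min s10 s20.
  apply: Or31; split => // y; rewrite !lt_min => /and3P[y1 y2 y3].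
  split; [exact: hs1|exact: hs2|].
  have [h|h] := ltP (complex.Re (F y)) b; first by rewrite u_uin //; exact: hs2.
  rewrite u_max //; last exact: hs2.
  apply: max_l; have := hs3 y y3; have := cmodD (fin z - fin y) (fin y).
  by rewrite subrK (cmodB (fin z)) -/(uin z) -/(uin y); lra.
Qed.

Let uin_continuous z : cmod z < 1 -> beta z -> forall e, 0 < e ->
  exists2 s, 0 < s & forall y, cmod (y - z) < s -> `|uin y - uin z| < e.
Proof.
facts.
move=> z1 bz e e0; have [s s0 hs] := derivable_cmod_continuous (dfin z1 bz) e0.
exists s => // y /hs h.
have := cmodD (fin z - fin y) (fin y); have := cmodD (fin y - fin z) (fin z).
by rewrite !subrK (cmodB (fin z)) /uin ltr_norml; lra.
Qed.

Let u_continuous z : cmod z < 1 -> {for z, continuous u}.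
Proof.
facts.
move=> z1; apply/continuous_complexP => e e0.
have zz : cmod (z - z) < 1 by rewrite subrr cmod0.
have [s s0 [[bz H]|[bz H]|H]] := u_local z1.
- have [s2 s20 hs2] := uin_continuous z1 bz e0.
  exists (Num.min s s2); first by rewrite lt_min s0.
  move=> y; rewrite lt_min => /andP[y1 y2].
  have [_ _ ->] := H y y1; have [|_ _ ->] := H z; last exact: hs2.
  by rewrite subrr cmod0.
- have [s2 s20 hs2] := uin_continuous z1 bz e0.
  exists (Num.min s s2); first by rewrite lt_min s0.
  move=> y; rewrite lt_min => /andP[y1 y2].
  have [_ _ ->] := H y y1; have [|_ _ ->] := H z; first by rewrite subrr cmod0.
  have := hs2 y y2; rewrite !ltr_norml.
  by case: (leP (uin y) kk); case: (leP (uin z) kk); lra.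
- exists s => // y /H ->; rewrite H ?subrr ?normr0 //.
  by rewrite cmod0.
Qed.

Let u_bounds z : cmod z < 1 -> 0 <= u z <= 1 + kap * S.
Proof.
facts.
move=> z1; have k1 : kk <= 1 + kap * S.
  have : 0 < kap * b by rewrite mulr_gt0.
  have : 0 < kap * S by rewrite mulr_gt0 //; lra.
  by rewrite /kk; lra.
have u0 : 0 <= uin z by apply: cmod_ge0.
case: (pselect (beta z)) => bz; last by rewrite u_kk // (ltW kk0).
have := uin_le z1 bz.
have [hz|hz] := ltP (complex.Re (F z)) b; first by rewrite u_uin // u0.
rewrite u_max // => h; apply/andP; split; first by rewrite le_max u0.
by rewrite ge_max h.
Qed.

(** Where u takes the value [kk] and is at least [kk] nearby, the constant is a minorant; elsewhere
    [fin] is one. *)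
Let u_minorant z : cmod z < 1 -> holo_minorant_at [set z | cmod z < 1] u z.
Proof.
move=> z1; have [s1 s10 hs1] := near_disc z1.
have kkc : cmod (kk%:C%C : C R) = kk by rewrite cmod_of_real // ltW.
have K s : 0 < s -> u z = kk -> (forall y, cmod (y - z) < s -> kk <= u y) ->
    holo_minorant_at [set z | cmod z < 1] u z.
  move=> s0 uz hs; exists (fun=> kk%:C%C), (Num.min s s1); split.
  - by rewrite lt_min s0.
  - by rewrite kkc.
  - move=> y; rewrite lt_min => /andP[y1 y2]; split; first exact: hs1.
      exact: derivable_cst.
    by rewrite kkc; exact: hs.
have [s s0 [[bz H]|[bz H]|H]] := u_local z1.
- exists fin, s; split => //.
    by have [|_ _ ->] := H z; rewrite ?subrr ?cmod0.
  move=> y /H[y1 by_ uy]; split => //; first exact: dfin.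
  by rewrite uy.
- have [|_ _ uz] := H z; first by rewrite subrr cmod0.
  have [uk|uk] := leP (uin z) kk.
    apply: (K s s0); first by rewrite uz; apply: max_r.
    by move=> y /H[_ _ ->]; rewrite le_max lexx orbT.
  exists fin, s; split => //.
    by rewrite uz; apply/esym/max_l/ltW.
  move=> y /H[y1 by_ uy]; split => //; first exact: dfin.
  by rewrite uy le_max lexx.
- apply: (K s s0); first by rewrite H // subrr cmod0.
  by move=> y /H ->.
Qed.

(** With t = kap S, the Schwarz lemma gives (1 - t) |F z - F 0| <= (1 + t) (2 h0 + e) |z|, where [e]
    pays for replacing F z + conj (F 0) by 2 h0. Then (1 + t) (1 - 3 t) <= 1 - t is used, and 3 t is
    the term with 24. *)
Lemma disc_peak_derivative e : 0 < e -> exists2 s, 0 < s &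
  forall z, cmod z < s ->
    (1 - 24 * S / b ^+ 2 * h0) * cmod (F z - F 0) <= (2 * h0 + e) * cmod z.
Proof.
facts.
move=> e0; have z01 : cmod (0 : C R) < 1 by rewrite cmod0.
have M0 : 0 < 1 + kap * S by rewrite addr_gt0 // mulr_gt0 //; lra.
have hb : complex.Re (F 0) < b by rewrite -/h0; lra.
have [l hl] : exists l, is_derive (0 : C R) 1 fin l.
  by exists ('D_1 fin 0); apply: DeriveDef; [exact: dfin|].
have fin0 : fin 0 = 0 by rewrite /fin subrr mul0r mul0r.
have [s1 s10 hs1] := beta_open z01 beta0.
have hb' : 0 < b - complex.Re (F 0) by rewrite subr_gt0.
have [s2 s20 hs2] := derivable_cmod_continuous (dF z01) hb'.
have /is_derive1_cmodP/(_ 1 ltr01)[s3 s30 hs3] := hl.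
have [s4 s40 hs4] := derivable_cmod_continuous (dF z01) e0.
have near0 z : cmod z < Num.min s1 s2 -> beta z /\ u z = uin z.
  rewrite lt_min => /andP[z1 z2].
  have bz : beta z by apply: hs1; rewrite subr0.
  split => //; apply: u_uin => //.
  have := hs2 z; rewrite subr0 => /(_ z2).
  by have := Re_le_cmod (F z - F 0); rewrite ReD ReN ler_norml; lra.
have SM := @schwarz_minorant R u (1 + kap * S) (cmod l + 1)
  (Num.min (Num.min s1 s2) s3) M0.
have {}SM z : cmod z < 1 -> u z <= (1 + kap * S) * cmod z.
  apply: SM => //.
  - by rewrite !lt_min s10 s20.
  - move=> y; rewrite lt_min => /andP[/near0[_ ->]] y3.
    have := hs3 y; rewrite subr0 fin0 subr0 => /(_ y3).
    have := cmodD (fin y - l * y) (l * y); rewrite subrK cmodM /uin; lra.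
exists (Num.min (Num.min s1 s2) (Num.min 1 s4)); first by rewrite !lt_min s10 s20 ltr01.
move=> z; rewrite lt_min [X in _ && X]lt_min => /and3P[/near0[bz uz] z1 z4].
have := SM z z1; rewrite uz uinE.
have /andP[f1 _] := cmod_factor z1 bz.
have cd : 0 < cmod (F z + conjc (F 0)) by rewrite cmod_gt0 den.
have cd2 : cmod (F z + conjc (F 0)) <= 2 * h0 + e.
  have := hs4 z; rewrite subr0 => /(_ z4) h.
  have -> : F z + conjc (F 0) = (F z - F 0) + (2 * h0)%:C%C.
    apply: complex_eq; rewrite !(ReD, ImD, ReN, ImN) /=; rewrite /h0; case: (F 0) => c d /=; ring.
  apply: (le_trans (cmodD _ _)); rewrite cmod_of_real; first lra.
  by rewrite mulr_ge0 // ltW.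
rewrite mulrAC ler_pdivrMr // => h.
have t0 : 0 < kap * S by rewrite mulr_gt0 //; lra.
have LE : 24 * S / b ^+ 2 * h0 = 3 * (kap * S).
  by rewrite /kap; field; rewrite gt_eqF.
have t8 := kapS1; rewrite LE; set t := kap * S in t0 f1 h t8 *.
set X := cmod (F z - F 0) in h *.
have X0 : 0 <= X by apply: cmod_ge0.
have z0 : 0 <= cmod z by apply: cmod_ge0.
have h5 : X * (1 - t) <= (1 + t) * cmod z * (2 * h0 + e).
  apply: (@le_trans _ _ (X * cmod (1 - kap%:C%C * F z))); first by rewrite ler_wpM2l.
  apply: (le_trans h); rewrite ler_wpM2l // mulr_ge0 //; lra.
have h6 : (1 + t) * (1 - 3 * t) <= 1 - t by have := sqr_ge0 t; nra.
have c0 : 0 <= X by [].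
rewrite -(ler_pM2l (x := 1 + t)); last by lra.
rewrite mulrA; apply: (@le_trans _ _ ((1 - t) * X)); first by rewrite ler_wpM2r.
by rewrite mulrC; apply: (le_trans h5); rewrite -!mulrA [cmod z * _]mulrC.
Qed.

End DiscPeak.

(** * Nonexpansive functions and the Kobayashi distance *)

Section Poincare.
Variables (R : realType) (d : nat) (D : set 'rV[C R]_d).
Implicit Types (z : C R) (e : R).

Lemma atanh_ge (s : R) : 0 <= s < 1 -> s / (1 + s) <= atanh s.
Proof.
move=> /andP[s0 s1]; rewrite /atanh.
pose q := (1 - s) / (1 + s).
have q0 : 0 < q by rewrite divr_gt0; lra.
have -> : (1 + s) / (1 - s) = q^-1 by rewrite /q invf_div.
rewrite lnV ?posrE // mulrN.
have : ln (1 + (q - 1)) <= q - 1 by apply: le_ln1Dx; lra.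
rewrite addrC subrK => h.
have : q - 1 = - 2 * (s / (1 + s)) by rewrite /q; field; rewrite gt_eqF //; lra.
by lra.
Qed.

(** The subtraction formula of tanh: the Poincare distance is additive along a radius. *)
Lemma atanhB (x y : R) : 0 <= x -> x <= y -> y < 1 ->
  atanh ((y - x) / (1 - x * y)) = atanh y - atanh x.
Proof.
move=> x0 xy y1.
have p1 : 0 < 1 - x * y by nra.
have p2 : 0 < 1 + y by lra.
have p3 : 0 < 1 - y by lra.
have p4 : 0 < 1 + x by lra.
have p5 : 0 < 1 - x by lra.
rewrite /atanh -mulrBr; congr (_ * _).
rewrite -ln_div ?posrE ?divr_gt0 //; congr ln.
have p6 : 1 - x * y - (y - x) != 0.
  by rewrite (_ : _ - _ = (1 + x) * (1 - y)); [rewrite gt_eqF ?mulr_gt0|ring].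
by field; rewrite p6 !gt_eqF.
Qed.

Definition mobius z0 z : C R := (z + z0) / (1 + conjc z0 * z).

Lemma mobius_norm z0 z : cmod z0 < 1 -> cmod z < 1 ->
  (1 + conjc z0 * z : C R) != 0 /\ cmod (mobius z0 z) < 1.
Proof.
move=> z01 z1.
have lt : cmod (z + z0) < cmod (1 + conjc z0 * z).
  rewrite -(ltr_pXn2r (n := 2)) ?nnegrE ?cmod_ge0 //.
  rewrite -subr_gt0 (_ : _ - _ = (1 - cmod z ^+ 2) * (1 - cmod z0 ^+ 2)).
    have sq (x : R) : 0 <= x -> x < 1 -> 0 < 1 - x ^+ 2 by move=> *; nra.
    by rewrite mulr_gt0 // sq // cmod_ge0.
  by rewrite !cmod_sqr; case: (z) (z0) => a b [a' b'] /=; ring.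
have n0 : (1 + conjc z0 * z : C R) != 0.
  by rewrite -cmod_gt0; apply: le_lt_trans lt; apply: cmod_ge0.
split => //; rewrite /mobius cmodM cmodV ltr_pdivrMr ?mul1r //.
by rewrite cmod_gt0.
Qed.

Lemma derivable_mobius z0 z : cmod z0 < 1 -> cmod z < 1 ->
  derivable (mobius z0) z 1.
Proof.
move=> z01 z1; have [n0 _] := mobius_norm z01 z1.
have d1 := derivable_add (@derivable_id _ _ z 1) (@derivable_cst _ _ _ z0 z 1).
have d2 := derivable_mul (@derivable_cst _ _ _ (conjc z0 : C R) z 1) (@derivable_id _ _ z 1).
have d3 := derivable_add (@derivable_cst _ _ _ (1 : C R) z 1) d2.
exact (derivable_div d1 d3 n0).
Qed.

Lemma derivable_comp_curve (K : numFieldType) (V : normedModType K)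
  (f : K -> V) (g : K -> K) x :
  derivable g x 1 -> derivable f (g x) 1 -> derivable (f \o g) x 1.
Proof.
move=> /derivable1_diffP dg /derivable1_diffP df; apply/derivable1_diffP.
exact: differentiable_comp.
Qed.

Lemma holo_disc_mobius (phi : C R -> 'rV[C R]_d) z0 :
  cmod z0 < 1 -> holo_disc D phi -> holo_disc D (phi \o mobius z0).
Proof.
move=> z01 hphi z; rewrite (_ : 1 = (1 : R)%:C%C) // ltc_cmod => z1.
have [_ m1] := mobius_norm z01 z1.
have [|dphi Dphi] := hphi (mobius z0 z).
  by rewrite (_ : 1 = (1 : R)%:C%C) // ltc_cmod.
split; last exact: Dphi.
exact (derivable_comp_curve (derivable_mobius z01 z1) dphi).
Qed.

(** A derivative bound at the centre of each disc, stated through increments because the truncated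
    peaks have corners. *)
Definition infinitesimally_nonexpansive (g : 'rV[C R]_d -> R) :=
  forall phi, holo_disc D phi -> forall e, 0 < e -> exists2 s, 0 < s &
    forall z, cmod z < s -> `|g (phi z) - g (phi 0)| <= (1 + e) * cmod z.

(** A Moebius change of variable carries the bound from the centre to any point of the radius, and
    [cousin_segment] adds up the small steps. One factor 1 + e comes from g, the other from q <= (1
    + e) atanh q for q < e. *)
Lemma nonexpansive_atanh g phi al : infinitesimally_nonexpansive g ->
  holo_disc D phi -> cmod al < 1 ->
  `|g (phi al) - g (phi 0)| <= atanh (cmod al).
Proof.
move=> hg hphi al1.
pose rho := cmod al.
have rho0 : 0 <= rho by apply: cmod_ge0.
pose T t := atanh (t * rho).
pose G t := g (phi (t%:C%C * al)).
suff K e : 0 < e <= 1 -> `|G 1 - G 0| <= (1 + e) ^+ 2 * (T 1 - T 0).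
  have T0 : T 0 = 0 by rewrite /T /atanh mul0r addr0 subr0 divr1 ln1 mulr0.
  have G0 : G 0 = g (phi 0) by rewrite /G rmorph0 mul0r.
  have G1 : G 1 = g (phi al) by rewrite /G rmorph1 mul1r.
  rewrite G0 G1 T0 subr0 /T mul1r in K.
  apply/ler_addgt0Pr => e e0.
  have a0 : 0 <= atanh rho by apply: atanh_ge0; rewrite rho0.
  pose e1 := Num.min 1 (e / (3 * (atanh rho + 1))).
  have e10 : 0 < e1 by rewrite lt_min ltr01 divr_gt0 // mulr_gt0 //; lra.
  have e11 : e1 <= 1 by rewrite ge_min lexx.
  have e12 : e1 * (3 * (atanh rho + 1)) <= e.
    by rewrite -ler_pdivlMr ?ge_min ?lexx ?orbT // mulr_gt0 //; lra.
  apply: (le_trans (K e1 _)); first by rewrite e10.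
  by have : e1 ^+ 2 * atanh rho <= e1 * atanh rho; [rewrite ler_wpM2r //; nra|nra].
move=> /andP[e0 e1].
have P x y : 0 <= x -> x <= y -> y <= 1 ->
    [/\ 0 <= x * rho, x * rho <= y * rho, y * rho < 1 &
        0 < 1 - x * rho * (y * rho)].
  move=> x0 xy y1; have h1 : 0 <= x * rho by rewrite mulr_ge0.
  have h2 : x * rho <= y * rho by rewrite ler_wpM2r.
  have h3 : y * rho < 1.
    by apply: le_lt_trans al1; rewrite -[X in _ <= X]mul1r ler_wpM2r.
  by split => //; clear - h1 h2 h3; nra.
have Tmono x y : 0 <= x -> x <= y -> y <= 1 -> T x <= T y.
  move=> x0 xy y1; have [h1 h2 h3 h4] := P _ _ x0 xy y1.
  rewrite -subr_ge0 /T -atanhB //; apply: atanh_ge0.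
  apply/andP; split.
    by apply: divr_ge0; [rewrite subr_ge0|exact: ltW].
  by rewrite ltr_pdivrMr // mul1r; clear - h1 h2 h3; nra.
apply: (@cousin_segment R (fun a b => 0 <= a -> b <= 1 ->
    `|G b - G a| <= (1 + e) ^+ 2 * (T b - T a)) 0 1) => //.
  move=> a b m ab mE Pm Pb a0 b1.
  have h1 := Pm a0 _; have h2 := Pb _ b1.
  apply: (le_trans (ler_distD (G m) _ _)).
  apply: (@le_trans _ _ ((1 + e) ^+ 2 * (T b - T m) + (1 + e) ^+ 2 * (T m - T a))).
    by apply: lerD; [apply: h2|apply: h1]; lra.
  by rewrite -mulrDr addrA subrK.
move=> t0 /andP[t00 t01].
have z01 : cmod (t0%:C%C * al) < 1.
  by rewrite cmodM cmod_of_real //; nra.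
have [s s0 hs] := hg _ (holo_disc_mobius z01 hphi) e e0.
pose s' := Num.min s e.
have s'0 : 0 < s' by rewrite lt_min s0.
have r1 : 0 < 1 - rho by rewrite subr_gt0.
(* The pseudohyperbolic distance of x al and y al is at most (y - x) / (1 - rho), hence below [s']
   for steps shorter than [w]. *)
pose w := s' * (1 - rho).
exists w; first by rewrite mulr_gt0.
have step x y : 0 <= x -> x <= y -> y <= 1 -> y - x < w -> (x = t0 \/ y = t0) ->
    `|G y - G x| <= (1 + e) ^+ 2 * (T y - T x).
  move=> x0 xy y1 yx hxy.
  have [p1 p2 p3 p4] := P _ _ x0 xy y1.
  have xyE : x * rho * (y * rho) = x * y * rho ^+ 2 by ring.
  have D0 : 0 < 1 - x * y * rho ^+ 2 by rewrite -xyE.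
  pose q := (y - x) * rho / (1 - x * y * rho ^+ 2).
  have q0 : 0 <= q by rewrite divr_ge0 ?mulr_ge0 //; [lra|exact: ltW].
  have qs : q < s'.
    rewrite ltr_pdivrMr //.
    have h1 : (y - x) * rho <= y - x.
      by rewrite -[X in _ <= X]mulr1 ler_wpM2l // ?subr_ge0 // ltW.
    have h2 : 1 - rho <= 1 - x * y * rho ^+ 2.
      have yr : y * rho <= rho by rewrite -[X in _ <= X]mul1r ler_wpM2r.
      by rewrite -xyE; clear - p1 p2 p3 yr; nra.
    have h3 : s' * (1 - rho) <= s' * (1 - x * y * rho ^+ 2).
      by apply: ler_wpM2l; first exact: ltW.
    exact: le_lt_trans h1 (lt_le_trans yx h3).
  have qe : q < e by move: qs; rewrite lt_min => /andP[].
  have TE : T y - T x = atanh q.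
    by rewrite /T -atanhB // xyE /q [(y - x) * rho]mulrBl.
  have qT : q <= (1 + e) * (T y - T x).
    have := @atanh_ge q; rewrite q0 -TE => /(_ _)/wrap[]; first lra.
    rewrite ler_pdivrMr; last by lra.
    move=> /le_trans; apply; rewrite mulrC ler_wpM2r //; first by rewrite subr_ge0 Tmono.
    by lra.
  suff : `|G y - G x| <= (1 + e) * q.
    move=> /le_trans; apply; rewrite expr2 -mulrA ler_wpM2l //; lra.
  have key t (z : C R) : cmod z = q -> mobius (t0%:C%C * al) z = t%:C%C * al ->
     `|G t - G t0| <= (1 + e) * q.
    move=> zq zt; have := hs z; rewrite zq => /(_ _)/wrap[].
      by move: qs; rewrite lt_min => /andP[].
    rewrite /= zt.
    have -> : mobius (t0%:C%C * al) 0 = t0%:C%C * al.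
      by rewrite /mobius add0r mulr0 addr0 divr1.
    by [].
  have al2 : conjc al * al = (rho ^+ 2)%:C%C :> C R.
    by rewrite /rho cmod_sqr; case: (al) => a b /=; apply: complex_eq => /=; ring.
  (* The preimage of t al under the Moebius map sending 0 to t0 al; its modulus is the
     pseudohyperbolic distance [q]. *)
  pose z t : C R := ((t - t0) / (1 - t * t0 * rho ^+ 2))%:C%C * al.
  have zE t : 1 - t * t0 * rho ^+ 2 != 0 -> 1 - t0 * t0 * rho ^+ 2 != 0 ->
     mobius (t0%:C%C * al) (z t) = t%:C%C * al.
    move=> n1 n2; rewrite /mobius /z.
    have E1 : ((t - t0) / (1 - t * t0 * rho ^+ 2))%:C%C * al + t0%:C%C * al =
       (t * (1 - t0 * t0 * rho ^+ 2) / (1 - t * t0 * rho ^+ 2))%:C%C * al.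
      rewrite -mulrDl -rmorphD; congr (_ %:C%C * _); field; exact: n1.
    have E2 : 1 + conjc (t0%:C%C * al) * (((t - t0) / (1 - t * t0 * rho ^+ 2))%:C%C * al)
       = ((1 - t0 * t0 * rho ^+ 2) / (1 - t * t0 * rho ^+ 2))%:C%C :> C R.
      have -> : conjc (t0%:C%C * al) = t0%:C%C * conjc al :> C R.
        by case: (al) => a b; apply: complex_eq => /=; ring.
      rewrite mulrACA al2 -!rmorphM /= -[1 in LHS]/((1 : R)%:C%C) -rmorphD; congr (_ %:C%C).
      by field; exact: n1.
    rewrite E1 E2 mulrAC -fmorphV -rmorphM; congr (_ %:C%C * _).
    by field; rewrite n1 n2.
  have n2 : 1 - t0 * t0 * rho ^+ 2 != 0.
    have [_ _ _ pt] := P t0 t0 t00 (lexx t0) t01.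
    by rewrite gt_eqF // (_ : t0 * t0 * rho ^+ 2 = t0 * rho * (t0 * rho)) //; ring.
  case: hxy => hh.
    apply: (@le_trans _ _ `|G y - G t0|); first by rewrite hh.
    have n1 : 1 - y * t0 * rho ^+ 2 != 0 by rewrite -hh [y * x]mulrC gt_eqF.
    apply: (key y (z y)); last exact: zE.
    rewrite /z -hh [y * x]mulrC cmodM cmod_of_real; last first.
      by apply: divr_ge0; [rewrite subr_ge0|exact: ltW].
    by rewrite /q mulrAC.
  apply: (@le_trans _ _ `|G x - G t0|); first by rewrite hh distrC.
  have n1 : 1 - x * t0 * rho ^+ 2 != 0 by rewrite -hh gt_eqF.
  apply: (key x (z x)); last exact: zE.
  rewrite /z -hh -cmodN -mulNr -rmorphN -mulNr opprB cmodM cmod_of_real; last first.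
    by apply: divr_ge0; [rewrite subr_ge0|exact: ltW].
  by rewrite /q mulrAC.
move=> a b /andP[aa at0] /andP[t0b bb] ba a0 b1.
apply: (le_trans (ler_distD (G t0) _ _)).
apply: (@le_trans _ _ ((1 + e) ^+ 2 * (T b - T t0) + (1 + e) ^+ 2 * (T t0 - T a))).
  apply: lerD.
    by apply: step; [lra|lra|lra|lra|left].
  by apply: step; [lra|lra|lra|lra|right].
by rewrite -mulrDr addrA subrK.
Qed.

(** The function |g x - g y| is itself a pseudodistance below the Lempert function, so it takes part
    in the supremum. *)
Lemma kobayashi_ge g (z w : 'rV[C R]_d) : infinitesimally_nonexpansive g -> D z -> D w ->
  ((`|g z - g w|)%:E <= kobayashi D z w)%E.
Proof.
move=> hg Dz Dw; apply: (kobayashi_ub (rho := fun x y => `|g x - g y|)).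
split.
  split=> [x y _ _|x _|x y _ _|x y t _ _ _] //.
  - by rewrite subrr normr0.
  - by rewrite distrC.
  - exact: ler_distD.
move=> x y Dx Dy; apply: le_ereal_inf_tmp => _ [al [al1 [phi [hphi <- <-]]] <-].
have al1' : cmod al < 1 by move: al1; rewrite (_ : 1 = (1 : R)%:C%C) // ltc_cmod.
by rewrite lee_fin distrC; exact: (nonexpansive_atanh hg hphi al1').
Qed.

End Poincare.

(** * Logarithms of truncated peaks *)

Section PeakFunction.
Variables (R : realType) (d : nat) (D : set 'rV[C R]_d).
Implicit Types (z : C R) (e : R) (B : set 'rV[C R]_d) (H : 'rV[C R]_d -> C R).

(* [H] is only controlled on [B]; the last condition makes the truncation in
   [log_peak] constant near the points of [D] outside [B]. *)
Definition peak_at_boundary H B (b S : R) :=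
  [/\ [/\ 0 < b, b <= S & 1 <= S],
      forall phi, holo_disc D phi ->
        forall z, cmod z < 1 -> derivable (fun t => H (phi t)) z 1,
      forall x, D x -> B x -> 0 < complex.Re (H x) /\ cmod (H x) <= S,
      open B
    & forall x, D x -> ~ B x ->
        nbhs x [set y | D y -> B y -> 2 * b < complex.Re (H y)]].

(** With L = 24 S / b^2, the derivative (1 - L s) / (2 s) of [psi] is the inverse of the bound 2 s /
    (1 - L s) that [disc_peak_derivative] gives for the speed of H along a disc. *)
Definition log_peak H B (b S a : R) (x : 'rV[C R]_d) : R :=
  let psi s := 2^-1 * (ln s - 24 * S / b ^+ 2 * s) in
  if `[< B x >] then psi (Num.min (complex.Re (H x)) a) else psi a.

Lemma holo_disc_D phi z : holo_disc D phi -> cmod z < 1 -> D (phi z).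
Proof.
by move=> hphi z1; have [] := hphi z; rewrite // (_ : 1 = (1 : R)%:C%C) // ltc_cmod.
Qed.

Lemma holo_disc_near phi z (P : set 'rV[C R]_d) : holo_disc D phi ->
  cmod z < 1 -> nbhs (phi z) P ->
  exists2 s, 0 < s & forall y, cmod (y - z) < s -> P (phi y).
Proof.
move=> hphi z1 nP; apply/nbhs_complexP.
have [dphi _] : derivable phi z 1 /\ D (phi z).
  by apply: hphi; rewrite (_ : 1 = (1 : R)%:C%C) // ltc_cmod.
have /derivable1_diffP/differentiable_continuous cphi := dphi.
exact: cphi.
Qed.

(** If phi 0 lies in [B], then Re H > a persists nearby. If not, the nearby points of the disc in
    [B] have Re H > 2 b, which exceeds a. In both cases the value is [psi] a. *)
Lemma log_peak_locally_constant H B b S a phi :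
  peak_at_boundary H B b S -> a <= b -> holo_disc D phi ->
  ~ (B (phi 0) /\ complex.Re (H (phi 0)) <= a) ->
  exists2 s, 0 < s & forall z, cmod z < s ->
    log_peak H B b S a (phi z) = log_peak H B b S a (phi 0).
Proof.
move=> [[b0 bS S1] hH HB oB far] ab hphi nB.
have z01 : cmod (0 : C R) < 1 by rewrite cmod0.
pose psi s := 2^-1 * (ln s - 24 * S / b ^+ 2 * s).
suff [s s0 hs] : exists2 s, 0 < s & forall z, cmod z < s ->
    log_peak H B b S a (phi z) = psi a.
  by exists s => // z /hs ->; rewrite hs // cmod0.
case: (pselect (B (phi 0))) => B0; last first.
  have [s s0 hs] := holo_disc_near hphi z01 (far _ (holo_disc_D hphi z01) B0).
  exists (Num.min s 1); first by rewrite lt_min s0 ltr01.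
  move=> z; rewrite lt_min => /andP[zs z1].
  have := hs z; rewrite subr0 => /(_ zs) h.
  rewrite /log_peak; case: asboolP => // Bz; congr (psi _); apply: min_r.
  have := h (holo_disc_D hphi z1) Bz; clear - ab b0; lra.
have h0a : 0 < complex.Re (H (phi 0)) - a.
  by rewrite subr_gt0 ltNge; apply/negP => h; apply: nB.
have [s s0 hs] := derivable_cmod_continuous (hH phi hphi 0 z01) h0a.
exists s => // z zs; rewrite /log_peak; case: asboolP => // Bz.
congr (psi _); apply: min_r.
have := hs z; rewrite subr0 => /(_ zs).
have := Re_le_cmod (H (phi z) - H (phi 0)); rewrite ReD ReN ler_norml.
by clear; lra.
Qed.

Lemma ln_derivative_bound (h L e : R) : 0 < h -> 0 <= h^-1 - L -> 0 < e ->
  exists2 s, 0 < s & forall t, `|t - h| < s ->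
    `|(ln t - L * t) - (ln h - L * h)| <= (h^-1 - L + e) * `|t - h|.
Proof.
move=> h0 L0 e0.
have /is_derive1_littleoP/(_ e e0)[s s0 hs] : is_derive h 1 (@ln R) h^-1.
  exact: is_derive1_ln.
exists s => // t /hs hb.
have -> : ln t - L * t - (ln h - L * h) =
  (ln t - ln h - h^-1 * (t - h)) + (h^-1 - L) * (t - h) by ring.
apply: (le_trans (ler_normD _ _)).
by rewrite [X in _ + X]normrM (ger0_norm L0); clear - hb; lra.
Qed.

Lemma log_peak_nonexpansive H B b S a : peak_at_boundary H B b S ->
  0 < a -> a <= b ^+ 3 / (64 * S ^+ 2) ->
  infinitesimally_nonexpansive D (log_peak H B b S a).
Proof.
move=> pk a0 asmall phi hphi e e0; have [[b0 bS S1] hH HB oB far] := pk.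
have z01 : cmod (0 : C R) < 1 by rewrite cmod0.
have S0 : 0 < S by clear - S1; lra.
pose L := 24 * S / b ^+ 2.
have aS : a * (64 * S ^+ 2) <= b ^+ 3 by rewrite -ler_pdivlMr // mulr_gt0 // exprn_gt0.
(* The smallness of a gives L a <= (3 / 8) (b / S); hence [psi] is increasing up to a, and the
   factor [D0] below stays at least 1/2. *)
have La : L * a <= 3 / 8.
  rewrite /L mulrAC ler_pdivrMr ?exprn_gt0 //.
  rewrite -(ler_pM2r (x := 8 * S / 3)); last by rewrite divr_gt0 // mulr_gt0.
  rewrite (_ : _ * (8 * S / 3) = a * (64 * S ^+ 2)); last by field.
  apply: (le_trans aS).
  rewrite (_ : _ * (8 * S / 3) = b ^+ 2 * S); last by field.
  by rewrite exprSr ler_wpM2l // sqr_ge0.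
have ab : a <= b.
  have h1 : b ^+ 3 <= b * S ^+ 2.
    by rewrite exprS ler_wpM2l // ?(ltW b0) // lerXn2r // nnegrE ltW.
  have h2 : a * S ^+ 2 <= b * S ^+ 2.
    have : 0 <= a * S ^+ 2 by rewrite mulr_ge0 ?sqr_ge0 // ltW.
    by clear - aS h1; lra.
  by move: h2; rewrite ler_pM2r // exprn_gt0.
case: (pselect (B (phi 0) /\ complex.Re (H (phi 0)) <= a)) => [[B0 ha]|]; last first.
  move=> nB; have [s s0 hs] := log_peak_locally_constant pk ab hphi nB.
  exists s => // z /hs ->; rewrite subrr normr0 mulr_ge0 ?cmod_ge0 //.
  by clear - e0; lra.
set h := complex.Re (H (phi 0)) in ha.
have [h0 _] := HB _ (holo_disc_D hphi z01) B0; rewrite -/h in h0.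
pose D0 := 1 - L * h.
have L0 : 0 < L by rewrite /L divr_gt0 ?exprn_gt0 // mulr_gt0.
have D01 : 1 / 2 <= D0.
  by have : L * h <= L * a; [rewrite ler_pM2l|rewrite /D0; clear - La; lra].
have D00 : 0 < D0 by clear - D01; lra.
(* For m = min 1 e one has (1 + m / 3)^2 <= 1 + m. *)
pose e1 := Num.min 1 e / 3.
have [e10 e11] : 0 < e1 /\ (1 + e1) ^+ 2 <= 1 + e.
  have m0 : 0 < Num.min 1 e by rewrite lt_min ltr01.
  have m1 : Num.min 1 e <= 1 by rewrite ge_min lexx.
  have m2 : Num.min 1 e <= e by rewrite ge_min lexx orbT.
  by rewrite /e1; clear - m0 m1 m2; split; [lra|nra].
have hL : h^-1 - L = D0 / h by rewrite /D0; field; rewrite gt_eqF.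
have hL0 : 0 <= h^-1 - L by rewrite hL divr_ge0 // ltW.
have eta0 : 0 < D0 / h * e1 by rewrite mulr_gt0 // divr_gt0.
have [s1 s10 hs1] := ln_derivative_bound h0 hL0 eta0.
have e20 : 0 < 2 * h * e1 by rewrite mulr_gt0 // mulr_gt0.
have [s2 s20 hs2] := @disc_peak_derivative R (fun t => H (phi t))
  (fun t => B (phi t)) b S b0 bS S1 (hH phi hphi)
  (fun z lt1 Bz => HB _ (holo_disc_D hphi lt1) Bz)
  (fun z lt1 Bz => holo_disc_near hphi lt1 (open_nbhs_nbhs (conj oB Bz)))
  (fun z lt1 nBz => ltac:(
     have [s s0 hs] := holo_disc_near hphi lt1 (far _ (holo_disc_D hphi lt1) nBz);
     exists (Num.min s (1 - cmod z)); [by rewrite lt_min s0 subr_gt0|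
     move=> y; rewrite lt_min => /andP[ys y1] By; apply: (hs y ys _ By);
     apply: (holo_disc_D hphi);
     have := cmodD (y - z) z; rewrite subrK; clear - y1; lra]))
  B0 (le_trans ha asmall) _ e20.
have [s3 s30 hs3] := derivable_cmod_continuous (hH phi hphi 0 z01) s10.
have [s4 s40 hs4] := holo_disc_near hphi z01 (open_nbhs_nbhs (conj oB B0)).
exists (Num.min (Num.min s2 s3) s4); first by rewrite !lt_min s20 s30.
move=> z; rewrite !lt_min => /andP[/andP[z2 z3] z4].
have Bz : B (phi z) by apply: hs4; rewrite subr0.
rewrite /log_peak !asboolT // -/h (min_l ha) -mulrBr -/L.
set t := Num.min _ _.
pose w := cmod (H (phi z) - H (phi 0)).
(* Truncation at a does not increase the distance to h <= a; this covers also the corner, where h =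
   a. *)
have tw : `|t - h| <= w.
  have : `|complex.Re (H (phi z)) - h| <= w.
    by have := Re_le_cmod (H (phi z) - H (phi 0)); rewrite ReD ReN.
  have [le|lt] := leP (complex.Re (H (phi z))) a; first by rewrite /t min_l.
  have ha' := ltW lt; rewrite /t min_r //.
  rewrite !ger0_norm ?subr_ge0 ?(le_trans ha) //.
  by clear - ha'; lra.
have ts : `|t - h| < s1.
  by apply: (le_lt_trans tw); apply: hs3; rewrite subr0.
have hw : D0 * w <= (2 * h + 2 * h * e1) * cmod z.
  exact: (hs2 z z2).
rewrite normrM ger0_norm; last by rewrite invr_ge0.
apply: (@le_trans _ _ (2^-1 * ((h^-1 - L + D0 / h * e1) * w))).
  rewrite ler_wpM2l ?invr_ge0 //; apply: (le_trans (hs1 t ts)).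
  by rewrite ler_wpM2l // addr_ge0 // ltW.
rewrite hL (_ : _ * (_ * w) = (1 + e1) / (2 * h) * (D0 * w)); last first.
  by field; rewrite gt_eqF.
apply: (@le_trans _ _ ((1 + e1) / (2 * h) * ((2 * h + 2 * h * e1) * cmod z))).
  rewrite ler_wpM2l //; apply: divr_ge0; last by rewrite mulr_ge0 // ltW.
  by clear - e10; lra.
rewrite (_ : _ * _ = (1 + e1) ^+ 2 * cmod z); last by field; rewrite gt_eqF.
by rewrite ler_wpM2r // cmod_ge0.
Qed.

(** By [disj] at most one of the two peaks is at or below its level at phi 0; the other is constant
    nearby, so the difference varies like a single peak. *)
Lemma log_peak_sub_nonexpansive H1 B1 b1 S1 a1 H2 B2 b2 S2 a2 :
  peak_at_boundary H1 B1 b1 S1 -> peak_at_boundary H2 B2 b2 S2 ->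
  0 < a1 -> a1 <= b1 ^+ 3 / (64 * S1 ^+ 2) -> a1 <= b1 ->
  0 < a2 -> a2 <= b2 ^+ 3 / (64 * S2 ^+ 2) -> a2 <= b2 ->
  (forall x, D x -> B1 x -> complex.Re (H1 x) <= a1 ->
     B2 x -> complex.Re (H2 x) <= a2 -> False) ->
  infinitesimally_nonexpansive D
    (fun x => log_peak H1 B1 b1 S1 a1 x - log_peak H2 B2 b2 S2 a2 x).
Proof.
move=> p1 p2 a10 s1 ab1 a20 s2 ab2 disj phi hphi e e0.
have z01 : cmod (0 : C R) < 1 by rewrite cmod0.
case: (pselect (B1 (phi 0) /\ complex.Re (H1 (phi 0)) <= a1)) => [[B10 h1]|nB1].
  have nB2 : ~ (B2 (phi 0) /\ complex.Re (H2 (phi 0)) <= a2).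
    by move=> [B20 h2]; exact: (disj _ (holo_disc_D hphi z01) B10 h1 B20 h2).
  have [r r0 hr] := log_peak_locally_constant p2 ab2 hphi nB2.
  have [r' r'0 hr'] := log_peak_nonexpansive p1 a10 s1 hphi e0.
  exists (Num.min r r'); first by rewrite lt_min r0.
  move=> z; rewrite lt_min => /andP[zr zr'].
  by rewrite hr // opprB addrA subrK; exact: hr'.
have [r r0 hr] := log_peak_locally_constant p1 ab1 hphi nB1.
have [r' r'0 hr'] := log_peak_nonexpansive p2 a20 s2 hphi e0.
exists (Num.min r r'); first by rewrite lt_min r0.
move=> z; rewrite lt_min => /andP[zr zr'].
by rewrite hr // opprB addrC addrA subrK distrC; exact: hr'.
Qed.

End PeakFunction.

(** * Euclidean geometry and second-order calculus *)

Section Enorm.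
Variables (R : realType) (d : nat).
Implicit Types (u v w : 'rV[C R]_d) (c : C R).

(* Locked, because deciding convertibility of two instances of [enorm], as
   [lra] does, would unfold them down to the construction of [R[i]]. *)
Definition len u : R := locked (@enorm R d) u.

Lemma lenE u : len u = enorm u.
Proof. by rewrite /len -lock. Qed.

Lemma conjM (x y : C R) : conjc (x * y) = conjc x * conjc y :> C R.
Proof. by case: x y => a b [a' b']; apply: complex_eq => /=; ring. Qed.

Lemma conjD (x y : C R) : conjc (x + y) = conjc x + conjc y :> C R.
Proof. by case: x y => a b [a' b']; apply: complex_eq => /=; ring. Qed.

Lemma conj_sum (I : finType) (F : I -> C R) :
  conjc (\sum_i F i) = \sum_i (conjc (F i) : C R).
Proof. by apply: (big_morph (fun x : C R => conjc x : C R) conjD); exact: conjc0. Qed.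

Lemma dotmx_sum u v : dotmx u v = \sum_j u 0 j * conjc (v 0 j).
Proof. by rewrite dotmxE mxE; apply: eq_bigr => j _; rewrite !mxE. Qed.

Lemma dotmxDl u v w : dotmx (u + v) w = dotmx u w + dotmx v w.
Proof.
by rewrite !dotmx_sum -big_split; apply: eq_bigr => j _; rewrite mxE mulrDl.
Qed.

Lemma dotmxZl c u v : dotmx (c *: u) v = c * dotmx u v.
Proof.
by rewrite !dotmx_sum mulr_sumr; apply: eq_bigr => j _; rewrite mxE mulrA.
Qed.

Lemma dotmxNl u v : dotmx (- u) v = - dotmx u v.
Proof. by rewrite -scaleN1r dotmxZl mulN1r. Qed.

Lemma dotmxBl u v w : dotmx (u - v) w = dotmx u w - dotmx v w.
Proof. by rewrite dotmxDl dotmxNl. Qed.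

Lemma dotmx_conj u v : dotmx v u = conjc (dotmx u v).
Proof.
rewrite !dotmx_sum conj_sum; apply: eq_bigr => j _.
by rewrite conjM conjcK mulrC.
Qed.

Lemma dotmxDr u v w : dotmx u (v + w) = dotmx u v + dotmx u w.
Proof.
rewrite (dotmx_conj (v + w) u) (dotmx_conj v u) (dotmx_conj w u) dotmxDl.
exact: conjD.
Qed.

Lemma dotmxZr c u v : dotmx u (c *: v) = conjc c * dotmx u v.
Proof. by rewrite [LHS]dotmx_conj dotmxZl conjM -(dotmx_conj v u). Qed.

Lemma dotmxBr u v w : dotmx u (v - w) = dotmx u v - dotmx u w.
Proof.
by rewrite dotmxDr -scaleN1r dotmxZr (_ : conjc (-1 : C R) = -1) ?mulN1r //;
   apply: complex_eq => /=; rewrite ?oppr0.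
Qed.

Lemma Re_sum (I : finType) (F : I -> C R) :
  complex.Re (\sum_i F i) = \sum_i complex.Re (F i).
Proof. exact: (big_morph (@complex.Re R) (@ReD R) erefl). Qed.

Lemma Re_dotmx u v : complex.Re (dotmx u v) =
  \sum_j (complex.Re (u 0 j) * complex.Re (v 0 j) +
          complex.Im (u 0 j) * complex.Im (v 0 j)).
Proof.
rewrite dotmx_sum Re_sum; apply: eq_bigr => j _; rewrite ReM.
by case: (v 0 j) => a b /=; rewrite mulrN opprK.
Qed.

Lemma len_sqr u : len u ^+ 2 = \sum_j cmod (u 0 j) ^+ 2.
Proof.
rewrite lenE /enorm Re_dotmx sqr_sqrtr; last first.
  by rewrite sumr_ge0 // => j _; rewrite -!expr2 addr_ge0 ?sqr_ge0.
by apply: eq_bigr => j _; rewrite cmod_sqr !expr2.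
Qed.

Lemma len_ge0 u : 0 <= len u.
Proof. by rewrite lenE sqrtr_ge0. Qed.

Lemma Re_dotmx_self u : complex.Re (dotmx u u) = len u ^+ 2.
Proof.
by rewrite len_sqr Re_dotmx; apply: eq_bigr => j _; rewrite cmod_sqr !expr2.
Qed.

Lemma len0 : len (0 : 'rV[C R]_d) = 0.
Proof.
apply/eqP; rewrite -sqrf_eq0 len_sqr big1 // => j _.
by rewrite mxE cmod0 expr0n.
Qed.

Lemma lenZ c u : len (c *: u) = cmod c * len u.
Proof.
have E : len (c *: u) ^+ 2 = (cmod c * len u) ^+ 2.
  rewrite [RHS]exprMn [LHS]len_sqr (eq_bigr (fun j => cmod c ^+ 2 * cmod (u 0 j) ^+ 2)).
    by rewrite -mulr_sumr -(len_sqr u).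
  by move=> j _; rewrite mxE cmodM [LHS]exprMn.
have r0 := mulr_ge0 (cmod_ge0 c) (len_ge0 u).
apply/eqP; rewrite -(eqrXn2 (isT : (0 < 2)%N) (len_ge0 _) r0).
by rewrite E.
Qed.

Lemma lenN u : len (- u) = len u.
Proof. by rewrite -scaleN1r lenZ cmodN cmod1 mul1r. Qed.

Lemma lenC u v : len (u - v) = len (v - u).
Proof. by rewrite -opprB lenN. Qed.

Lemma cmod_le_len u j : cmod (u 0 j) <= len u.
Proof.
rewrite -(ler_pXn2r (n := 2)) ?nnegrE ?len_ge0 ?cmod_ge0 // len_sqr.
by rewrite (bigD1 j) //= lerDl sumr_ge0 // => k _; exact: sqr_ge0.
Qed.

Lemma len_eq0 u : (len u == 0) = (u == 0).
Proof.
apply/eqP/eqP => [u0|->]; last exact: len0.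
apply/rowP => j; rewrite mxE; apply/eqP; rewrite -cmod_eq0 eq_le cmod_ge0 andbT.
by rewrite -u0 cmod_le_len.
Qed.

Lemma len_gt0 u : (0 < len u) = (u != 0).
Proof. by rewrite lt_def len_ge0 andbT len_eq0. Qed.

Lemma Re_dotmx_le u v : complex.Re (dotmx u v) <= len u * len v.
Proof.
have [->|u0] := eqVneq u 0.
  by rewrite dotmx_sum big1 ?len0 ?mul0r // => j _; rewrite mxE mul0r.
have [->|v0] := eqVneq v 0.
  by rewrite len0 mulr0 dotmx_sum big1 // => j _; rewrite mxE conjc0 mulr0.
have u1 : 0 < len u by rewrite len_gt0.
have v1 : 0 < len v by rewrite len_gt0.
set a := len u in u1 *; set b := len v in v1 *.
have := sqr_ge0 (len (b%:C%C *: u - a%:C%C *: v)).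
rewrite -Re_dotmx_self dotmxBl !dotmxBr !dotmxZl !dotmxZr (dotmx_conj u v).
have := Re_dotmx_self u; have := Re_dotmx_self v; rewrite -/a -/b.
case: (dotmx u u) (dotmx v v) (dotmx u v) => x1 y1 [x2 y2] [x y] /= -> -> h.
have h2 : 0 <= 2 * (a * b) * (a * b - x) by move: h; clear; nra.
rewrite -subr_ge0 -(pmulr_rge0 _ (mulr_gt0 (ltr0Sn R 1) (mulr_gt0 u1 v1))).
exact: h2.
Qed.

Lemma cmod_dotmx_le u v : cmod (dotmx u v) <= len u * len v.
Proof.
have [c [c1 cE]] := unimodular_to_cmod (dotmx u v).
have := Re_dotmx_le (c *: u) v.
by rewrite dotmxZl cE lenZ c1 mul1r.
Qed.

Lemma lenD u v : len (u + v) <= len u + len v.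
Proof.
rewrite -(ler_pXn2r (n := 2)) ?nnegrE ?addr_ge0 ?len_ge0 //.
rewrite -Re_dotmx_self dotmxDl !dotmxDr (dotmx_conj u v).
have := Re_dotmx_self u; have := Re_dotmx_self v; have := Re_dotmx_le u v.
case: (dotmx u u) (dotmx v v) (dotmx u v) => x1 y1 [x2 y2] [x y] /= h -> ->.
by rewrite sqrrD; lra.
Qed.

Lemma len_distD w u v : len (u - v) <= len (u - w) + len (w - v).
Proof. by rewrite (le_trans _ (lenD _ _)) // addrA subrK. Qed.

Lemma len_le_sum u : len u <= \sum_j cmod (u 0 j).
Proof.
have s0 : 0 <= \sum_j cmod (u 0 j) by rewrite sumr_ge0 // => j _; exact: cmod_ge0.
rewrite -(ler_pXn2r (n := 2)) ?nnegrE ?len_ge0 // len_sqr.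
rewrite [X in _ <= X]expr2 mulr_suml ler_sum // => j _.
rewrite expr2 ler_wpM2l ?cmod_ge0 // (bigD1 j) //= lerDl sumr_ge0 // => k _.
exact: cmod_ge0.
Qed.

Lemma nbhs_lenP u (A : set 'rV[C R]_d) :
  nbhs u A <-> exists2 e, 0 < e & forall v, len (v - u) < e -> A v.
Proof.
split=> [/nbhs_ballP[e /= /gt0_complexP[r r0 ->] h]|[e e0 h]].
  exists r => // v vu; apply: h; split=> [|i j]; first by rewrite ltcR.
  rewrite /ball /= (ord1 i) distrC ltc_cmod.
  by apply: le_lt_trans vu; have := cmod_le_len (v - u) j; rewrite !mxE.
(* [d.+1] keeps the divisor nonzero in dimension 0 and the final inequality strict. *)
have e1 : 0 < e / d.+1%:R by rewrite divr_gt0 // ltr0n.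
apply/nbhs_ballP; exists (e / d.+1%:R)%:C%C; first by rewrite /= ltcR.
move=> v vu; apply: h; apply: (le_lt_trans (len_le_sum _)).
apply: (@le_lt_trans _ _ (\sum_(j < d) e / d.+1%:R)).
  apply: ler_sum => j _; apply: ltW; have := vu.2 0 j.
  by rewrite /ball /= distrC ltc_cmod !mxE.
rewrite sumr_const card_ord -[X in X < _]mulr_natr mulrAC ltr_pdivrMr ?ltr0n //.
by rewrite ltr_pM2l // ltr_nat.
Qed.

Lemma continuous_lenP (f : 'rV[C R]_d -> R) u :
  {for u, continuous f} <->
  forall e, 0 < e -> exists2 s, 0 < s &
    forall v, len (v - u) < s -> `|f v - f u| < e.
Proof.
split=> [cf e e0|H P /nbhs_ballP[e /= e0 he]].
  have /nbhs_lenP[s s0 hs] : nbhs u (f @^-1` ball (f u) e).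
    by apply: cf; exact: nbhsx_ballx.
  by exists s => // v /hs; rewrite /ball /= distrC.
have [s s0 hs] := H e e0; apply/nbhs_lenP; exists s => // v /hs vu.
by apply: he; rewrite /ball /= distrC.
Qed.

Lemma continuous_len u : {for u, continuous len}.
Proof.
apply/continuous_lenP => e e0; exists e => // v vu.
apply: le_lt_trans vu; rewrite ler_norml.
have := lenD (v - u) u; have := lenD (u - v) v.
by rewrite !subrK (lenC u); lra.
Qed.

Lemma len_bounded_closed_compact (A : set 'rV[C R]_d) (K : R) :
  closed A -> (forall u, A u -> len u <= K) -> compact A.
Proof.
move=> cA AK.
have cB := @rV_compact (C R) d (fun=> [set c : C R | 0 <= cmod c <= K])
  (fun=> @compact_annulus R 0 K).
apply: (subclosed_compact cA cB) => u /AK uK j /=.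
by rewrite cmod_ge0 /=; exact: le_trans (cmod_le_len _ _) uK.
Qed.

End Enorm.

Section Calculus.
Variables (R : realType) (d : nat).
Implicit Types (u v w y : 'rV[C R]_d) (f : 'rV[C R]_d -> R) (V : set 'rV[C R]_d).

Lemma ex_pos_lower_bound n (F : 'I_n -> R) : (forall j, 0 < F j) ->
  exists2 s, 0 < s & forall j, s <= F j.
Proof.
elim: n F => [|n IH] F F0; first by exists 1 => // -[].
have [s s0 hs] := IH (fun j => F (lift ord0 j)) (fun j => F0 _).
exists (Num.min (F ord0) s); first by rewrite lt_min F0.
move=> j; case: (unliftP ord0 j) => [k ->|->]; rewrite ge_min ?lexx //.
by rewrite hs orbT.
Qed.

Lemma len_mono u v : (forall j, cmod (u 0 j) <= cmod (v 0 j)) -> len u <= len v.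
Proof.
move=> uv; rewrite -(ler_pXn2r (n := 2)) ?nnegrE ?len_ge0 // !len_sqr.
by apply: ler_sum => j _; rewrite lerXn2r // nnegrE cmod_ge0.
Qed.

(** The real differential of f at z applied to v: the real part of the Hermitian product is the
    Euclidean product of R^(2d). *)
Definition dirD f z v : R := complex.Re (dotmx v (grad f z)).

Lemma dirD_sum f z v : dirD f z v = \sum_j (complex.Re (v 0 j) *
  pderiv (xdir j) f z + complex.Im (v 0 j) * pderiv (ydir j) f z).
Proof. by rewrite /dirD Re_dotmx; apply: eq_bigr => j _; rewrite mxE. Qed.

Lemma along_is_derive f y v (t : R) :
  derivable (along f (y + (t%:C%C : C R) *: v) v) 0 1 ->
  is_derive t 1 (along f y v) (pderiv v f (y + (t%:C%C : C R) *: v)).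
Proof.
move=> df; have d0 : is_derive (t + - t) 1 (along f (y + (t%:C%C : C R) *: v) v)
    (pderiv v f (y + (t%:C%C : C R) *: v)).
  by rewrite subrr /pderiv derive1E; exact: derivableP.
have E : (fun s => along f (y + (t%:C%C : C R) *: v) v (s + - t)) = along f y v.
  apply/funext => s; rewrite /along -addrA -scalerDl; congr (f (_ + _ *: _)).
  by rewrite -rmorphD /= addrC subrK.
by have := is_derive1_translate d0; rewrite E.
Qed.

Lemma basis_step f y v (a b e : R) :
  (forall t : R, `|t| <= `|a| -> derivable (along f (y + (t%:C%C : C R) *: v) v) 0 1 /\
     `|pderiv v f (y + (t%:C%C : C R) *: v) - b| <= e) ->
  `|f (y + (a%:C%C : C R) *: v) - f y - a * b| <= e * `|a|.
Proof.
move=> H.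
have M := @mean_value_dist R (fun t => along f y v t - b * t)
  (fun t => pderiv v f (y + (t%:C%C : C R) *: v) - b) 0 a e.
have E0 : along f y v 0 = f y by rewrite /along scale0r addr0.
rewrite (_ : _ - _ - _ = along f y v a - b * a - (along f y v 0 - b * 0)); last first.
  by rewrite E0 mulr0 subr0 addrAC [b * a]mulrC.
rewrite -[X in _ <= e * `|X|]subr0.
apply: M => t; rewrite !subr0 => ta; last by have [] := H t ta.
have [df _] := H t ta.
apply: is_derive1_sub; first exact: along_is_derive.
have := is_deriveZ b (is_derive_id t (1 : R)).
by rewrite /GRing.scale /= mulr1.
Qed.

(** The displacement v is travelled one real coordinate at a time, and the mean value theorem is
    applied on each of the 2 d segments. *)
Lemma class_C1_differentiable V f z : open V -> V z -> class_C 1 V f ->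
  forall e, 0 < e -> exists2 s, 0 < s &
    forall v, len v < s -> `|f (z + v) - f z - dirD f z v| <= e * len v.
Proof.
move=> oV Vz [_ H] e e0.
pose e1 := e / (2 * d.+1%:R).
have e10 : 0 < e1 by rewrite divr_gt0 // mulr_gt0 // ltr0n.
have near w : real_basis w -> exists2 s, 0 < s & forall y, len (y - z) < s ->
    derivable (along f y w) 0 1 /\ `|pderiv w f y - pderiv w f z| <= e1.
  move=> bw; have [dw [cw _]] := H w bw.
  have /nbhs_lenP[s1 s10 hs1] := open_nbhs_nbhs (conj oV Vz).
  have /continuous_lenP/(_ e1 e10)[s2 s20 hs2] := cw z Vz.
  exists (Num.min s1 s2); first by rewrite lt_min s10.
  move=> y; rewrite lt_min => /andP[/hs1 Vy /hs2 h]; split; last exact: ltW.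
  exact: dw.
have /choice[sx sxP] : forall j : 'I_d, exists s : R, 0 < s /\ forall y, len (y - z) < s ->
    derivable (along f y (xdir j)) 0 1 /\
    `|pderiv (xdir j) f y - pderiv (xdir j) f z| <= e1.
  by move=> j; have [|s s0 hs] := near (xdir j); [left; exists j|exists s].
have /choice[sy syP] : forall j : 'I_d, exists s : R, 0 < s /\ forall y, len (y - z) < s ->
    derivable (along f y (ydir j)) 0 1 /\
    `|pderiv (ydir j) f y - pderiv (ydir j) f z| <= e1.
  by move=> j; have [|s s0 hs] := near (ydir j); [right; exists j|exists s].
have [s s0 hs] := @ex_pos_lower_bound d (fun j => Num.min (sx j) (sy j))
  (fun j => ltac:(by rewrite lt_min (sxP j).1 (syP j).1)).
exists s => // v vs.
(* [W k] keeps the first k complex coordinates of v, and [X k a] adds the real displacement a in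
   coordinate k; by [Wlen] the intermediate displacements are no longer than v. *)
have [W WE] : exists W : nat -> 'rV[C R]_d,
    forall k, W k = \row_j (if (j < k)%N then v 0 j else 0) by eexists.
have W0 : W 0%N = 0 by apply/rowP => j; rewrite WE !mxE.
have Wd : W d = v by apply/rowP => j; rewrite WE !mxE ltn_ord.
pose X (k : 'I_d) (a : R) := W k + (a%:C%C : C R) *: xdir k.
have Wlen (k : 'I_d) (a b : R) : `|a| <= `|complex.Re (v 0 k)| ->
    `|b| <= `|complex.Im (v 0 k)| ->
    len (X k a + (b%:C%C : C R) *: ydir k) <= len v.
  move=> ha hb; apply: len_mono => j; rewrite /X WE !mxE /=.
  have [->|jk] := eqVneq j k.
    rewrite ltnn !mulr1 add0r.
    rewrite -(ler_pXn2r (n := 2)) ?nnegrE ?cmod_ge0 // !cmod_sqr.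
    rewrite !(ReD, ImD, ReM, ImM) /= !(mulr0, mul0r, mulr1, subr0, addr0, add0r).
    rewrite -(real_normK (num_real a)) -(real_normK (num_real b)).
    rewrite -(real_normK (num_real (complex.Re _))) -(real_normK (num_real (complex.Im _))).
    by apply: lerD; rewrite lerXn2r // nnegrE.
  by rewrite !mulr0 !addr0; case: ifP => // _; rewrite cmod0 cmod_ge0.
have WS (k : 'I_d) : W k.+1 = X k (complex.Re (v 0 k)) +
    ((complex.Im (v 0 k))%:C%C : C R) *: ydir k.
  apply/rowP => j; rewrite /X !WE !mxE /=; have [->|jk] := eqVneq j k.
    rewrite ltnSn ltnn !mulr1 add0r; apply: complex_eq;
    by rewrite !(ReD, ImD, ReM, ImM) /= !(mulr0, mul0r, mulr1, subr0, addr0, add0r).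
  by rewrite !mulr0 !addr0 ltnS leq_eqVlt (_ : (j == k :> nat) = false) //; apply/negbTE.
pose De (k : 'I_d) := complex.Re (v 0 k) * pderiv (xdir k) f z +
   complex.Im (v 0 k) * pderiv (ydir k) f z.
have step (k : 'I_d) : `|f (z + W k.+1) - f (z + W k) - De k| <= 2 * e1 * len v.
  have h1 : `|f (z + X k (complex.Re (v 0 k))) - f (z + W k) -
      complex.Re (v 0 k) * pderiv (xdir k) f z| <= e1 * `|complex.Re (v 0 k)|.
    rewrite /X (addrA z).
    apply: (@basis_step f (z + W k) (xdir k)) => t ht.
    apply: (sxP k).2.
    rewrite (_ : _ - z = X k t); last by rewrite /X -(addrA z) addrC addrK.
    apply: (le_lt_trans _ (lt_le_trans vs (le_trans (hs k) _))).
      by have := Wlen k t 0 ht; rewrite normr0 scale0r addr0; apply.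
    by rewrite ge_min lexx.
  have h2 : `|f (z + W k.+1) - f (z + X k (complex.Re (v 0 k))) -
      complex.Im (v 0 k) * pderiv (ydir k) f z| <= e1 * `|complex.Im (v 0 k)|.
    have -> : f (z + W k.+1) = f (z + X k (complex.Re (v 0 k)) +
        ((complex.Im (v 0 k))%:C%C : C R) *: ydir k).
      by congr f; rewrite (WS k); exact: addrA.
    apply: (@basis_step f (z + X k (complex.Re (v 0 k))) (ydir k)) => t ht.
    apply: (syP k).2; rewrite -(addrA z) addrC addrK.
    apply: (le_lt_trans _ (lt_le_trans vs (le_trans (hs k) _))).
      by apply: Wlen.
    by rewrite ge_min lexx orbT.
  have r1 := le_trans (Re_le_cmod (v 0 k)) (cmod_le_len v k).
  have r2 := le_trans (Im_le_cmod (v 0 k)) (cmod_le_len v k).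
  have k1 : e1 * `|complex.Re (v 0 k)| <= e1 * len v by rewrite ler_wpM2l // ltW.
  have k2 : e1 * `|complex.Im (v 0 k)| <= e1 * len v by rewrite ler_wpM2l // ltW.
  move: h1 h2 k1 k2; rewrite /De.
  generalize (f (z + X k (complex.Re (v 0 k)))) => b.
  generalize (f (z + W k.+1)) (f (z + W k)) (complex.Re (v 0 k)) (complex.Im (v 0 k))
    (pderiv (xdir k) f z) (pderiv (ydir k) f z) (len v).
  move=> a c x y m n l h1 h2 k1 k2.
  have -> : a - c - (x * m + y * n) = (a - b - y * n) + (b - c - x * m) by ring.
  by apply: (le_trans (ler_normD _ _)); lra.
have -> : f (z + v) - f z - dirD f z v =
    \sum_(k < d) (f (z + W k.+1) - f (z + W k) - De k).
  rewrite sumrB dirD_sum; congr (_ - _).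
  rewrite -(big_mkord xpredT (fun k => f (z + W k.+1) - f (z + W k))).
  by rewrite telescope_sumr // W0 Wd addr0.
apply: (le_trans (ler_norm_sum _ _ _)).
apply: (@le_trans _ _ (\sum_(k < d) 2 * e1 * len v)).
  by apply: ler_sum => k _; exact: step.
rewrite sumr_const card_ord -[X in X <= _]mulr_natr.
have -> : e * len v = 2 * e1 * len v * d.+1%:R.
  have n0 : d.+1%:R != 0 :> R by rewrite pnatr_eq0.
  by rewrite /e1; move: n0; generalize (d.+1%:R : R) => N n0; field.
apply: ler_wpM2l; last by rewrite ler_nat.
by apply: mulr_ge0; [apply: mulr_ge0; [|exact: ltW]|exact: len_ge0].
Qed.

End Calculus.

Section SecondOrder.
Variables (R : realType) (d : nat).
Implicit Types (u v w x y z p q : 'rV[C R]_d) (f g : 'rV[C R]_d -> R)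
  (V : set 'rV[C R]_d).

Definition ray q v (t : R) : 'rV[C R]_d := q + (t%:C%C : C R) *: v.

Lemma class_C_pred k V f : class_C k.+1 V f -> class_C k V f.
Proof.
elim: k f => [|k IH] f [cf H]; first by [].
by split=> // v /H[dv cv]; split=> //; exact: IH.
Qed.

(** Passes from a displacement of length Y L along a vector of length L to the parameter Y; L + 1
    avoids dividing by 0 for the zero vector. *)
Lemma scaled_bound (a e L Y s : R) : 0 < e -> 0 <= L -> 0 <= Y ->
  Y < s / (L + 1) -> (Y * L < s -> a <= e / (L + 1) * (Y * L)) -> a <= e * Y.
Proof.
move=> e0 L0 Y0; have L1 : 0 < L + 1 by rewrite ltr_wpDl.
rewrite ltr_pdivlMr // => Ys H; apply: (le_trans (H _)).
  by apply: le_lt_trans Ys; apply: ler_wpM2l => //; rewrite lerDl.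
have -> : e / (L + 1) * (Y * L) = e * Y * (L / (L + 1)) by ring.
apply: ler_piMr; first by rewrite mulr_ge0 // ltW.
by rewrite ler_pdivrMr // mul1r lerDl.
Qed.

Lemma ray_derive V f q v (t : R) : open V -> class_C 1 V f -> V (ray q v t) ->
  is_derive t 1 (fun s => f (ray q v s)) (dirD f (ray q v t) v).
Proof.
move=> oV cf Vt; apply/is_derive1_littleoP => e e0.
have l1 : 0 < len v + 1 by rewrite ltr_wpDl // len_ge0.
have [s s0 hs] := class_C1_differentiable oV Vt cf (divr_gt0 e0 l1).
exists (s / (len v + 1)); first exact: divr_gt0.
move=> y yt; have := hs (((y - t)%:C%C : C R) *: v).
have cy : cmod ((y - t)%:C%C : C R) = `|y - t|.
  rewrite -(ger0_norm (cmod_ge0 _)); apply/eqP.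
  by rewrite -(eqrXn2 (isT : (0 < 2)%N)) ?normr_ge0 // -!normrX cmod_sqr /= expr0n addr0.
rewrite lenZ cy.
have E : ray q v t + ((y - t)%:C%C : C R) *: v = ray q v y.
  by rewrite /ray -addrA -scalerDl -rmorphD /= [t + _]addrC subrK.
have Ed : dirD f (ray q v t) (((y - t)%:C%C : C R) *: v) = dirD f (ray q v t) v * (y - t).
  rewrite /dirD dotmxZl; case: (dotmx _ _) => a b /=; ring.
rewrite E Ed; move=> H.
exact: (@scaled_bound _ e (len v) `|y - t| s e0 (len_ge0 v) (normr_ge0 _) yt H).
Qed.

(** The quadratic form of the real Hessian, that is, the second derivative along the line of
    direction v. *)
Definition hess f z v : R := \sum_j (complex.Re (v 0 j) * dirD (pderiv (xdir j) f) z v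
  + complex.Im (v 0 j) * dirD (pderiv (ydir j) f) z v).

Lemma ray_derive2 V f q v (t : R) : open V -> class_C 2 V f -> V (ray q v t) ->
  is_derive t 1 (fun s => dirD f (ray q v s) v) (hess f (ray q v t) v).
Proof.
move=> oV [_ H] Vt.
have cx j : class_C 1 V (pderiv (xdir j) f) by apply: (H _ _).2; left; exists j.
have cy j : class_C 1 V (pderiv (ydir j) f) by apply: (H _ _).2; right; exists j.
have hj (j : 'I_d) : is_derive t 1
    (fun s => complex.Re (v 0 j) * pderiv (xdir j) f (ray q v s) +
              complex.Im (v 0 j) * pderiv (ydir j) f (ray q v s))
    (complex.Re (v 0 j) * dirD (pderiv (xdir j) f) (ray q v t) v
      + complex.Im (v 0 j) * dirD (pderiv (ydir j) f) (ray q v t) v).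
  apply: is_derive1_lincomb; first exact: ray_derive (cx j) Vt.
  have := is_derive1_lincomb (complex.Im (v 0 j)) (ray_derive oV (cy j) Vt) (is_derive_cst (0 : R) t 1).
  by rewrite addr0; under eq_fun do rewrite /= addr0.
have := is_derive_sum hj; rewrite -/(hess f (ray q v t) v).
rewrite (_ : \sum_(i < d) _ = fun s => dirD f (ray q v s) v) //.
by apply/funext => s; rewrite fct_sumE dirD_sum.
Qed.

Lemma grad_continuous V f p : open V -> V p -> class_C 1 V f ->
  forall e, 0 < e -> exists2 s, 0 < s & forall q, len (q - p) < s ->
    len (grad f q - grad f p) <= e.
Proof.
move=> oV Vp [_ H] e e0.
pose e1 := e / (2 * d.+1%:R).
have e10 : 0 < e1 by rewrite divr_gt0 // mulr_gt0 // ltr0n.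
have cx w : real_basis w -> exists s, 0 < s /\ forall q, len (q - p) < s ->
    `|pderiv w f q - pderiv w f p| < e1.
  move=> bw; have [_ [cw _]] := H w bw.
  by have /continuous_lenP/(_ e1 e10)[s s0 hs] := cw p Vp; exists s.
have /choice[sx sxP] : forall j : 'I_d, exists s : R, 0 < s /\ forall q, len (q - p) < s ->
    `|pderiv (xdir j) f q - pderiv (xdir j) f p| < e1.
  by move=> j; apply: cx; left; exists j.
have /choice[sy syP] : forall j : 'I_d, exists s : R, 0 < s /\ forall q, len (q - p) < s ->
    `|pderiv (ydir j) f q - pderiv (ydir j) f p| < e1.
  by move=> j; apply: cx; right; exists j.
have [s s0 hs] := @ex_pos_lower_bound R d (fun j => Num.min (sx j) (sy j))
  (fun j => ltac:(by rewrite lt_min (sxP j).1 (syP j).1)).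
exists s => // q qs.
apply: (le_trans (len_le_sum _)).
apply: (@le_trans _ _ (\sum_(j < d) 2 * e1)).
  apply: ler_sum => j _; apply: (le_trans (cmod_le _)).
  have := (sxP j).2 q; have := (syP j).2 q; have := hs j; rewrite le_min => /andP[h1 h2].
  move=> /(_ (lt_le_trans qs h2)) k2 /(_ (lt_le_trans qs h1)) k1.
  have -> : complex.Re ((grad f q - grad f p) 0 j) =
    pderiv (xdir j) f q - pderiv (xdir j) f p by rewrite mxE ReD mxE mxE ReN mxE.
  have -> : complex.Im ((grad f q - grad f p) 0 j) =
    pderiv (ydir j) f q - pderiv (ydir j) f p by rewrite mxE ImD mxE mxE ImN mxE.
  by apply: (le_trans (lerD (ltW k1) (ltW k2))); rewrite mulr_natl mulr2n.
rewrite sumr_const card_ord -[X in X <= _]mulr_natr.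
have -> : e = 2 * e1 * d.+1%:R.
  have n0 : d.+1%:R != 0 :> R by rewrite pnatr_eq0.
  by rewrite /e1; move: n0; generalize (d.+1%:R : R) => N n0; field.
apply: ler_wpM2l; last by rewrite ler_nat.
by apply: mulr_ge0; [|exact: ltW].
Qed.

Lemma dirD_le f z v : `|dirD f z v| <= len v * len (grad f z).
Proof. exact: le_trans (Re_le_cmod _) (cmod_dotmx_le _ _). Qed.

Lemma hess_sum_bound (a b : 'I_d -> R) v (M : R) : 0 <= M ->
  (forall j, `|a j| <= M) -> (forall j, `|b j| <= M) ->
  `|\sum_j (complex.Re (v 0 j) * a j + complex.Im (v 0 j) * b j)|
    <= 2 * d%:R * len v * M.
Proof.
move=> M0 ha hb; apply: (le_trans (ler_norm_sum _ _ _)).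
apply: (@le_trans _ _ (\sum_(j < d) 2 * len v * M)).
  apply: ler_sum => j _; apply: (le_trans (ler_normD _ _)); rewrite !normrM.
  have r1 := le_trans (Re_le_cmod (v 0 j)) (cmod_le_len v j).
  have r2 := le_trans (Im_le_cmod (v 0 j)) (cmod_le_len v j).
  have k1 : `|complex.Re (v 0 j)| * `|a j| <= len v * M by apply: ler_pM.
  have k2 : `|complex.Im (v 0 j)| * `|b j| <= len v * M by apply: ler_pM.
  by lra.
by rewrite sumr_const card_ord -[X in X <= _]mulr_natr le_eqVlt; apply/orP; left; apply/eqP; ring.
Qed.

Lemma hess_continuous V f p : open V -> V p -> class_C 2 V f ->
  forall e, 0 < e -> exists2 s, 0 < s & forall q, len (q - p) < s ->
    forall v, `|hess f q v - hess f p v| <= e * len v ^+ 2.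
Proof.
move=> oV Vp [_ H] e e0.
pose e1 := e / (2 * d.+1%:R).
have e10 : 0 < e1 by rewrite divr_gt0 // mulr_gt0 // ltr0n.
have cx w : real_basis w -> exists s, 0 < s /\ forall q, len (q - p) < s ->
    len (grad (pderiv w f) q - grad (pderiv w f) p) <= e1.
  move=> bw; have [_ cw] := H w bw.
  by have [s s0 hs] := grad_continuous oV Vp cw e10; exists s.
have /choice[sx sxP] : forall j : 'I_d, exists s : R, 0 < s /\ forall q, len (q - p) < s ->
    len (grad (pderiv (xdir j) f) q - grad (pderiv (xdir j) f) p) <= e1.
  by move=> j; apply: cx; left; exists j.
have /choice[sy syP] : forall j : 'I_d, exists s : R, 0 < s /\ forall q, len (q - p) < s ->
    len (grad (pderiv (ydir j) f) q - grad (pderiv (ydir j) f) p) <= e1.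
  by move=> j; apply: cx; right; exists j.
have [s s0 hs] := @ex_pos_lower_bound R d (fun j => Num.min (sx j) (sy j))
  (fun j => ltac:(by rewrite lt_min (sxP j).1 (syP j).1)).
exists s => // q qs v.
have B w : len (grad (pderiv w f) q - grad (pderiv w f) p) <= e1 ->
    `|dirD (pderiv w f) q v - dirD (pderiv w f) p v| <= len v * e1.
  move=> h; rewrite /dirD -ReN -ReD -dotmxBr.
  apply: (le_trans (Re_le_cmod _)); apply: (le_trans (cmod_dotmx_le _ _)).
  by rewrite ler_wpM2l // len_ge0.
have -> : hess f q v - hess f p v = \sum_j
   (complex.Re (v 0 j) * (dirD (pderiv (xdir j) f) q v - dirD (pderiv (xdir j) f) p v) +
    complex.Im (v 0 j) * (dirD (pderiv (ydir j) f) q v - dirD (pderiv (ydir j) f) p v)).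
  have lin (a b x x' y y' : R) : a * x + b * y - (a * x' + b * y') =
    a * (x - x') + b * (y - y') by ring.
  by rewrite /hess -sumrB; apply: eq_bigr => j _; exact: lin.
apply: (le_trans (@hess_sum_bound _ _ v (len v * e1) _ _ _)).
- by rewrite mulr_ge0 ?len_ge0 // ltW.
- move=> j; apply: B; apply: (sxP j).2; apply: (lt_le_trans qs).
  by apply: (le_trans (hs j)); rewrite ge_min lexx.
- move=> j; apply: B; apply: (syP j).2; apply: (lt_le_trans qs).
  by apply: (le_trans (hs j)); rewrite ge_min lexx orbT.
have eE : e = e1 * (2 * d.+1%:R) by rewrite /e1 divfK // mulf_neq0 ?pnatr_eq0.
have -> : e * len v ^+ 2 = 2 * d.+1%:R * len v * (len v * e1) by rewrite eE; ring.
have l0 := len_ge0 v.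
apply: ler_wpM2r; first by apply: mulr_ge0; [|exact: ltW].
by apply: ler_wpM2r => //; apply: ler_wpM2l => //; rewrite ler_nat.
Qed.

Lemma hess_bound f p : exists2 K, 0 <= K & forall v, `|hess f p v| <= K * len v ^+ 2.
Proof.
pose M := \sum_(j < d) (len (grad (pderiv (xdir j) f) p) + len (grad (pderiv (ydir j) f) p)).
have M0 : 0 <= M by rewrite sumr_ge0 // => j _; rewrite addr_ge0 // len_ge0.
exists (2 * d%:R * M); first by rewrite mulr_ge0 // mulr_ge0 // ler0n.
move=> v; have Mj j : len (grad (pderiv (xdir j) f) p) + len (grad (pderiv (ydir j) f) p) <= M.
  rewrite /M (bigD1 j) //= lerDl sumr_ge0 // => k _.
  by rewrite addr_ge0 // len_ge0.
have l0 := len_ge0 v.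
apply: (le_trans (@hess_sum_bound _ _ v (len v * M) _ _ _)).
- by rewrite mulr_ge0.
- move=> j; apply: (le_trans (dirD_le _ _ _)); rewrite ler_wpM2l //.
  by apply: le_trans (Mj j); rewrite lerDl; exact: len_ge0.
- move=> j; apply: (le_trans (dirD_le _ _ _)); rewrite ler_wpM2l //.
  by apply: le_trans (Mj j); rewrite lerDr; exact: len_ge0.
by rewrite le_eqVlt; apply/orP; left; apply/eqP; ring.
Qed.

(** The radius is uniform in the base point q, because the Hessian form varies by at most e |v|^2
    along the segment from q to x; the mean value bound is then applied twice along it. *)
Lemma Taylor2 V f p : open V -> V p -> class_C 2 V f ->
  forall e, 0 < e -> exists2 s, 0 < s & forall q x,
    len (q - p) < s -> len (x - p) < s ->
    `|f x - f q - dirD f q (x - q) - hess f q (x - q) / 2| <= e * len (x - q) ^+ 2.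
Proof.
move=> oV Vp cf e e0.
have e20 : 0 < e / 2 by rewrite divr_gt0.
have [s1 s10 hs1] := hess_continuous oV Vp cf e20.
have /nbhs_lenP[s2 s20 hs2] := open_nbhs_nbhs (conj oV Vp).
pose s := Num.min s1 s2 / 3.
have m0 : 0 < Num.min s1 s2 by rewrite lt_min s10.
exists s; first by rewrite divr_gt0.
move=> q x qs xs; set v := x - q.
have seg (t : R) : 0 <= t <= 1 -> len (ray q v t - p) < Num.min s1 s2.
  move=> /andP[t0 t1].
  have -> : ray q v t - p = (q - p) + (t%:C%C : C R) *: v by rewrite /ray addrAC.
  apply: (le_lt_trans (lenD _ _)); rewrite lenZ cmod_of_real //.
  have vs : len v <= len (x - p) + len (q - p).
    by rewrite (lenC q p); exact: len_distD.
  have : t * len v <= len v by rewrite -[X in _ <= X]mul1r ler_wpM2r // len_ge0.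
  by move: qs xs; rewrite /s; lra.
have cf1 := class_C_pred cf.
have D1 (t : R) : 0 <= t <= 1 -> is_derive t 1 (fun s => f (ray q v s)) (dirD f (ray q v t) v).
  move=> /seg; rewrite lt_min => /andP[_ h]; apply: (ray_derive oV cf1); exact: hs2.
have D2 (t : R) : 0 <= t <= 1 -> is_derive t 1 (fun s => dirD f (ray q v s) v) (hess f (ray q v t) v).
  move=> /seg; rewrite lt_min => /andP[_ h]; apply: (ray_derive2 oV cf); exact: hs2.
set K := hess f q v.
have q0 : ray q v 0 = q by rewrite /ray scale0r addr0.
have q1 : ray q v 1 = x by rewrite /ray scale1r /v addrC subrK.
have HK (t : R) : 0 <= t <= 1 -> `|hess f (ray q v t) v - K| <= e * len v ^+ 2.
  move=> ht; have := seg t ht; rewrite lt_min => /andP[/hs1/(_ v) k1 _].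
  have k2 := hs1 q _ v.
  have {}k2 : `|hess f q v - hess f p v| <= e / 2 * len v ^+ 2.
    by apply: k2; apply: (lt_trans qs); rewrite /s; have := ge_min s1 s1 s2; rewrite lexx /=; move=> h; lra.
  apply: (le_trans (ler_distD (hess f p v) _ _)); rewrite [X in _ + X]distrC.
  by apply: (le_trans (lerD k1 k2)); rewrite -mulrDl -splitr.
set E := e * len v ^+ 2 in HK *.
have G (t : R) : 0 <= t <= 1 -> `|dirD f (ray q v t) v - K * t - dirD f q v| <= E.
  move=> /andP[t0 t1].
  have E0 : 0 <= E by rewrite mulr_ge0 ?(ltW e0) // sqr_ge0.
  have := @mean_value_bound R (fun s => dirD f (ray q v s) v)
    (fun s => hess f (ray q v s) v) 0 t K E t0.
  rewrite q0 subr0 addrAC => M; apply: (le_trans (M _ _)).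
  - by move=> y /andP[y0 yt]; apply: D2; rewrite y0 (le_trans yt).
  - by move=> y /andP[y0 yt]; apply: HK; rewrite y0 (le_trans yt).
  - by rewrite -[X in _ <= X]mulr1; apply: ler_wpM2l.
have D3 (t : R) : 0 <= t <= 1 -> is_derive t 1
    (fun s => f (ray q v s) - K / 2 * (s ^+ 2 + 0)) (dirD f (ray q v t) v - K * t).
  move=> /D1 d1; have := is_derive1_sub d1 (is_derive1_square (K / 2) 0 t).
  by rewrite (_ : 2 * (K / 2) = K) //; field.
have := @mean_value_bound R (fun s => f (ray q v s) - K / 2 * (s ^+ 2 + 0))
  (fun s => dirD f (ray q v s) v - K * s) 0 1 (dirD f q v) E ler01 D3 G.
rewrite q0 q1 subr0 !mulr1 expr1n expr0n !addr0 mulr0 subr0 mulr1 => M.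
have lin (a b c k : R) : a - b - c - k = a - k - b - c by ring.
by rewrite lin.
Qed.

End SecondOrder.

(** * The Levi form *)

Section Levi.
Variables (R : realType) (d : nat).
Implicit Types (u v w x y z p q X : 'rV[C R]_d) (f r : 'rV[C R]_d -> R)
  (V : set 'rV[C R]_d).

Lemma pderiv_cst v (c : R) z : pderiv v (fun=> c) z = 0.
Proof.
rewrite /pderiv (_ : along _ z v = fun=> c) //; first exact: derive1_cst.
Qed.

Lemma pderiv_half v f z : derivable (along f z v) 0 1 ->
  pderiv v (fun x => 2^-1 * f x) z = 2^-1 * pderiv v f z.
Proof.
move=> df; rewrite /pderiv !derive1E.
exact (@deriveZ R R R (along f z v) 2^-1 0 1 df).
Qed.

Lemma pderivC_real v f z :
  pderivC v (fun x => (f x)%:C%C : C R) z = (pderiv v f z)%:C%C.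
Proof. by rewrite /pderivC /= pderiv_cst. Qed.

Lemma iE : 'i = (0 +i* 1)%C :> C R.
Proof. by rewrite -complexiE. Qed.

Lemma halfE : (2^-1 : C R) = ((2^-1 : R)%:C)%C.
Proof. by rewrite fmorphV rmorph_nat. Qed.

Lemma dz_real j f z : dz j (fun x => (f x)%:C%C : C R) z =
  (2^-1 * pderiv (xdir j) f z +i* (- (2^-1 * pderiv (ydir j) f z)))%C.
Proof.
rewrite /dz !pderivC_real iE halfE; generalize (pderiv (xdir j) f z) (pderiv (ydir j) f z) => a b.
by apply: complex_eq; rewrite !(ReM, ImM, ReD, ImD, ReN, ImN) /=; ring.
Qed.

Lemma dzbar_real j f z : dzbar j (fun x => (f x)%:C%C : C R) z =
  (2^-1 * pderiv (xdir j) f z +i* (2^-1 * pderiv (ydir j) f z))%C.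
Proof.
rewrite /dzbar !pderivC_real iE halfE; generalize (pderiv (xdir j) f z) (pderiv (ydir j) f z) => a b.
by apply: complex_eq; rewrite !(ReM, ImM, ReD, ImD) /=; ring.
Qed.

Let P2 (a b : 'I_d -> 'rV[C R]_d) f z j k := pderiv (a j) (pderiv (b k) f) z.

Lemma dz_dzbar V f z j k : class_C 2 V f -> V z ->
  dz j (dzbar k (fun x => (f x)%:C%C : C R)) z =
  (4^-1 * (P2 xdir xdir f z j k + P2 ydir ydir f z j k)
   +i* (4^-1 * (P2 xdir ydir f z j k - P2 ydir xdir f z j k)))%C.
Proof.
move=> [_ H] Vz.
have bx i : real_basis (xdir i : 'rV[C R]_d) by left; exists i.
have by_ i : real_basis (ydir i : 'rV[C R]_d) by right; exists i.
have h a b : real_basis (a : 'rV[C R]_d) -> real_basis b ->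
    pderiv a (fun x => 2^-1 * pderiv b f x) z = 2^-1 * pderiv a (pderiv b f) z.
  by move=> ba bb; apply: pderiv_half; exact: ((H b bb).2.2 a ba).1.
have pair a : pderivC a (dzbar k (fun x => (f x)%:C%C : C R)) z =
  (pderiv a (fun x => 2^-1 * pderiv (xdir k) f x) z +i*
   pderiv a (fun x => 2^-1 * pderiv (ydir k) f x) z)%C.
  rewrite /pderivC; congr (pderiv a _ z +i* pderiv a _ z)%C;
  by apply/funext => x; rewrite dzbar_real.
rewrite /dz (pair (xdir j)) (pair (ydir j)).
move: (h _ _ (bx j) (bx k)) (h _ _ (by_ j) (bx k)) (h _ _ (bx j) (by_ k)) (h _ _ (by_ j) (by_ k)).
rewrite /P2.
generalize (pderiv (xdir j) (fun x => 2^-1 * pderiv (xdir k) f x) z)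
  (pderiv (ydir j) (fun x => 2^-1 * pderiv (xdir k) f x) z)
  (pderiv (xdir j) (fun x => 2^-1 * pderiv (ydir k) f x) z)
  (pderiv (ydir j) (fun x => 2^-1 * pderiv (ydir k) f x) z).
generalize (pderiv (xdir j) (pderiv (xdir k) f) z) (pderiv (ydir j) (pderiv (xdir k) f) z)
  (pderiv (xdir j) (pderiv (ydir k) f) z) (pderiv (ydir j) (pderiv (ydir k) f) z).
move=> a b c e a' b' c' e' -> -> -> ->; rewrite iE halfE.
by apply: complex_eq; rewrite !(ReM, ImM, ReD, ImD, ReN, ImN) /=; field.
Qed.

Lemma hess_sum f z v : hess f z v = \sum_j \sum_k
  (complex.Re (v 0 k) * (complex.Re (v 0 j) * P2 xdir xdir f z j k +
                         complex.Im (v 0 j) * P2 ydir xdir f z j k) +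
   complex.Im (v 0 k) * (complex.Re (v 0 j) * P2 xdir ydir f z j k +
                         complex.Im (v 0 j) * P2 ydir ydir f z j k)).
Proof.
rewrite exchange_big /hess; apply: eq_bigr => k _.
move: (dirD_sum (pderiv (xdir k) f) z v) (dirD_sum (pderiv (ydir k) f) z v).
generalize (dirD (pderiv (xdir k) f) z v) (dirD (pderiv (ydir k) f) z v).
by move=> a b -> ->; rewrite /P2 !mulr_sumr -big_split.
Qed.

Lemma Re_i_scale v j : complex.Re (('i *: v) 0 j) = - complex.Im (v 0 j).
Proof. by rewrite mxE iE ReM /= mul0r mul1r add0r. Qed.
Lemma Im_i_scale v j : complex.Im (('i *: v) 0 j) = complex.Re (v 0 j).
Proof. by rewrite mxE iE ImM /= mul0r mul1r add0r. Qed.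

(** Under v -> i v the Hessian splits into an even part, which is twice the Levi form, and an odd
    part, which by [Re_quad_hess] is the real part of a holomorphic quadratic polynomial. *)
Lemma Re_levi V f z X : class_C 2 V f -> V z ->
  complex.Re (levi f z X) = (hess f z X + hess f z ('i *: X)) / 4.
Proof.
move=> cf Vz; rewrite /levi Re_sum !hess_sum -big_split mulr_suml.
apply: eq_bigr => j _; rewrite Re_sum -big_split mulr_suml.
apply: eq_bigr => k _; rewrite (dz_dzbar _ _ cf Vz) !Re_i_scale !Im_i_scale.
generalize (P2 xdir xdir f z j k) (P2 xdir ydir f z j k) (P2 ydir xdir f z j k)
  (P2 ydir ydir f z j k) => a b c e.
case: (X 0 j) (X 0 k) => x1 y1 [x2 y2].
by rewrite (_ : (_^*)%R = (x2 -i* y2)%C) // !(ReM, ImM) /=; field.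
Qed.

Definition quad (m : 'I_d -> 'I_d -> C R) v : C R := \sum_j \sum_k m j k * v 0 j * v 0 k.

Definition hess_coef f z (j k : 'I_d) : C R :=
  (4^-1 * (P2 xdir xdir f z j k - P2 ydir ydir f z j k)
   +i* (- (4^-1 * (P2 xdir ydir f z j k + P2 ydir xdir f z j k))))%C.

Lemma Re_quad_hess f z v :
  complex.Re (quad (hess_coef f z) v) = (hess f z v - hess f z ('i *: v)) / 4.
Proof.
rewrite /quad Re_sum !hess_sum -sumrB mulr_suml.
apply: eq_bigr => j _; rewrite Re_sum -sumrB mulr_suml.
apply: eq_bigr => k _; rewrite /hess_coef !Re_i_scale !Im_i_scale.
generalize (P2 xdir xdir f z j k) (P2 xdir ydir f z j k) (P2 ydir xdir f z j k)
  (P2 ydir ydir f z j k) => a b c e.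
by case: (v 0 j) (v 0 k) => x1 y1 [x2 y2]; rewrite !(ReM, ImM) /=; field.
Qed.

Lemma quad_lipschitz m : exists2 K, 0 <= K & forall u w,
  cmod (quad m u - quad m w) <= K * (len (u - w) * (len u + len w)).
Proof.
pose K := \sum_j \sum_k cmod (m j k).
exists K; first by rewrite sumr_ge0 // => j _; rewrite sumr_ge0 // => k _; exact: cmod_ge0.
have cmod_sum (I : finType) (F : I -> C R) : cmod (\sum_i F i) <= \sum_i cmod (F i).
  elim/big_ind2: _ => [|x1 y1 x2 y2 h1 h2|//]; first by rewrite cmod0.
  exact: le_trans (cmodD _ _) (lerD h1 h2).
move=> u w; rewrite /quad -sumrB; apply: (le_trans (cmod_sum _ _)).
rewrite /K mulr_suml; apply: ler_sum => j _; rewrite -sumrB.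
apply: (le_trans (cmod_sum _ _)); rewrite mulr_suml; apply: ler_sum => k _.
have -> : m j k * u 0 j * u 0 k - m j k * w 0 j * w 0 k =
  m j k * ((u 0 j - w 0 j) * u 0 k + w 0 j * (u 0 k - w 0 k)).
  by generalize (m j k) (u 0 j) (u 0 k) (w 0 j) (w 0 k) => a b c e g; ring.
rewrite cmodM ler_wpM2l ?cmod_ge0 //; apply: (le_trans (cmodD _ _)); rewrite !cmodM.
have c1 := cmod_le_len (u - w) j; have c2 := cmod_le_len (u - w) k.
rewrite !mxE in c1 c2; rewrite mulrDr; apply: lerD.
  by apply: ler_pM; rewrite ?cmod_ge0 ?cmod_le_len.
by rewrite mulrC; apply: ler_pM; rewrite ?cmod_ge0 ?cmod_le_len.
Qed.

Lemma complex_tangentE f z X :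
  complex_tangent f z X <-> dotmx X (grad f z) = 0.
Proof.
rewrite /complex_tangent /= (_ : \sum_j _ = 2^-1 * dotmx X (grad f z)); last first.
  rewrite dotmx_sum mulr_sumr; apply: eq_bigr => j _; rewrite dz_real mxE halfE.
  generalize (pderiv (xdir j) f z) (pderiv (ydir j) f z) => a b.
  by case: (X 0 j) => x y; apply: complex_eq; rewrite !(ReM, ImM) /=; ring.
split=> [/eqP|->]; last by rewrite mulr0.
by rewrite mulf_eq0 invr_eq0 pnatr_eq0 /= => /eqP.
Qed.

(** The bilinear form with diagonal [hess], needed to expand a difference of two values of
    [hess]. *)
Definition hessb f z v w : R := \sum_j (complex.Re (v 0 j) * dirD (pderiv (xdir j) f) z w
  + complex.Im (v 0 j) * dirD (pderiv (ydir j) f) z w).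

Lemma hess_lipschitz f z : exists2 K, 0 <= K & forall v w,
  `|hess f z v - hess f z w| <= K * (len (v - w) * (len v + len w)).
Proof.
pose M := \sum_j (len (grad (pderiv (xdir j) f) z) + len (grad (pderiv (ydir j) f) z)).
have M0 : 0 <= M by rewrite sumr_ge0 // => j _; rewrite addr_ge0 // len_ge0.
have Mj j : len (grad (pderiv (xdir j) f) z) + len (grad (pderiv (ydir j) f) z) <= M.
  rewrite /M (bigD1 j) //= lerDl sumr_ge0 // => k _.
  by rewrite addr_ge0 // len_ge0.
have bd v w : `|hessb f z v w| <= 2 * d%:R * len v * (len w * M).
  have l0 := len_ge0 w; apply: hess_sum_bound; first by rewrite mulr_ge0.
  - move=> j; apply: (le_trans (dirD_le _ _ _)); rewrite ler_wpM2l //.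
    by apply: le_trans (Mj j); rewrite lerDl; exact: len_ge0.
  - move=> j; apply: (le_trans (dirD_le _ _ _)); rewrite ler_wpM2l //.
    by apply: le_trans (Mj j); rewrite lerDr; exact: len_ge0.
exists (2 * d%:R * M); first by rewrite mulr_ge0 // mulr_ge0 // ler0n.
move=> v w.
have dB g u1 u2 : dirD g z (u1 - u2) = dirD g z u1 - dirD g z u2.
  by rewrite /dirD dotmxBl ReD ReN.
have E : hess f z v - hess f z w = hessb f z (v - w) v + hessb f z w (v - w).
  rewrite /hess /hessb -sumrB -big_split; apply: eq_bigr => j _.
  have -> : (v - w) 0 j = v 0 j - w 0 j by rewrite !mxE.
  rewrite ReD ReN ImD ImN.
  move: (dB (pderiv (xdir j) f) v w) (dB (pderiv (ydir j) f) v w).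
  generalize (dirD (pderiv (xdir j) f) z v) (dirD (pderiv (ydir j) f) z v)
    (dirD (pderiv (xdir j) f) z w) (dirD (pderiv (ydir j) f) z w)
    (dirD (pderiv (xdir j) f) z (v - w)) (dirD (pderiv (ydir j) f) z (v - w)).
  move=> s1 s2 s3 s4 s5 s6 -> ->.
  have lin (a b a' b' x1 x1' y1 y1' : R) : a * x1 + b * y1 - (a' * x1' + b' * y1') =
    (a - a') * x1 + (b - b') * y1 + (a' * (x1 - x1') + b' * (y1 - y1')) by ring.
  exact: lin.
rewrite E; apply: (le_trans (ler_normD _ _)).
apply: (le_trans (lerD (bd _ _) (bd _ _))).
by generalize (len v) (len w) (len (v - w)) => a b c; rewrite le_eqVlt; apply/orP; left; apply/eqP; ring.
Qed.

Lemma quad_form_continuous (F : 'rV[C R]_d -> R) (K : R) : 0 <= K ->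
  (forall v w, `|F v - F w| <= K * (len (v - w) * (len v + len w))) ->
  forall v, {for v, continuous F}.
Proof.
move=> K0 HF v; apply/continuous_lenP => e e0.
have l0 := len_ge0 v.
have D0 : 0 < K * (2 * len v + 1) + 1 by rewrite ltr_wpDl // mulr_ge0 // addr_ge0 // mulr_ge0.
exists (Num.min 1 (e / (K * (2 * len v + 1) + 1))); first by rewrite lt_min ltr01 divr_gt0.
move=> w; rewrite lt_min ltr_pdivlMr // => /andP[w1 w2].
apply: (le_lt_trans (HF _ _)).
have wl : len w <= len v + 1 by have := lenD (w - v) v; rewrite subrK; lra.
have t0 := len_ge0 (w - v); apply: le_lt_trans w2.
move: wl t0; generalize (len (w - v)) (len w) => t lw wl t0.
have h : K * (t * (lw + len v)) <= K * (t * (2 * len v + 1)).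
  by apply: ler_wpM2l => //; apply: ler_wpM2l => //; lra.
by apply: (le_trans h); rewrite mulrCA ler_wpM2l // lerDl.
Qed.

Lemma hess0 f z : hess f z 0 = 0.
Proof.
rewrite /hess big1 // => j _.
have h (c : C R) (a b : R) : c = 0 -> complex.Re c * a + complex.Im c * b = 0.
  by move=> ->; rewrite /= !mul0r addr0.
by apply: h; rewrite mxE.
Qed.

Lemma hessZ f z (t : R) v : hess f z ((t%:C%C : C R) *: v) = t ^+ 2 * hess f z v.
Proof.
have dirZ g w : dirD g z ((t%:C%C : C R) *: w) = t * dirD g z w.
  by rewrite /dirD dotmxZl; case: (dotmx _ _) => a b /=; rewrite mul0r subr0.
rewrite /hess mulr_sumr; apply: eq_bigr => j _.
have -> : ((t%:C%C : C R) *: v) 0 j = (t%:C%C : C R) * v 0 j by rewrite mxE.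
move: (dirZ (pderiv (xdir j) f) v) (dirZ (pderiv (ydir j) f) v).
generalize (dirD (pderiv (xdir j) f) z v) (dirD (pderiv (ydir j) f) z v)
  (dirD (pderiv (xdir j) f) z ((t%:C%C : C R) *: v))
  (dirD (pderiv (ydir j) f) z ((t%:C%C : C R) *: v)).
move=> a b a' b' -> ->; case: (v 0 j) => s s' /=.
by clear; ring.
Qed.

Lemma mean_dist_le (a b a' b' k : R) : `|a - b| <= k -> `|a' - b'| <= k ->
  `|(a + a') / 4 - (b + b') / 4| <= k.
Proof.
rewrite !ler_norml => /andP[t1 t2] /andP[t3 t4].
by apply/andP; split; lra.
Qed.

Lemma lincomb_dist_le (a b a' b' k l e M : R) : 0 <= M -> `|a - b| <= k * e ->
  M * `|a' - b'| <= M * (l * e) -> `|a + M * a' - (b + M * b')| <= (k + M * l) * e.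
Proof.
move=> M0 t1 t2; rewrite opprD addrACA -mulrBr mulrDl -mulrA.
apply: (le_trans (ler_normD _ _)); rewrite normrM (ger0_norm M0).
exact: lerD t1 t2.
Qed.

Lemma cmod_dist_le (s t : C R) : `|cmod s - cmod t| <= cmod (s - t).
Proof.
have h1 := cmodD (s - t) t; have h2 := cmodD (t - s) s.
rewrite subrK in h1; rewrite subrK (cmodB t) in h2.
by rewrite ler_norml lerNl opprB !lerBlDr h1 h2.
Qed.

Lemma sqr_dist_le (a b e k l g : R) : `|a - b| <= e * g -> a <= k * g -> b <= l * g ->
  0 <= a -> 0 <= b -> `|a ^+ 2 - b ^+ 2| <= g ^+ 2 * (e * (k + l)).
Proof.
move=> ab ak bl a0 b0; rewrite subr_sqr normrM (ger0_norm (addr_ge0 a0 b0)).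
have -> : g ^+ 2 * (e * (k + l)) = (e * g) * (k * g + l * g) by ring.
by apply: ler_pM => //; [rewrite addr_ge0|exact: lerD].
Qed.

Lemma compact_min (F : 'rV[C R]_d -> R) (A : set 'rV[C R]_d) : compact A ->
  A !=set0 -> (forall v, {for v, continuous F}) ->
  exists2 v0, A v0 & forall v, A v -> F v0 <= F v.
Proof.
move=> cA A0 cF.
have cAF : {within A, continuous F} by apply: continuous_in_subspaceT => v _; exact: (cF v).
have [v0 /set_mem Av0 h] := @compact_EVT_min _ R F A A0 cA cAF.
by exists v0 => // v Av; exact: (h v (mem_set Av)).
Qed.

Lemma compact_sphere : compact [set v : 'rV[C R]_d | len v = 1].
Proof.
apply: (@len_bounded_closed_compact R d _ 1); last by move=> v /= ->.
rewrite (_ : [set v | _] = (@len R d) @^-1` [set 1]); last by [].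
apply: preimage_closed; last exact: closed_eq.
by move=> v _; exact: continuous_len.
Qed.

(** On the unit sphere the set where the Levi form is <= 0 is compact, and the product of v with the
    gradient has no zero there. A large multiple of its squared modulus therefore makes the sum
    positive on the sphere, and homogeneity gives all v. *)
Lemma levi_form_positive V f p : class_C 2 V f -> V p ->
  (forall X, complex_tangent f p X -> X != 0 -> 0 < levi f p X) ->
  exists c M : R, [/\ 0 < c, 0 <= M & forall v,
    c * len v ^+ 2 <= (hess f p v + hess f p ('i *: v)) / 4
      + M * cmod (dotmx v (grad f p)) ^+ 2].
Proof.
move=> cf Vp pos.
pose F v := (hess f p v + hess f p ('i *: v)) / 4.
pose G v := cmod (dotmx v (grad f p)) ^+ 2.
have ci : cmod ('i : C R) = 1.
  by apply/eqP; rewrite -(eqrXn2 (isT : (0 < 2)%N)) ?cmod_ge0 // cmod_sqr iE /= !expr2 mul0r add0r mulr1.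
have F0_ge (c M : R) : 0 <= M -> c * len (0 : 'rV[C R]_d) ^+ 2 <=
    (hess f p 0 + hess f p ('i *: 0)) / 4 + M * cmod (dotmx 0 (grad f p)) ^+ 2.
  move=> M0; have l0 := len0 R d.
  have a0 : c * len (0 : 'rV[C R]_d) ^+ 2 = 0 by rewrite l0 expr0n mulr0.
  have h0 : (hess f p 0 + hess f p ('i *: 0)) / 4 = 0 by rewrite scaler0 hess0 addr0 mul0r.
  by rewrite a0 h0 add0r; apply: mulr_ge0 => //; exact: sqr_ge0.
have [K K0 hK] := hess_lipschitz f p.
have FK v w : `|F v - F w| <= K * (len (v - w) * (len v + len w)).
  have h1 := hK v w; have := hK ('i *: v) ('i *: w).
  rewrite -scalerBr !lenZ ci !mul1r => h2.
  exact: mean_dist_le h1 h2.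
have GK v w : `|G v - G w| <= (len (grad f p)) ^+ 2 * (len (v - w) * (len v + len w)).
  rewrite /G; apply: (@sqr_dist_le (cmod (dotmx v (grad f p))) (cmod (dotmx w (grad f p)))
    (len (v - w)) (len v) (len w) (len (grad f p))).
  - by apply: (le_trans (cmod_dist_le _ _)); rewrite -dotmxBl; exact: cmod_dotmx_le.
  - exact: cmod_dotmx_le.
  - exact: cmod_dotmx_le.
  - exact: cmod_ge0.
  - exact: cmod_ge0.
have cF := quad_form_continuous K0 FK.
have cG := quad_form_continuous (sqr_ge0 _) GK.
(* Without unit vectors, that is, in dimension 0, every v is zero. *)
have [sph0|sphN] := pselect (exists v : 'rV[C R]_d, len v = 1); last first.
  exists 1, 0; split => // v; have [->|v0] := eqVneq v 0.
    exact: F0_ge 1 0 (lexx _).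
  exfalso; apply: sphN; exists (((len v)^-1)%:C%C *: v).
  rewrite lenZ cmod_of_real ?invr_ge0 ?len_ge0 // mulVf //.
  by rewrite gt_eqF // len_gt0.
have csph := compact_sphere.
have [v0 v01 minF] := compact_min csph sph0 cF.
pose S0 := [set v : 'rV[C R]_d | len v = 1 /\ F v <= 0].
have Fpos v : len v = 1 -> dotmx v (grad f p) = 0 -> 0 < F v.
  move=> v1 tv; have vn : v != 0 by rewrite -len_gt0 v1.
  have := pos v ((complex_tangentE f p v).2 tv) vn.
  by rewrite ltcE => /andP[_] /=; rewrite (Re_levi _ cf Vp).
have [m m0 hm] : exists2 m, 0 < m & forall v, S0 v -> m <= G v.
  have [[v1 S0v1]|nS0] := pselect (exists v, S0 v); last first.
    by exists 1 => // v Sv; exfalso; apply: nS0; exists v.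
  have cS0 : compact S0.
    apply: (subclosed_compact _ csph); last by move=> v [].
    rewrite (_ : S0 = [set v : 'rV[C R]_d | len v = 1] `&` (F @^-1` [set s | s <= 0])); last by [].
    apply: closedI; first by apply: compact_closed; [exact: norm_hausdorff|exact: csph].
    by apply: preimage_closed; [move=> v _; exact: (cF v)|exact: closed_le].
  have [v2 [v21 Fv2] h] := compact_min cS0 (ex_intro _ v1 S0v1) cG.
  exists (G v2) => //.
  rewrite exprn_gt0 // cmod_gt0; apply/eqP => /(Fpos v2 v21).
  by rewrite ltNge Fv2.
pose M := (`|F v0| + 1) / m.
have M0 : 0 <= M by rewrite divr_ge0 // ?ltW // addr_ge0.
have FGpos v : len v = 1 -> 0 < F v + M * G v.
  move=> v1; have G0 : 0 <= M * G v by rewrite mulr_ge0 // sqr_ge0.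
  have [Fv|Fv] := ltP 0 (F v); first by rewrite ltr_wpDr.
  have h1 := hm v (conj v1 Fv); have h2 := minF v v1.
  have h3 : M * m <= M * G v by rewrite ler_wpM2l.
  rewrite (mulfVK (lt0r_neq0 m0)) in h3.
  have lin (a b s : R) : a <= b -> `|a| + 1 <= s -> 0 < b + s.
    by clear; have := ler_norm (- a); rewrite normrN; lra.
  exact: lin h2 h3.
pose FG v := F v + M * G v.
have FGK v w : `|FG v - FG w| <=
    (K + M * len (grad f p) ^+ 2) * (len (v - w) * (len v + len w)).
  have h1 := FK v w; have h2 := ler_wpM2l M0 (GK v w).
  exact: lincomb_dist_le M0 h1 h2.
have cFG := quad_form_continuous (addr_ge0 K0 (mulr_ge0 M0 (sqr_ge0 (len (grad f p))))) FGK.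
have [v3 v31 minFG] := compact_min csph sph0 cFG.
exists (F v3 + M * G v3), M; split => //; first exact: FGpos.
move=> v; have [->|vn] := eqVneq v 0.
  exact: F0_ge (F v3 + M * G v3) M M0.
have l0 : 0 < len v by rewrite len_gt0.
pose t := (len v)^-1.
have t0 : 0 < t by rewrite invr_gt0.
have tv : len ((t%:C%C : C R) *: v) = 1.
  by rewrite lenZ cmod_of_real ?(ltW t0) // mulVf // gt_eqF.
have := minFG _ tv.
have GZ : G ((t%:C%C : C R) *: v) = t ^+ 2 * G v.
  by rewrite /G dotmxZl cmodM cmod_of_real ?(ltW t0) // exprMn.
have FZ : F ((t%:C%C : C R) *: v) = t ^+ 2 * F v.
  by rewrite /F scalerA [_ * _%:C%C]mulrC -scalerA !hessZ -mulrDr mulrA.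
rewrite /FG FZ GZ => h.
have lin (a b b' : R) : a <= t ^+ 2 * b + M * (t ^+ 2 * b') -> a * len v ^+ 2 <= b + M * b'.
  rewrite [M * _]mulrCA -[X in a <= X]mulrDr /t exprVn mulrC ler_pdivlMr //; exact: exprn_gt0.
exact: lin h.
Qed.

End Levi.

(** * Uniform Taylor estimates and the peak inequality *)

Section NearPoint.
Variables (R : realType) (d : nat).
Implicit Types (u v w x y z p q : 'rV[C R]_d) (f r : 'rV[C R]_d -> R)
  (V : set 'rV[C R]_d).

(** The Hessian is taken at p and not at q, so that the peaks at all boundary points near p share
    the same quadratic coefficients. *)
Lemma Taylor_uniform V f p : open V -> V p -> class_C 2 V f ->
  forall e, 0 < e -> exists2 s, 0 < s & forall q x,
    len (q - p) < s -> len (x - p) < s ->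
    `|f x - f q - dirD f q (x - q) - hess f p (x - q) / 2| <= e * len (x - q) ^+ 2.
Proof.
move=> oV Vp cf e e0.
have [s1 s10 h1] := Taylor2 oV Vp cf (divr_gt0 e0 (ltr0Sn R 1)).
have [s2 s20 h2] := hess_continuous oV Vp cf e0.
exists (Num.min s1 s2); first by rewrite lt_min s10.
move=> q x; rewrite !lt_min => /andP[q1 q2] /andP[x1 x2].
have t1 := h1 q x q1 x1; have t2 := h2 q q2 (x - q).
have lin (A h h' l : R) : `|A - h / 2| <= e / 2 * l -> `|h - h'| <= e * l ->
    `|A - h' / 2| <= e * l.
  by clear; rewrite !ler_norml => /andP[a1 a2] /andP[a3 a4]; apply/andP; split; lra.
exact: lin t1 t2.
Qed.

Lemma Taylor_first_order V f p : open V -> V p -> class_C 2 V f ->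
  exists K s, [/\ 0 <= K, 0 < s & forall q x,
    len (q - p) < s -> len (x - p) < s ->
    `|f x - f q - dirD f q (x - q)| <= K * len (x - q) ^+ 2].
Proof.
move=> oV Vp cf.
have [s s0 h] := Taylor_uniform oV Vp cf ltr01.
have [K K0 hK] := hess_bound f p.
exists (1 + K), s; split => //; first exact: addr_ge0.
move=> q x qs xs; have t1 := h q x qs xs; have t2 := hK (x - q).
have lin (A b l : R) : 0 <= l -> `|A - b / 2| <= 1 * l -> `|b| <= K * l ->
    `|A| <= (1 + K) * l.
  clear -K0 => l0; rewrite !ler_norml => /andP[a1 a2] /andP[a3 a4].
  have Kl : 0 <= K * l by exact: mulr_ge0.
  by move: a1 a2 a3 a4 Kl; rewrite mulrDl; generalize (K * l) => k *; apply/andP; split; lra.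
exact: lin (sqr_ge0 _) t1 t2.
Qed.

(** The coefficients of the square of [dotmx v g], which is a holomorphic polynomial in v since
    [dotmx] is linear in its first argument. *)
Definition outer_sqr (g : 'rV[C R]_d) (j k : 'I_d) : C R :=
  conjc (g 0 j) * conjc (g 0 k).

Lemma quad_outer_sqr g v : quad (outer_sqr g) v = dotmx v g ^+ 2.
Proof.
rewrite /quad expr2 dotmx_sum mulr_suml; apply: eq_bigr => j _.
rewrite mulr_sumr; apply: eq_bigr => k _; rewrite /outer_sqr.
by generalize (v 0 j) (v 0 k) (conjc (g 0 j) : C R) (conjc (g 0 k) : C R) => a b e h; ring.
Qed.

Lemma quadD (m n : 'I_d -> 'I_d -> C R) v :
  quad (fun j k => m j k + n j k) v = quad m v + quad n v.
Proof.
rewrite /quad -big_split; apply: eq_bigr => j _ /=; rewrite -big_split.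
by apply: eq_bigr => k _ /=; rewrite !mulrDl.
Qed.

Lemma quadZ (c : C R) (m : 'I_d -> 'I_d -> C R) v :
  quad (fun j k => c * m j k) v = c * quad m v.
Proof.
rewrite /quad mulr_sumr; apply: eq_bigr => j _; rewrite mulr_sumr.
by apply: eq_bigr => k _; rewrite !mulrA.
Qed.

Lemma Re_sqr (c : C R) : complex.Re (c ^+ 2) = 2 * complex.Re c ^+ 2 - cmod c ^+ 2.
Proof. by rewrite cmod_sqr; case: c => a b; rewrite expr2 ReM /=; ring. Qed.

(** Here rho = - r x, l = |x - q|, T is the linear term of r at q, h half of the Hessian, k its Levi
    part and E its holomorphic part; a and cm are the real part and the modulus of the product with
    the gradient at p. The cost 2 M a^2 is at most 4 M rho^2 + 4 M eta^2 l^2, hence at most rho / 2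
    + c l^2 / 4. *)
Lemma peak_inequality_arith (rho l E T h c M a cm k eta : R) :
  0 <= rho -> 0 <= l -> 0 < c -> 0 <= M ->
  `|- rho - T - h| <= c / 4 * l ^+ 2 ->
  c * l ^+ 2 <= k + M * cm ^+ 2 ->
  h = k + E ->
  `|a| <= rho + eta * l -> 4 * M * eta ^+ 2 <= c / 4 -> 8 * M * rho <= 1 ->
  rho / 2 + c / 2 * l ^+ 2 <= - T - (E + M * (2 * a ^+ 2 - cm ^+ 2)).
Proof.
move=> rho0 l0 c0 M0 hT hk hh ha heta hrho.
have a2 : a ^+ 2 <= 2 * rho ^+ 2 + 2 * (eta ^+ 2 * l ^+ 2).
  rewrite -(real_normK (num_real a)).
  have t0 : 0 <= rho + eta * l by apply: le_trans ha; exact: normr_ge0.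
  have : `|a| ^+ 2 <= (rho + eta * l) ^+ 2 by rewrite lerXn2r // nnegrE.
  have := sqr_ge0 (rho - eta * l); rewrite sqrrB sqrrD -exprMn.
  by clear; lra.
have h1 : 2 * M * a ^+ 2 <= 4 * M * rho ^+ 2 + 4 * M * eta ^+ 2 * l ^+ 2.
  have : M * a ^+ 2 <= M * (2 * rho ^+ 2 + 2 * (eta ^+ 2 * l ^+ 2)) by rewrite ler_wpM2l.
  by clear; lra.
have h2 : 4 * M * rho ^+ 2 <= rho / 2.
  have : 8 * M * rho * rho <= 1 * rho by rewrite ler_wpM2r.
  by rewrite expr2 mulrA mul1r; move: (M * rho) => u; clear; lra.
have h3 : 4 * M * eta ^+ 2 * l ^+ 2 <= c / 4 * l ^+ 2 by rewrite ler_wpM2r // sqr_ge0.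
move: hT hk h1 h2 h3; rewrite hh ler_norml => /andP[t2 _].
have -> : M * (2 * a ^+ 2 - cm ^+ 2) = 2 * M * a ^+ 2 - M * cm ^+ 2 by ring.
move: t2; clear; move: (2 * M * a ^+ 2) (M * cm ^+ 2) (4 * M * rho ^+ 2) (4 * M * eta ^+ 2 * l ^+ 2) (l ^+ 2).
by move=> A Bb Cc Dd L *; lra.
Qed.

(* With [v = x - q] one has [hess v / 2 = levi v + Re (quad hess_coef v)], and the
   defect of positivity [M |<v, g>|^2] of the Levi form off the complex tangent
   space is absorbed by adding [M <v, g>^2] to the quadratic polynomial: the sum
   of both is [2 M (Re <v, g>)^2], and [Re <v, g>] is of the order of [r x]. *)
Lemma peak_inequality V r p : open V -> V p -> class_C 2 V r -> r p = 0 ->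
  (forall X, complex_tangent r p X -> X != 0 -> 0 < levi r p X) ->
  exists (m : 'I_d -> 'I_d -> C R) (c s : R), [/\ 0 < c, 0 < s &
    forall q x, len (q - p) < s -> len (x - p) < s -> r q = 0 -> r x < 0 ->
    - r x / 2 + c * len (x - q) ^+ 2 <=
      - dirD r q (x - q) - complex.Re (quad m (x - q))].
Proof.
move=> oV Vp cr rp0 pos.
have [c [M [c0 M0 hc]]] := levi_form_positive cr Vp pos.
pose eta := Num.min 1 (c / (16 * M + 1)).
have M1 : 0 < 16 * M + 1 by rewrite ltr_wpDl // mulr_ge0.
have eta0 : 0 < eta by rewrite lt_min ltr01 divr_gt0.
have hM : 4 * M * eta ^+ 2 <= c / 4.
  have e1 : eta <= 1 by rewrite ge_min lexx.
  have e2 : eta * (16 * M + 1) <= c by rewrite -ler_pdivlMr // ge_min lexx orbT.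
  have e3 : M * eta * eta <= M * eta * 1 by rewrite ler_wpM2l // mulr_ge0 // ltW.
  have lin (a : R) : a * (16 * M + 1) <= c -> M * a * a <= M * a * 1 -> 0 < a ->
      4 * M * a ^+ 2 <= c / 4.
    have -> : a * (16 * M + 1) = 16 * (M * a) + a by ring.
    have -> : 4 * M * a ^+ 2 = 4 * (M * a * a) by ring.
    by clear; lra.
  exact: (lin _ e2 e3 eta0).
have [s1 s10 h1] := Taylor_uniform oV Vp cr (divr_gt0 c0 (ltr0Sn R 3)).
have [K [s2 [K0 s20 h2]]] := Taylor_first_order oV Vp cr.
have [s3 s30 h3] := grad_continuous oV Vp (class_C_pred cr) (divr_gt0 eta0 (ltr0Sn R 1)).
have [cr0 _] := cr.
have M2 : 0 < 8 * M + 1 by rewrite ltr_wpDl // mulr_ge0.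
have i0 : 0 < (8 * M + 1)^-1 by rewrite invr_gt0.
have [s4 s40 h4] := (continuous_lenP r p).1 (cr0 p Vp) _ i0.
(* Then |x - q| <= 2 s5, so the quadratic remainder K |x - q|^2 is at most eta / 2 |x - q|; the
   variation of the gradient takes the other half of [eta]. *)
pose s5 := eta / (4 * K + 1).
have K1 : 0 < 4 * K + 1 by rewrite ltr_wpDl // mulr_ge0.
have s50 : 0 < s5 by exact: divr_gt0.
pose s := Num.min (Num.min s1 s2) (Num.min (Num.min s3 s4) s5).
exists (fun j k => hess_coef r p j k + (M%:C%C : C R) * outer_sqr (grad r p) j k), (c / 2), s.
split; [exact: divr_gt0|by rewrite !lt_min s10 s20 s30 s40|].
move=> q x; rewrite !lt_min => /andP[/andP[q1 q2] /andP[/andP[q3 q4] q5]].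
move=> /andP[/andP[x1 x2] /andP[/andP[x3 x4] x5]] rq rx.
have t1 := h1 q x q1 x1; have t2 := h2 q x q2 x2.
rewrite rq subr0 in t1; rewrite rq subr0 in t2.
have t3 := h3 q q3; have t4 := h4 x x4; rewrite rp0 subr0 ltr0_norm // in t4.
have l0 := len_ge0 (x - q).
have lxq : len (x - q) <= 2 * s5.
  by apply: (le_trans (len_distD p _ _)); rewrite (lenC p); clear -q5 x5; lra.
have ha : `|dirD r p (x - q)| <= - r x + eta * len (x - q).
  have b1 : `|dirD r p (x - q) - dirD r q (x - q)| <= eta / 2 * len (x - q).
    have -> : dirD r p (x - q) - dirD r q (x - q) = complex.Re (dotmx (x - q) (grad r p - grad r q)).
      by rewrite dotmxBr ReD ReN.
    apply: (le_trans (Re_le_cmod _)); apply: (le_trans (cmod_dotmx_le _ _)).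
    by rewrite mulrC (lenC (grad r p)); exact: (ler_wpM2r l0 t3).
  have b2 : K * len (x - q) ^+ 2 <= eta / 2 * len (x - q).
    rewrite expr2 mulrA ler_wpM2r //.
    have b3 : K * len (x - q) <= K * (2 * s5) by rewrite ler_wpM2l.
    have b4 : s5 * (4 * K + 1) = eta by rewrite /s5 mulfVK // gt_eqF.
    move: b3 b4 s50; rewrite mulrDr mulr1 mulrCA (mulrC s5) -mulrA; move: (K * s5) (K * len _) => u1 u2.
    by clear; lra.
  have lin (a b e k ro : R) : `|a - b| <= e / 2 * len (x - q) -> k <= e / 2 * len (x - q) ->
      `|ro - b| <= k -> ro < 0 -> `|a| <= - ro + e * len (x - q).
    rewrite !ler_norml => /andP[a1 a2] a3 /andP[a4 a5] a6.
    move: a1 a2 a3 a4 a5 a6; rewrite -mulrA (mulrC (2^-1)) mulrA; move: (e * len (x - q)) => u.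
    by clear; move=> *; apply/andP; split; lra.
  exact: lin b1 b2 t2 rx.
rewrite quadD quadZ quad_outer_sqr ReD.
have -> : complex.Re ((M%:C%C : C R) * dotmx (x - q) (grad r p) ^+ 2) =
    M * (2 * dirD r p (x - q) ^+ 2 - cmod (dotmx (x - q) (grad r p)) ^+ 2).
  by rewrite ReM /= mul0r subr0 Re_sqr.
have rho0 : 0 <= - r x by rewrite oppr_ge0 ltW.
have rho1 : 8 * M * (- r x) <= 1.
  have : - r x * (8 * M + 1) <= 1 by rewrite -ler_pdivlMr // mul1r ltW.
  by move: rho0; move: (- r x) => u; rewrite mulrDr mulr1 mulrC; move: (8 * M * u) => u2; clear; lra.
have hk := hc (x - q).
pose k := (hess r p (x - q) + hess r p ('i *: (x - q))) / 4.
have hE : hess r p (x - q) / 2 = k + complex.Re (quad (hess_coef r p) (x - q)).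
  by rewrite Re_quad_hess /k; move: (hess _ _ _) (hess _ _ _) => u1 u2; clear; lra.
have t1' : `|- (- r x) - dirD r q (x - q) - hess r p (x - q) / 2| <= c / 4 * len (x - q) ^+ 2.
  by rewrite opprK.
have h := peak_inequality_arith rho0 l0 c0 M0 t1' hk hE ha hM rho1.
exact: h.
Qed.

End NearPoint.

Section Ray.
Variables (R : realType) (d : nat).

Lemma cmod_of_real_norm (t : R) : cmod (t%:C%C : C R) = `|t|.
Proof.
have [t0|t0] := leP 0 t; first by rewrite cmod_of_real // ger0_norm.
have -> : (t%:C%C : C R) = - ((- t)%:C%C : C R).
  by apply: complex_eq; rewrite ?ReN ?ImN /= ?opprK ?oppr0.
by rewrite cmodN cmod_of_real ?oppr_ge0 ?(ltW t0) // ltr0_norm.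
Qed.

Lemma ray_dist (x v : 'rV[C R]_d) (t t' : R) :
  len (ray x v t - ray x v t') = `|t - t'| * len v.
Proof.
have -> : ray x v t - ray x v t' = ((t - t')%:C%C : C R) *: v.
  have h (a b : C R) (u w : 'rV[C R]_d) : u + a *: w - (u + b *: w) = (a - b) *: w.
    by rewrite opprD addrACA subrr add0r scalerBl.
  rewrite /ray h; congr (_ *: _).
  by apply: complex_eq; rewrite ?ReD ?ImD ?ReN ?ImN //= subr0.
by rewrite lenZ cmod_of_real_norm.
Qed.

End Ray.

(** * Boundary points and normals *)

Section Boundary.
Variables (R : realType) (d : nat) (D : set 'rV[C R]_d).
Hypothesis oD : open D.
Implicit Types (u v w x y z p q : 'rV[C R]_d) (V : set 'rV[C R]_d)
  (r : 'rV[C R]_d -> R).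

Lemma boundary_lenP q : boundary D q ->
  ~ D q /\ forall e, 0 < e -> exists2 x, D x & len (x - q) < e.
Proof.
move=> [clq nint]; split=> [Dq|e e0].
  by apply: nint; apply: open_nbhs_nbhs.
have [|x [Dx xe]] := clq [set x | len (x - q) < e].
  by apply/nbhs_lenP; exists e.
by exists x.
Qed.

(** Were no point of the segment on the boundary, each would be interior to D or to its complement,
    and membership in D would propagate from x to y by [cousin_segment]. *)
Lemma segment_boundary x y : D x -> ~ D y ->
  exists2 q, boundary D q & len (x - q) <= len (x - y).
Proof.
move=> Dx nDy; apply: contrapT => nq.
have [l [ll l0 l1]] : exists l : R -> 'rV[C R]_d,
    [/\ forall t t', len (l t - l t') = `|t - t'| * len (y - x), l 0 = x & l 1 = y].
  exists (ray x (y - x)); split; [exact: ray_dist| |].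
    by rewrite /ray (_ : 0%:C%C = 0 :> C R) // scale0r addr0.
  by rewrite /ray (_ : 1%:C%C = 1 :> C R) // scale1r addrC subrK.
have L0 : 0 < len (y - x) + 1 by rewrite ltr_wpDl // len_ge0.
have [Q QE] : exists Q : R -> R -> Prop, forall a b, Q a b = (D (l a) -> D (l b)) by eexists.
suff : Q 0 1 by rewrite QE l0 l1; tauto.
refine (@cousin_segment R Q 0 1 ler01 _ _).
  by move=> a b m _ _; rewrite !QE => h1 h2 /h1/h2.
move=> t /andP[t0 t1].
have small e a b : 0 < e -> a <= t -> t <= b -> b - a < e / (len (y - x) + 1) ->
    len (l a - l t) < e /\ len (l b - l t) < e.
  move=> e0 at_ tb; rewrite ltr_pdivlMr // => h; rewrite !ll.
  have h0 := len_ge0 (y - x).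
  have m1 : `|a - t| * len (y - x) <= (b - a) * (len (y - x) + 1).
    apply: ler_pM; rewrite ?normr_ge0 ?lerDl //.
    by rewrite ler_norml; clear -at_ tb; apply/andP; split; lra.
  have m2 : `|b - t| * len (y - x) <= (b - a) * (len (y - x) + 1).
    apply: ler_pM; rewrite ?normr_ge0 ?lerDl //.
    by rewrite ler_norml; clear -at_ tb; apply/andP; split; lra.
  by split; exact: le_lt_trans h.
have [Dt|nDt] := pselect (D (l t)).
  have /nbhs_lenP[e e0 he] : nbhs (l t) D by apply: open_nbhs_nbhs.
  exists (e / (len (y - x) + 1)); first exact: divr_gt0.
  move=> a b /andP[_ at_] /andP[tb _] ab; rewrite QE => _.
  by apply: he; exact: (small e a b e0 at_ tb ab).2.
have ncl : ~ closure D (l t).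
  move=> cl; apply: nq; exists (l t).
    by split=> // /nbhs_singleton.
  rewrite -l0 -{1}l1 !ll sub0r normrN !sub0r normrN normr1 ger0_norm //.
  by rewrite ler_wpM2r // len_ge0.
have [e e0 he] : exists2 e, 0 < e & forall x, len (x - l t) < e -> ~ D x.
  apply: contrapT => H; apply: ncl => B /nbhs_lenP[e e0 he].
  apply: contrapT => H2; apply: H; exists e => // x' xe Dx'; apply: H2.
  by exists x'; split=> //; exact: he.
exists (e / (len (y - x) + 1)); first exact: divr_gt0.
move=> a b /andP[_ at_] /andP[tb _] ab; rewrite QE => Da; exfalso.
exact: (he _ (small e a b e0 at_ tb ab).1 Da).
Qed.

Lemma bdist_le z q : boundary D q -> bdist D z <= len (z - q).
Proof.
move=> bq; rewrite lenE; apply: ge_inf; last by exists q.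
by exists 0 => _ [q' _ <-]; rewrite -lenE len_ge0.
Qed.

Lemma closestP z : boundary D !=set0 ->
  boundary D (closest D z) /\ len (z - closest D z) = bdist D z.
Proof.
move=> [p bp].
suff [q bq] : exists q, is_closest D z q.
  have := @xgetPex _ 0 [set q | is_closest D z q] (ex_intro _ q bq).
  by rewrite /is_closest /= -/(closest D z) -lenE.
pose A := boundary D `&` [set q | len (q - z) <= len (p - z)].
have cB : closed (boundary D).
  by apply: closedI; [exact: closed_closure|apply: open_closedC; exact: open_interior].
have cf v : {for v, continuous (fun q => len (q - z))}.
  apply/continuous_lenP => e e0; exists e => // w wv.
  apply: le_lt_trans wv; rewrite ler_norml.
  have := lenD (w - v) (v - z); have := lenD (v - w) (w - z).
  rewrite !addrA !subrK (lenC v w); move: (len (w - v)) (len (w - z)) (len (v - z)).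
  by clear; move=> a b c *; apply/andP; split; lra.
have cA : compact A.
  apply: (@len_bounded_closed_compact R d A (len (p - z) + len z)).
    apply: closedI => //.
    apply: (@preimage_closed _ _ (fun q => len (q - z)) [set s | s <= len (p - z)]).
      by move=> v _; exact: (cf v).
    exact: closed_le.
  move=> q [_ /= qz]; have := lenD (q - z) z; rewrite subrK => h.
  by apply: (le_trans h); rewrite lerD2r.
have Ap : A p by split=> //=; exact: lexx.
have [q [bq qp] hq] := compact_min cA (ex_intro _ p Ap) cf.
have minq q' : boundary D q' -> len (z - q) <= len (z - q').
  move=> bq'; rewrite lenC (lenC z); have [h|h] := leP (len (q' - z)) (len (p - z)).
    exact: hq.
  exact: le_trans qp (ltW h).
exists q; split => //; apply/eqP; rewrite -lenE eq_le bdist_le // andbT.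
apply: lb_le_inf; first by exists (enorm (z - q)), q.
by move=> _ [q' bq' <-]; rewrite -lenE; exact: minq.
Qed.

Lemma bdist_gt0 z : boundary D !=set0 -> D z -> 0 < bdist D z.
Proof.
move=> /(closestP z)[bq <-] Dz; rewrite len_gt0 subr_eq0.
by apply/eqP => zq; have [+ _] := boundary_lenP bq; rewrite -zq.
Qed.

Lemma defining_function_in V r p x : defining_function D p V r -> V x ->
  D x <-> r x < 0.
Proof.
move=> [_ _ _ DV _] Vx; have : (D `&` V) x <-> [set z | V z /\ r z < 0] x by rewrite DV.
by rewrite /=; split => [Dx|rx]; tauto.
Qed.

(** A negative value would put q in the open set D; a positive one would persist near q, where there
    are points of D. *)
Lemma defining_function_boundary V r p q : defining_function D p V r -> V q ->
  boundary D q -> r q = 0.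
Proof.
move=> rV Vq bq; have [nDq hq] := boundary_lenP bq.
have [oV _ [cr _] _ _] := rV.
apply/eqP; rewrite eq_le; apply/andP; split; rewrite leNgt; apply/negP => rq; last first.
  by apply: nDq; apply/(defining_function_in rV Vq).
have [s s0 hs] := (continuous_lenP r q).1 (cr q Vq) _ rq.
have /nbhs_lenP[s' s'0 hV] : nbhs q V by apply: open_nbhs_nbhs.
have m0 : 0 < Num.min s s' by rewrite lt_min s0.
have [x Dx] := hq _ m0; rewrite lt_min => /andP[xs xs'].
have := hs x xs; have := (defining_function_in rV (hV x xs')).1 Dx.
by clear; rewrite ltr_norml => rx /andP[h _]; lra.
Qed.

End Boundary.

Section Normal.
Variables (R : realType) (d : nat).
Implicit Types (u v w x y z p q g : 'rV[C R]_d) (V : set 'rV[C R]_d)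
  (r f : 'rV[C R]_d -> R).

Lemma Re_dotmxC u v : complex.Re (dotmx u v) = complex.Re (dotmx v u).
Proof. by rewrite (dotmx_conj v u); case: (dotmx _ _). Qed.

Lemma Re_dotmxZl (t : R) u v :
  complex.Re (dotmx ((t%:C%C : C R) *: u) v) = t * complex.Re (dotmx u v).
Proof. by rewrite dotmxZl; case: (dotmx _ _) => a b /=; rewrite mul0r subr0. Qed.

Lemma Re_dotmxZr (t : R) u v :
  complex.Re (dotmx u ((t%:C%C : C R) *: v)) = t * complex.Re (dotmx u v).
Proof.
have h1 := Re_dotmxC u ((t%:C%C : C R) *: v); have h2 := Re_dotmxZl t v u.
exact: etrans h1 (etrans h2 (congr1 (fun a => t * a) (Re_dotmxC v u))).
Qed.

Lemma Re_dotmxBl u v w :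
  complex.Re (dotmx (u - v) w) = complex.Re (dotmx u w) - complex.Re (dotmx v w).
Proof. by rewrite dotmxBl ReD ReN. Qed.

Lemma Re_dotmxBr u v w :
  complex.Re (dotmx w (u - v)) = complex.Re (dotmx w u) - complex.Re (dotmx w v).
Proof. by rewrite dotmxBr ReD ReN. Qed.

Lemma Re_dotmx_unit u v : len u = 1 -> len v = 1 ->
  complex.Re (dotmx (u - v) u) = len (u - v) ^+ 2 / 2.
Proof.
move=> u1 v1.
have := Re_dotmx_self u; have := Re_dotmx_self v; have := Re_dotmx_self (u - v).
have := Re_dotmxBr u v (u - v); have := Re_dotmxBl u v u; have := Re_dotmxBl u v v.
have := Re_dotmxC u v; rewrite u1 v1 expr1n.
generalize (complex.Re (dotmx (u - v) u)) (complex.Re (dotmx (u - v) v))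
  (complex.Re (dotmx (u - v) (u - v))) (complex.Re (dotmx u v)) (complex.Re (dotmx v u))
  (complex.Re (dotmx u u)) (complex.Re (dotmx v v)) (len (u - v) ^+ 2).
by clear; move=> *; lra.
Qed.

Definition normalize g : 'rV[C R]_d := ((len g)^-1%:C%C : C R) *: g.

Lemma len_normalize g : g != 0 -> len (normalize g) = 1.
Proof.
by move=> g0; rewrite lenZ cmod_of_real_norm ger0_norm ?invr_ge0 ?len_ge0 // mulVf ?len_eq0.
Qed.

Lemma Re_dotmx_normalize u g :
  complex.Re (dotmx u (normalize g)) = (len g)^-1 * complex.Re (dotmx u g).
Proof. exact: Re_dotmxZr. Qed.

Lemma derive_sign V f q v : open V -> V q -> class_C 1 V f -> f q = 0 ->
  dirD f q v != 0 -> exists2 s, 0 < s & forall t, 0 < t < s ->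
    V (q + (t%:C%C : C R) *: v) /\ 0 < f (q + (t%:C%C : C R) *: v) * dirD f q v.
Proof.
move=> oV Vq cf fq dn0.
have L0 : 0 < len v + 1 by rewrite ltr_wpDl // len_ge0.
have a0 : 0 < `|dirD f q v| by rewrite normr_gt0.
have e0 : 0 < `|dirD f q v| / (2 * (len v + 1)) by rewrite divr_gt0 // mulr_gt0.
have [s s0 hs] := class_C1_differentiable oV Vq cf e0.
have /nbhs_lenP[s' s'0 hV] : nbhs q V by apply: open_nbhs_nbhs.
exists (Num.min s s' / (len v + 1)); first by rewrite divr_gt0 // lt_min s0.
move=> t /andP[t0]; rewrite ltr_pdivlMr // lt_min => /andP[ts ts'].
have lt_ : len ((t%:C%C : C R) *: v) = t * len v.
  by rewrite lenZ cmod_of_real_norm ger0_norm // ltW.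
have h : t * len v <= t * (len v + 1) by rewrite ler_wpM2l ?lerDl ?ltW.
split.
  by apply: hV; rewrite addrAC subrr add0r lt_; exact: le_lt_trans h ts'.
have := hs ((t%:C%C : C R) *: v); rewrite lt_ => /(_ (le_lt_trans h ts)).
rewrite fq subr0 {1}/dirD Re_dotmxZl -/(dirD f q v).
move: (f (q + _)) => F.
have h2 : `|dirD f q v| / (2 * (len v + 1)) * (t * len v) <= `|dirD f q v| * t / 2.
  have -> : `|dirD f q v| * t / 2 = `|dirD f q v| / (2 * (len v + 1)) * (t * (len v + 1)).
    by move: L0 => /lt0r_neq0; move: (len v + 1) `|dirD f q v| => a b a0'; field.
  by rewrite ler_wpM2l // ltW.
move=> /le_trans /(_ h2); move: dn0; move: (dirD f q v) => a.
clear -t0 => dn0; rewrite ler_norml => /andP[h1 h2].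
have [a0|a0] := ltP 0 a.
  apply: mulr_gt0 => //; rewrite (gtr0_norm a0) in h1.
  by have := mulr_gt0 a0 t0; move: h1; rewrite (mulrC t); move: (a * t) => b; clear; lra.
have {dn0}a0 : a < 0 by rewrite lt_neqAle dn0.
rewrite nmulr_lgt0 //; rewrite (ltr0_norm a0) in h2.
have : a * t < 0 by rewrite pmulr_llt0.
by move: h2; rewrite (mulrC t) mulNr; move: (a * t) => b; clear; lra.
Qed.

Variable (D : set 'rV[C R]_d).
Hypothesis oD : open D.

(** If the unit gradients u and u' differed, then by [Re_dotmx_unit] r would decrease and r'
    increase from q in the direction u' - u, so that points just ahead would be both in D and
    outside it. *)
Lemma normalize_grad_unique p q V V' r r' : defining_function D p V r ->
  defining_function D q V' r' -> V q -> boundary D q ->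
  normalize (grad r q) = normalize (grad r' q).
Proof.
move=> rV rV' Vq bq.
have [oV _ cr _ g0] := rV; have [oV' V'q cr' _ g0'] := rV'.
have n1 := len_normalize (g0 q Vq); have n1' := len_normalize (g0' q V'q).
have r0 := defining_function_boundary oD rV Vq bq.
have r0' := defining_function_boundary oD rV' V'q bq.
apply/eqP/negPn/negP => nn.
pose u := normalize (grad r q); pose u' := normalize (grad r' q).
have L0 : 0 < len (u' - u) ^+ 2 / 2.
  by rewrite divr_gt0 // exprn_gt0 // len_gt0 subr_eq0 eq_sym.
have m0 : 0 < len (grad r q) by rewrite len_gt0 g0.
have m0' : 0 < len (grad r' q) by rewrite len_gt0 g0'.
have E1 : len (u' - u) ^+ 2 / 2 = (len (grad r' q))^-1 * dirD r' q (u' - u).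
  exact: etrans (esym (Re_dotmx_unit n1' n1)) (Re_dotmx_normalize (u' - u) (grad r' q)).
have E2 : len (u - u') ^+ 2 / 2 = (len (grad r q))^-1 * dirD r q (u - u').
  exact: etrans (esym (Re_dotmx_unit n1 n1')) (Re_dotmx_normalize (u - u') (grad r q)).
have E3 : dirD r q (u - u') = - dirD r q (u' - u).
  by rewrite /dirD -ReN -dotmxNl opprB.
have pos_mul (a b e : R) : 0 < a -> e = a^-1 * b -> 0 < e -> 0 < b.
  by move=> a0 ->; rewrite pmulr_rgt0 // invr_gt0.
have neg_mul (a b : R) : b < 0 -> 0 < a * b -> a < 0 by move=> b0; rewrite nmulr_lgt0.
have d1 : dirD r' q (u' - u) > 0 by exact: pos_mul m0' E1 L0.
have d2 : dirD r q (u' - u) < 0.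
  by rewrite -oppr_gt0 -E3; apply: pos_mul m0 E2 _; rewrite (lenC u).
have [s s0 hs] := derive_sign oV Vq (class_C_pred cr) r0 (ltr0_neq0 d2).
have [s' s'0 hs'] := derive_sign oV' V'q (class_C_pred cr') r0' (lt0r_neq0 d1).
pose t := Num.min s s' / 2.
have m : 0 < Num.min s s' by rewrite lt_min s0.
have t0 : 0 < t by rewrite divr_gt0.
have tm : t < Num.min s s' by rewrite /t ltr_pdivrMr // ltr_pMr // ltr1n.
move: tm; rewrite lt_min => /andP[ts ts'].
have [|Vx rx] := hs t; first by rewrite t0.
have [|Vx' rx'] := hs' t; first by rewrite t0.
have nx : r (q + (t%:C%C : C R) *: (u' - u)) < 0 by exact: neg_mul d2 rx.
have := (defining_function_in rV Vx).2 nx => /(defining_function_in rV' Vx').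
by move: rx'; rewrite pmulr_lgt0 // => h /(lt_trans h); rewrite ltxx.
Qed.

Lemma outer_normalE p q V r : defining_function D p V r -> V q ->
  boundary D q -> outer_normal D q = normalize (grad r q).
Proof.
move=> rV Vq bq.
have nu : is_outer_normal D q (normalize (grad r q)).
  split => //; exists V, r; split; last by rewrite /normalize lenE.
  by have [oV _ cr DV g0] := rV.
have := @xgetPex _ 0 [set nu | is_outer_normal D q nu] (ex_intro _ _ nu).
rewrite /= -/(outer_normal D q) => -[_ [V' [r' [rV' ->]]]].
by rewrite -lenE -/(normalize _) (normalize_grad_unique rV rV' Vq bq).
Qed.

(** From x one moves along the gradient at p until r is no longer negative; the segment travelled,
    of length 2 (- r x) / m, then meets the boundary. *)
Lemma bdist_le_defining p V r : boundary D p -> defining_function D p V r ->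
  exists K s, [/\ 0 < K, 0 < s & forall x, D x -> len (x - p) < s ->
    bdist D x <= K * - r x].
Proof.
move=> bp rV; have [oV Vp cr _ g0] := rV.
have rp := defining_function_boundary oD rV Vp bp.
have [m mE m0] : exists2 m, m = len (grad r p) & 0 < m.
  by exists (len (grad r p)) => //; rewrite len_gt0 g0.
have [K [s1 [K0 s10 h1]]] := Taylor_first_order oV Vp cr.
have [s2 s20 h2] := grad_continuous oV Vp (class_C_pred cr) (divr_gt0 m0 (ltr0Sn R 3)).
have /nbhs_lenP[s3 s30 hV] : nbhs p V by apply: open_nbhs_nbhs.
have [cr0 _] := cr.
pose s4 := Num.min s1 s3.
have s40 : 0 < s4 by rewrite lt_min s10.
pose e := Num.min (s4 * m / 4) (m ^+ 2 / (8 * K + 1)).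
have K1 : 0 < 8 * K + 1 by rewrite ltr_wpDl // mulr_ge0.
have e0 : 0 < e by rewrite lt_min !divr_gt0 ?mulr_gt0 ?exprn_gt0.
have [s5 s50 h5] := (continuous_lenP r p).1 (cr0 p Vp) _ e0.
exists (2 / m), (Num.min (Num.min (s4 / 2) s2) s5); split.
- exact: divr_gt0.
- by rewrite !lt_min s20 s50 divr_gt0.
move=> x Dx; rewrite !lt_min => /andP[/andP[x4 x2] x5].
have x4' : len (x - p) < s4 by clear -x4 s40; lra.
have Vx : V x by apply: hV; move: x4'; rewrite lt_min => /andP[].
have rx := (defining_function_in rV Vx).1 Dx.
have := h5 x x5; rewrite rp subr0 ltr0_norm // lt_min => /andP[re1 re2].
(* Twice the time needed at first order: the linear term gains at least 3/2 (- r x), and the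
   remainder loses at most half of - r x. *)
pose t := 2 * - r x / m ^+ 2.
have t0 : 0 < t by rewrite divr_gt0 ?exprn_gt0 // mulr_gt0 // oppr_gt0.
pose y := x + (t%:C%C : C R) *: grad r p.
have yx : y - x = (t%:C%C : C R) *: grad r p by rewrite /y addrAC subrr add0r.
have lyx : len (y - x) = t * m.
  by rewrite yx lenZ cmod_of_real_norm mE ger0_norm // ltW.
have mn0 := lt0r_neq0 m0.
have tmE : t * m = 2 / m * - r x by rewrite /t; move: (- r x) mn0; clear => u mn0; field.
have y4 : len (y - p) < s4.
  apply: (le_lt_trans (len_distD x _ _)); rewrite lyx tmE.
  have : - r x * 4 < s4 * m by rewrite -ltr_pdivlMr.
  rewrite mulrAC (mulrC 2) -mulrA => h; have : 2 * - r x / m < s4 / 2.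
    by rewrite ltr_pdivrMr //; move: h; clear; lra.
  by move: x4; clear; lra.
have Vy : V y by apply: hV; move: y4; rewrite lt_min => /andP[].
have nDy : ~ D y.
  move=> Dy; have ry := (defining_function_in rV Vy).1 Dy.
  move: x4' y4; rewrite !lt_min => /andP[x1 _] /andP[y1 _].
  have := h1 x y x1 y1; rewrite lyx ler_norml => /andP[h _].
  have b1 : t * (3 / 4 * m ^+ 2) <= dirD r x (y - x).
    rewrite yx /dirD Re_dotmxZl; apply: (ler_wpM2l (ltW t0)).
    have a1 := Re_dotmx_le (grad r p) (grad r p - grad r x).
    have a2 := ler_wpM2l (len_ge0 (grad r p)) (h2 x x2).
    rewrite lenC in a2; have a3' := le_trans a1 a2.
    have a4 := Re_dotmx_self (grad r p).
    have lin (a b k l : R) : k = a - b -> k <= l * (m / 4) -> m = l -> a = l ^+ 2 ->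
        3 / 4 * m ^+ 2 <= b.
      move=> -> kl ml; move: kl; rewrite -ml.
      have -> : m * (m / 4) = m ^+ 2 / 4 by ring.
      by move: (m ^+ 2); clear => *; lra.
    have a5 := Re_dotmxBr (grad r p) (grad r x) (grad r p).
    have a6 := lin _ _ _ _ a5 a3' mE a4.
    exact: a6.
  have b2 : K * (t * m) ^+ 2 <= t * (m ^+ 2 / 4).
    have : - r x * (8 * K + 1) <= m ^+ 2 by rewrite -ler_pdivlMr // ltW.
    have -> : K * (t * m) ^+ 2 = t * (2 * K * - r x).
      by rewrite /t; move: (- r x) mn0; clear => u mn0; field.
    rewrite ler_pM2l // mulrDr mulr1; have := oppr_gt0 (r x); rewrite rx.
    have -> : - r x * (8 * K) = 4 * (2 * K * - r x) by ring.
    by move: (2 * K * _) (m ^+ 2) => ? ?; clear; lra.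
  have b3 : t * m ^+ 2 = 2 * - r x by rewrite /t mulfVK // expf_neq0 // lt0r_neq0.
  move: b1 b2; have -> : t * (3 / 4 * m ^+ 2) = 3 / 4 * (t * m ^+ 2) by ring.
  have -> : t * (m ^+ 2 / 4) = t * m ^+ 2 / 4 by ring.
  by rewrite b3; move: h ry; move: (r x) (r y) (dirD _ _ _) (K * _) => ? ? ? ?; clear; lra.
have [q bq qx] := segment_boundary oD Dx nDy.
apply: (le_trans (bdist_le _ bq)); apply: (le_trans qx).
by rewrite lenC lyx tmE.
Qed.

End Normal.

(** * Peak polynomials *)

Section DerivableSum.
Variable K : numFieldType.

Lemma derivable_bigsum (I : Type) (s : seq I) (F : I -> K -> K) (t : K) :
  (forall i, derivable (F i) t 1) -> derivable (fun t' => \sum_(i <- s) F i t') t 1.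
Proof.
move=> dF; elim: s => [|i s IH].
  have -> : (fun t' => \sum_(i <- [::]) F i t') = fun=> 0.
    by apply/funext => t'; rewrite big_nil.
  exact: derivable_cst.
have -> : (fun t' => \sum_(j <- i :: s) F j t') = (fun t' => F i t' + \sum_(j <- s) F j t').
  by apply/funext => t'; rewrite big_cons.
exact: derivable_add (dF i) IH.
Qed.

End DerivableSum.

Section PeakPolynomial.
Variables (R : realType) (d : nat).
Implicit Types (u v w x y z p q g : 'rV[C R]_d) (m : 'I_d -> 'I_d -> C R).

Lemma derivable_coord (phi : C R -> 'rV[C R]_d) (j : 'I_d) (t : C R) :
  derivable phi t 1 -> derivable (fun s => phi s 0 j) t 1.
Proof.
move=> /cvg_ex[L hL]; apply/cvg_ex; exists (L 0 j).
have := cvg_comp _ _ hL (@coord_continuous (C R) 1 d 0 j L).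
by apply: cvg_trans; apply: near_eq_cvg; near=> h => /=; rewrite !mxE.
Unshelve. all: by end_near. Qed.

(* The quadratic part is centred at [z] and not at [q], for the difference of the
   values at [w] and [z] to be [Re <z - w, g>] up to [O(|z - w|^2)]. *)
Definition peak_poly m g q z (th a0 : R) a x : C R :=
  - dotmx (x - q) g - quad m (x - z) + th%:C%C * dotmx (x - z) a ^+ 2 + a0%:C%C.

Lemma derivable_peak_poly m g q z th a0 a (phi : C R -> 'rV[C R]_d) (t : C R) :
  derivable phi t 1 ->
  derivable (fun s => peak_poly m g q z th a0 a (phi s)) t 1.
Proof.
move=> dphi.
have dc w j : derivable (fun s => (phi s - w) 0 j) t 1.
  have -> : (fun s => (phi s - w) 0 j) = fun s => phi s 0 j - w 0 j.
    by apply/funext => s; rewrite !mxE.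
  have h1 := @derivable_coord phi j t dphi; have h2 := (@derivable_cst _ _ _ (w 0 j) t 1).
  exact (derivable_sub h1 h2).
have dd w v : derivable (fun s => dotmx (phi s - w) v) t 1.
  have -> : (fun s => dotmx (phi s - w) v) = fun s => \sum_j (phi s - w) 0 j * conjc (v 0 j).
    by apply/funext => s; rewrite dotmx_sum.
  refine (derivable_bigsum _) => j.
  exact (derivable_mul (dc w j) (@derivable_cst _ _ _ (conjc (v 0 j) : C R) t 1)).
have dq w : derivable (fun s => quad m (phi s - w)) t 1.
  refine (derivable_bigsum _) => j.
  refine (derivable_bigsum _) => k.
  refine (derivable_mul (derivable_mul _ _) _).
  - exact (@derivable_cst _ _ _ (m j k) t 1).
  - exact (dc w j).
  - exact (dc w k).
have d1 := derivable_sub (@derivable_cst _ _ _ (0 : C R) t 1) (dd q g).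
have d2 := derivable_sub d1 (dq z).
have d3 := derivable_mul (@derivable_cst _ _ _ (th%:C%C : C R) t 1) (@derivable_exp _ _ 2 _ (dd z a)).
have d4 := derivable_add (derivable_add d2 d3) (@derivable_cst _ _ _ (a0%:C%C : C R) t 1).
have <- : (fun s => 0 - dotmx (phi s - q) g - quad m (phi s - z) +
   th%:C%C * dotmx (phi s - z) a ^+ 2 + a0%:C%C) = fun s => peak_poly m g q z th a0 a (phi s).
  by apply/funext => s; rewrite sub0r.
exact d4.
Qed.

Lemma quad0 m : quad m (0 : 'rV[C R]_d) = 0.
Proof. by rewrite /quad big1 // => j _; rewrite big1 // => k _; rewrite !mxE !mulr0. Qed.

Lemma dotmx_self v : dotmx v v = (len v ^+ 2)%:C%C.
Proof.
have := Re_dotmx_self v; have := dotmx_conj v v; case: (dotmx v v) => a b /= h <-.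
by case: h => h; apply: complex_eq => //=; lra.
Qed.

Lemma dotmx_normalize v : dotmx v (normalize v) ^+ 2 = (len v ^+ 2)%:C%C.
Proof.
have [v0|v0] := eqVneq v 0.
  have -> : dotmx v (normalize v) = 0 by rewrite v0 dotmx_sum big1 // => j _; rewrite mxE mul0r.
  by rewrite v0 len0 !expr0n.
rewrite /normalize dotmxZr dotmx_self.
have /lt0r_neq0 : 0 < len v by rewrite len_gt0.
move: (len v) => l l0.
have -> : (conjc (l^-1)%:C%C : C R) * (l ^+ 2)%:C%C = l%:C%C :> C R.
  by apply: complex_eq; rewrite !(ReM, ImM) /=; field.
by apply: complex_eq; rewrite !expr2 !(ReM, ImM) /=; ring.
Qed.

Lemma len_normalize_le1 v : len (normalize v) <= 1.
Proof.
have [->|v0] := eqVneq v 0; last by rewrite len_normalize.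
by rewrite /normalize scaler0 len0.
Qed.

End PeakPolynomial.

Section BoundaryPeak.
Variables (R : realType) (d : nat) (D : set 'rV[C R]_d).
Hypothesis oD : open D.
Implicit Types (u v w x y z p q g : 'rV[C R]_d) (m : 'I_d -> 'I_d -> C R)
  (V : set 'rV[C R]_d) (r : 'rV[C R]_d -> R).

Lemma near_strongly_pseudoconvex p V r : boundary D p -> defining_function D p V r ->
  (forall X, complex_tangent r p X -> X != 0 -> 0 < levi r p X) ->
  exists (m : 'I_d -> 'I_d -> C R) (c K G g0 s : R),
  [/\ [/\ 0 < c, 0 <= K, 0 < g0, 0 < s & s <= 1],
      forall q, len (q - p) < s -> V q /\ g0 <= len (grad r q) <= G,
      forall q x, len (q - p) < s -> len (x - p) < s ->
        `|r x - r q - dirD r q (x - q)| <= K * len (x - q) ^+ 2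
    & forall q x, boundary D q -> D x -> len (q - p) < s -> len (x - p) < s ->
        c * bdist D x + c * len (x - q) ^+ 2 <=
        - dirD r q (x - q) - complex.Re (quad m (x - q))].
Proof.
move=> bp rV pos; have [oV Vp cr _ gn0] := rV.
have rp := defining_function_boundary oD rV Vp bp.
have [m [c1 [s1 [c10 s10 h1]]]] := peak_inequality oV Vp cr rp pos.
have [K [s2 [K0 s20 h2]]] := Taylor_first_order oV Vp cr.
have [K2 [s3 [K20 s30 h3]]] := bdist_le_defining oD bp rV.
have l0 : 0 < len (grad r p) by rewrite len_gt0 gn0.
have [s4 s40 h4] := grad_continuous oV Vp (class_C_pred cr) (divr_gt0 l0 (ltr0Sn R 1)).
have /nbhs_lenP[s5 s50 hV] : nbhs p V by apply: open_nbhs_nbhs.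
pose s := Num.min (Num.min (Num.min s1 s2) (Num.min s3 s4)) (Num.min s5 1).
exists m, (Num.min c1 (2 * K2)^-1), K, (2 * len (grad r p)), (len (grad r p) / 2), s.
have K2i : 0 < (2 * K2)^-1 by rewrite invr_gt0 mulr_gt0.
split.
- split => //; first by rewrite lt_min c10.
  + exact: divr_gt0.
  + by rewrite !lt_min s10 s20 s30 s40 s50 ltr01.
  + by rewrite !ge_min lexx !orbT.
- move=> q; rewrite !lt_min => /andP[/andP[_ /andP[_ q4]] /andP[q5 _]]; split; first exact: hV.
  have := h4 q q4; have := lenD (grad r q - grad r p) (grad r p).
  have := lenD (grad r p - grad r q) (grad r q).
  rewrite (lenC (grad r p)) (subrK (grad r q)) (subrK (grad r p)).
  move: l0; move: (len (grad r q)) (len (grad r p)) (len (grad r q - grad r p)).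
  by clear; move=> a b e *; apply/andP; split; lra.
- move=> q x; rewrite !lt_min => /andP[/andP[/andP[_ q2] _] _] /andP[/andP[/andP[_ x2] _] _].
  exact: h2.
move=> q x bq Dx; rewrite !lt_min => /andP[/andP[/andP[q1 _] _] /andP[q5 _]].
move=> /andP[/andP[/andP[x1 _] /andP[x3 _]] /andP[x5 _]].
have rq := defining_function_boundary oD rV (hV q q5) bq.
have rx := (defining_function_in rV (hV x x5)).1 Dx.
apply: le_trans (h1 q x q1 x1 rq rx).
apply: lerD; last by apply: ler_wpM2r; [exact: sqr_ge0|rewrite ge_min lexx].
have b0 : 0 <= bdist D x by apply: ltW; apply: bdist_gt0 => //; exists p.
have t1 : Num.min c1 (2 * K2)^-1 * bdist D x <= (2 * K2)^-1 * bdist D x.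
  by apply: ler_wpM2r => //; rewrite ge_min lexx orbT.
apply: (le_trans t1).
have t2 : (2 * K2)^-1 * bdist D x <= (2 * K2)^-1 * (K2 * - r x).
  by apply: ler_wpM2l; [exact: ltW|exact: h3].
apply: (le_trans t2); move: (lt0r_neq0 K20); move: (r x) => t; clear => n.
by have -> : (2 * K2)^-1 * (K2 * - t) = - t / 2 by field.
Qed.

Lemma Re_peak_poly m g q z (th a0 : R) a x :
  complex.Re (peak_poly m g q z th a0 a x) =
  - complex.Re (dotmx (x - q) g) - complex.Re (quad m (x - z))
  + th * complex.Re (dotmx (x - z) a ^+ 2) + a0.
Proof. by rewrite /peak_poly !ReD !ReN ReM /= mul0r subr0. Qed.

(** Moving the centre of the quadratic part from q to z, with dl = |z - q|, costs at most kq dl (2 l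
    + dl). As 2 kq dl l <= c / 4 l^2 + 4 kq^2 / c dl^2, this is paid by part of c l^2 and by a0
    dl^2, whence the lower bound on a0; the term in th costs at most c / 4 (l^2 + dl^2). *)
Lemma peak_lower_arith (T A B' l dl w kq c th P a0 : R) :
  0 < c -> 0 <= l -> 0 <= dl -> 0 <= w -> 0 <= kq -> w <= l + dl ->
  P + c * l ^+ 2 <= T - A ->
  `|B' - A| <= kq * (dl * (l + w)) ->
  `|th| <= c / 8 * w ^+ 2 ->
  c + 4 * kq ^+ 2 / c + kq <= a0 ->
  P + c / 4 * l ^+ 2 <= T - B' + th + a0 * dl ^+ 2.
Proof.
move=> c0 l0 d0 w0 k0 wl h1; rewrite !ler_norml => /andP[_ h2] /andP[h3 _] ha.
have w2 : w ^+ 2 <= 2 * l ^+ 2 + 2 * dl ^+ 2.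
  have : w ^+ 2 <= (l + dl) ^+ 2 by rewrite lerXn2r // nnegrE // addr_ge0.
  by have := sqr_ge0 (l - dl); rewrite sqrrB sqrrD; clear; lra.
have h4 : kq * (dl * (l + w)) <= kq * (dl * (2 * l + dl)).
  by rewrite ler_wpM2l // ler_wpM2l //; move: wl; clear; lra.
have h5 : 2 * kq * dl * l <= c / 4 * l ^+ 2 + 4 * kq ^+ 2 / c * dl ^+ 2.
  rewrite -subr_ge0.
  have -> : c / 4 * l ^+ 2 + 4 * kq ^+ 2 / c * dl ^+ 2 - 2 * kq * dl * l
     = (c * l / 2 - 2 * kq * dl) ^+ 2 / c.
    by move: (lt0r_neq0 c0) => n; field.
  by rewrite divr_ge0 ?sqr_ge0 // ltW.
have h6 : (c + 4 * kq ^+ 2 / c + kq) * dl ^+ 2 <= a0 * dl ^+ 2 by rewrite ler_wpM2r // sqr_ge0.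
have h7 : c / 8 * w ^+ 2 <= c / 8 * (2 * l ^+ 2 + 2 * dl ^+ 2).
  by rewrite ler_wpM2l // divr_ge0 // ltW.
have h8 : 0 <= c * dl ^+ 2 by rewrite mulr_ge0 ?sqr_ge0 // ltW.
have h9 : 0 <= c * l ^+ 2 by rewrite mulr_ge0 ?sqr_ge0 // ltW.
move: h1 h2 h3 h4 h5 h6 h7 h8 h9.
have -> : kq * (dl * (2 * l + dl)) = 2 * kq * dl * l + kq * dl ^+ 2 by ring.
have -> : (c + 4 * kq ^+ 2 / c + kq) * dl ^+ 2 = c * dl ^+ 2 + 4 * kq ^+ 2 / c * dl ^+ 2 + kq * dl ^+ 2 by ring.
have -> : c / 8 * (2 * l ^+ 2 + 2 * dl ^+ 2) = c * l ^+ 2 / 4 + c * dl ^+ 2 / 4 by field.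
have -> : c / 4 * l ^+ 2 = c * l ^+ 2 / 4 by field.
move: (kq * (dl * (l + w))) (2 * kq * dl * l) (4 * kq ^+ 2 / c * dl ^+ 2) (kq * dl ^+ 2)
  (c * dl ^+ 2) (c * l ^+ 2) (c / 8 * w ^+ 2) (a0 * dl ^+ 2).
by clear; move=> *; lra.
Qed.

End BoundaryPeak.

Section Arithmetic.
Variable R : realType.
Implicit Types a b s t k : R.

Lemma quarter_lt a s : 0 < s -> a < s / 4 -> a < s.
Proof. by lra. Qed.

Lemma quarter_add_lt a b t s : 0 < s -> a < s / 4 -> b <= a -> t <= b + a -> t < s.
Proof. by lra. Qed.

Lemma sqr_le_self a : 0 <= a -> a <= 1 -> a ^+ 2 <= a.
Proof. by move=> a0 a1; rewrite expr2 ler_piMr. Qed.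

Lemma sqr_le_mul2 a b t : t <= a + b -> 0 <= t -> 0 <= a -> 0 <= b -> b ^+ 2 <= b ->
  t ^+ 2 <= 2 * a ^+ 2 + 2 * b.
Proof.
move=> tab t0 a0 b0 b1.
have : t ^+ 2 <= (a + b) ^+ 2 by rewrite lerXn2r // nnegrE addr_ge0.
by have := sqr_ge0 (a - b); rewrite sqrrB sqrrD; lra.
Qed.

(** In the application r1 is r w; B' and r2 are its linear approximations from the closest points of
    z and of w, and B is the linear term at z. *)
Lemma dirD_closest_arith (A B B' r1 r2 dz dw w2 L K G : R) :
  A = B - B' -> `|B| <= G * dz -> `|r1 - B'| <= K * w2 ->
  `|r1 - r2| <= K * dw ^+ 2 -> `|r2| <= G * dw ->
  w2 <= 2 * L + 2 * dz -> dw ^+ 2 <= dw -> 0 <= G -> 0 <= K -> 0 <= L -> 0 <= dw ->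
  `|A| <= (G + 2 * K) * (dz + dw + L).
Proof.
move=> -> /ler_normlP[a1 a2] /ler_normlP[a3 a4] /ler_normlP[a5 a6] /ler_normlP[a7 a8].
move=> h5 h6 G0 K0 L0 w0; have k1 := ler_wpM2l K0 h5; have k2 := ler_wpM2l K0 h6.
have l2 := mulr_ge0 G0 L0; have l3 := mulr_ge0 K0 w0.
have l4 : K * (2 * L + 2 * dz) = 2 * (K * L) + 2 * (K * dz) by ring.
have -> : (G + 2 * K) * (dz + dw + L) = G * dz + G * dw + G * L + 2 * (K * dz) +
  2 * (K * dw) + 2 * (K * L) by ring.
rewrite l4 in k1; move: a1 a2 a3 a4 a5 a6 a7 a8 k1 k2 l2 l3.
move: (K * L) (K * dz) (G * dz) (G * dw) (G * L) (K * dw) (K * w2) (K * dw ^+ 2).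
move=> t1 t2 t3 t4 t5 t6 t7 t8; clear=> *; apply/ler_normlP; split; lra.
Qed.

End Arithmetic.

(** * Peaks at the boundary points near p *)

Section Peaks.
Variables (R : realType) (d : nat) (D : set 'rV[C R]_d).
Hypothesis oD : open D.
Variables (p : 'rV[C R]_d) (V : set 'rV[C R]_d) (r : 'rV[C R]_d -> R)
  (m : 'I_d -> 'I_d -> C R) (c K G g0 s kq : R).
Hypotheses (bp : boundary D p) (rV : defining_function D p V r).
Hypotheses (c0 : 0 < c) (K0 : 0 <= K) (g00 : 0 < g0) (s0 : 0 < s) (s1 : s <= 1)
  (kq0 : 0 <= kq).
Hypothesis quad_m : forall u w,
  cmod (quad m u - quad m w) <= kq * (len (u - w) * (len u + len w)).
Hypothesis grad_near : forall q, len (q - p) < s -> V q /\ g0 <= len (grad r q) <= G.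
Hypothesis taylor_near : forall q x, len (q - p) < s -> len (x - p) < s ->
  `|r x - r q - dirD r q (x - q)| <= K * len (x - q) ^+ 2.
Hypothesis peak_near : forall q x, boundary D q -> D x -> len (q - p) < s ->
  len (x - p) < s -> c * bdist D x + c * len (x - q) ^+ 2 <=
    - dirD r q (x - q) - complex.Re (quad m (x - q)).
Implicit Types (u v w x y z q a : 'rV[C R]_d) (th : R).

Variable a0 : R.
Hypothesis a0_large : c + 4 * kq ^+ 2 / c + kq <= a0.

Definition peak_near_boundary q z th a :=
  peak_poly m (grad r q) q z th (a0 * len (z - q) ^+ 2) a.

Lemma a0_ge : c <= a0.
Proof.
apply: le_trans a0_large; rewrite -addrA lerDl addr_ge0 // divr_ge0 ?(ltW c0) // mulr_ge0 //; exact: sqr_ge0.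
Qed.

Lemma quad_m_le u : cmod (quad m u) <= kq * len u ^+ 2.
Proof.
have := quad_m u 0; rewrite quad0 len0 !subr0 addr0 expr2; exact.
Qed.

Lemma dotmx_sqr_le u a : len a <= 1 -> cmod (dotmx u a ^+ 2) <= len u ^+ 2.
Proof.
move=> a1; rewrite cmodX; apply: lerXn2r; rewrite ?nnegrE ?cmod_ge0 ?len_ge0 //.
apply: (le_trans (cmod_dotmx_le _ _)); rewrite ler_piMr //; exact: len_ge0.
Qed.

Lemma peak_lower q z th a x : boundary D q -> D x -> len (q - p) < s ->
  len (x - p) < s -> `|th| <= c / 8 -> len a <= 1 ->
  c * bdist D x + c / 4 * len (x - q) ^+ 2 <=
    complex.Re (peak_near_boundary q z th a x).
Proof.
move=> bq Dx qs xs th8 a1; rewrite Re_peak_poly.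
have h1 := peak_near bq Dx qs xs.
have w1 : len (x - z) <= len (x - q) + len (z - q).
  by have := len_distD q x z; rewrite (lenC q z).
have h2 : `|complex.Re (quad m (x - z)) - complex.Re (quad m (x - q))| <=
    kq * (len (z - q) * (len (x - q) + len (x - z))).
  rewrite -ReN -ReD; apply: (le_trans (Re_le_cmod _)); apply: (le_trans (quad_m _ _)).
  have -> : x - z - (x - q) = q - z by rewrite opprB addrC addrA subrK.
  by rewrite (lenC q z) (addrC (len (x - z))).
have h3 : `|th * complex.Re (dotmx (x - z) a ^+ 2)| <= c / 8 * len (x - z) ^+ 2.
  rewrite normrM; apply: ler_pM => //.
  exact: le_trans (Re_le_cmod _) (dotmx_sqr_le _ a1).
exact: (peak_lower_arith c0 (len_ge0 _) (len_ge0 _) (len_ge0 _) kq0 w1 h1 h2 h3 a0_large).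
Qed.

Lemma peak_center q z th a : complex.Re (peak_near_boundary q z th a z) =
  - dirD r q (z - q) + a0 * len (z - q) ^+ 2.
Proof.
rewrite Re_peak_poly subrr quad0.
have -> : dotmx 0 a = 0 by rewrite dotmx_sum big1 // => j _; rewrite mxE mul0r.
by rewrite expr0n /= mulr0 subr0 addr0.
Qed.

Lemma peak_center_le q z th a : len (q - p) < s -> len (z - q) <= 1 ->
  complex.Re (peak_near_boundary q z th a z) <= (G + a0) * len (z - q).
Proof.
move=> qs zq; rewrite peak_center mulrDl; apply: lerD.
  have [_ /andP[_ gG]] := grad_near qs.
  have := dirD_le r q (z - q); rewrite ler_norml => /andP[h _].
  have h2 := ler_wpM2l (len_ge0 (z - q)) gG.
  rewrite lerNl mulrC; apply: le_trans h; by rewrite lerN2.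
have a00 : 0 <= a0 by exact: le_trans (ltW c0) a0_ge.
by rewrite ler_wpM2l // expr2 ler_piMr // len_ge0.
Qed.

Lemma cmod_peak_le q z th a x : len (q - p) < s -> len (z - q) <= 1 ->
  len (x - q) <= 2 -> len (x - z) <= 2 -> `|th| <= c / 8 -> len a <= 1 ->
  cmod (peak_near_boundary q z th a x) <= 2 * G + 4 * kq + c + a0 + 1.
Proof.
move=> qs zq xq xz th8 a1.
have [_ /andP[gG0 gG]] := grad_near qs.
have a00 : 0 <= a0 by exact: le_trans (ltW c0) a0_ge.
have h1 : cmod (dotmx (x - q) (grad r q)) <= 2 * G.
  by apply: (le_trans (cmod_dotmx_le _ _)); apply: ler_pM => //; exact: len_ge0.
have x4 : len (x - z) ^+ 2 <= 4.
  have -> : 4 = 2 ^+ 2 :> R by rewrite -natrX.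
  by apply: lerXn2r => //; rewrite nnegrE // len_ge0.
have h2 : cmod (quad m (x - z)) <= 4 * kq.
  by apply: (le_trans (quad_m_le _)); rewrite mulrC ler_wpM2r.
have h3 : cmod ((th%:C%C : C R) * dotmx (x - z) a ^+ 2) <= c.
  rewrite cmodM cmod_of_real_norm.
  have t := ler_pM (normr_ge0 th) (cmod_ge0 _) th8 (le_trans (dotmx_sqr_le (x - z) a1) x4).
  by apply: (le_trans t); have := c0; lra.
have h4 : cmod ((a0 * len (z - q) ^+ 2)%:C%C : C R) <= a0.
  rewrite cmod_of_real_norm ger0_norm; last by rewrite mulr_ge0 // sqr_ge0.
  by rewrite ler_piMr // expr_le1 // len_ge0.
rewrite /peak_near_boundary /peak_poly.
apply: (le_trans (cmodD _ _)); apply: (le_trans (lerD (cmodD _ _) (lexx _))).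
apply: (le_trans (lerD (lerD (cmodD _ _) (lexx _)) (lexx _))).
rewrite !cmodN; move: h1 h2 h3 h4.
move: (cmod (dotmx (x - q) _)) (cmod (quad _ _)) (cmod (_ * dotmx _ _ ^+ 2)) (cmod (_ %:C%C)).
move=> *; lra.
Qed.

(** The direction (w - z) / |w - z| makes the squared product at w the real number |w - z|^2, while
    the terms centred at z vanish at z. *)
Lemma peak_difference q z w th :
  complex.Re (peak_near_boundary q z th (normalize (w - z)) w) -
  complex.Re (peak_near_boundary q z th (normalize (w - z)) z) =
  dirD r q (z - w) - complex.Re (quad m (w - z)) + th * len (w - z) ^+ 2.
Proof.
have h0 := peak_center q z th (normalize (w - z)).
have h1 := Re_peak_poly m (grad r q) q z th (a0 * len (z - q) ^+ 2) (normalize (w - z)) w.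
have h2 : complex.Re (dotmx (w - z) (normalize (w - z)) ^+ 2) = len (w - z) ^+ 2.
  by rewrite dotmx_normalize.
have h3 : dirD r q (z - w) = dirD r q (z - q) - dirD r q (w - q).
  by have := Re_dotmxBl (z - q) (w - q) (grad r q); rewrite opprB addrA subrK.
have lin (A B A' B' T T1 T2 Q L L' : R) : A = - T2 - Q + th * L' + B' -> B = - T1 + B' ->
    L' = L -> T = T1 - T2 -> A - B = T - Q + th * L.
  by move=> -> -> -> ->; ring.
exact: lin h1 h0 h2 h3.
Qed.

(* The sign of [th] is that of the remaining terms, so that [th |w - z|^2] adds up
   with them and dominates the error in [O(|z - w|^2)]. *)
Lemma peak_separation q z w : exists th a, [/\ `|th| <= c / 8, len a <= 1 &
  c / (8 * kq + c) * `|dirD r q (z - w)| <=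
  `|complex.Re (peak_near_boundary q z th a w) - complex.Re (peak_near_boundary q z th a z)|].
Proof.
have c8 : 0 <= c / 8 by rewrite divr_ge0 // ltW.
pose T := dirD r q (z - w) - complex.Re (quad m (w - z)).
pose th := if 0 <= T then c / 8 else - (c / 8).
exists th, (normalize (w - z)).
have th8 : `|th| <= c / 8 by rewrite /th; case: ifP => _; rewrite ?normrN ger0_norm.
split=> //; first exact: len_normalize_le1.
have E := peak_difference q z w th.
rewrite E -/T.
have L0 := sqr_ge0 (len (w - z)).
have F : `|T + th * len (w - z) ^+ 2| = `|T| + c / 8 * len (w - z) ^+ 2.
  have L8 : 0 <= c / 8 * len (w - z) ^+ 2 by exact: mulr_ge0.
  rewrite /th; have [T0|T0] := leP 0 T.
    by rewrite !ger0_norm // addr_ge0.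
  rewrite mulNr ltr0_norm; first by rewrite ltr0_norm // opprB addrC.
  by rewrite ltr_wnDr // oppr_le0.
rewrite F.
have hT : `|dirD r q (z - w)| <= `|T| + kq * len (w - z) ^+ 2.
  have -> : dirD r q (z - w) = T + complex.Re (quad m (w - z)) by rewrite /T subrK.
  apply: (le_trans (ler_normD _ _)); rewrite lerD2l.
  exact: le_trans (Re_le_cmod _) (quad_m_le _).
have d0 : 0 < 8 * kq + c by rewrite ltr_wpDl // mulr_ge0.
have lam0 : 0 <= c / (8 * kq + c) by rewrite divr_ge0 // ltW.
apply: (le_trans (ler_wpM2l lam0 hT)); rewrite mulrDr; apply: lerD.
  rewrite ler_piMl // ler_pdivrMr // mul1r lerDr mulr_ge0 //.
rewrite mulrA ler_wpM2r // mulrAC ler_pdivrMr // -mulrA.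
by apply: (ler_wpM2l (ltW c0)); rewrite mulrDr mulKf // lerDl mulr_ge0 // ltW.
Qed.

Lemma G_gt0 : 0 < G.
Proof.
have [|_ /andP[h1 h2]] := @grad_near p; first by rewrite subrr len0.
exact: lt_le_trans g00 (le_trans h1 h2).
Qed.

(** Near a point outside the ball of radius s, the points of D in the ball are at distance at least
    s / 2 from q, so Re H exceeds c s^2 / 16. This is more than 2 b for b = c s^2 / 64. *)
Lemma peak_near_boundary_peak q z th a : boundary D q -> len (q - p) < s / 4 ->
  len (z - p) < s / 4 -> `|th| <= c / 8 -> len a <= 1 ->
  peak_at_boundary D (peak_near_boundary q z th a) [set x | len (x - p) < s]
    (c * s ^+ 2 / 64) (2 * G + 4 * kq + c + a0 + 1).
Proof.
move=> bq q4 z4 th8 a1.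
have le_s t : t < s / 4 -> t < s by have := s0; move=> *; lra.
have qs := le_s _ q4; have zs := le_s _ z4.
have a00 := le_trans (ltW c0) a0_ge; have G0 := G_gt0.
have s2 : s ^+ 2 <= 1 by rewrite expr_le1 // ltW.
have zq : len (z - q) <= 1.
  apply: (le_trans (len_distD p _ _)); rewrite (lenC p q).
  by have := s1; move: q4 z4; move: (len (q - p)) (len (z - p)) => *; lra.
split.
- split.
  + by rewrite divr_gt0 // mulr_gt0 // exprn_gt0.
  + have h : c * s ^+ 2 <= c by rewrite ler_piMr // ltW.
    by have := kq0; have := c0; move: h G0 a00 => *; lra.
  + by have := kq0; have := c0; move: G0 a00 => *; lra.
- move=> phi hphi t t1; refine (@derivable_peak_poly _ _ _ _ _ _ _ _ _ _ _ _).
  by have [] := hphi t; rewrite // (_ : 1 = (1 : R)%:C%C) // ltc_cmod.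
- move=> x Dx /= xs; split; last first.
    have two u : len (u - p) < s -> len (x - u) <= 2.
      move=> us; apply: (le_trans (len_distD p _ _)); rewrite (lenC p u).
      by have := s1; move: xs us; move: (len (x - p)) (len (u - p)) => *; lra.
    by apply: cmod_peak_le => //; exact: two.
  apply: lt_le_trans (peak_lower z bq Dx qs xs th8 a1).
  apply: ltr_wpDr; first by rewrite mulr_ge0 ?sqr_ge0 // divr_ge0 // ltW.
  by rewrite mulr_gt0 // bdist_gt0 //; exists p.
- rewrite openE => x /= xs; apply/nbhs_lenP; exists (s - len (x - p)).
    by rewrite subr_gt0.
  by move=> y yx /=; apply: (le_lt_trans (len_distD x _ _)); rewrite -ltrBrDr.
move=> x Dx /= /negP; rewrite -leNgt => xs; apply/nbhs_lenP; exists (s / 4).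
  exact: divr_gt0.
move=> y yx Dy ys; apply: lt_le_trans (peak_lower z bq Dy qs ys th8 a1).
have b0 : 0 < c * bdist D y by rewrite mulr_gt0 // bdist_gt0 //; exists p.
have yq : s / 2 <= len (y - q).
  have := len_distD y x p; have := len_distD q y p; rewrite (lenC x y).
  by move: xs yx q4 => *; lra.
have h : (s / 2) ^+ 2 <= len (y - q) ^+ 2 by rewrite lerXn2r // nnegrE ?len_ge0 // divr_ge0 // ltW.
have h2 : c / 4 * (s / 2) ^+ 2 <= c / 4 * len (y - q) ^+ 2 by rewrite ler_wpM2l // divr_ge0 // ltW.
have E1 : c / 4 * (s / 2) ^+ 2 = c * s ^+ 2 / 16 by field.
have h3 : 0 < c * s ^+ 2 by rewrite mulr_gt0 // exprn_gt0.
move: h2 b0 h3; rewrite E1; move: (c * s ^+ 2) (c * bdist D y) (c / 4 * _) => t1 t2 t3 *; lra.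
Qed.

Lemma normal_length_closest z v : V (closest D z) ->
  normal_length D z v = `|dirD r (closest D z) v| / len (grad r (closest D z)).
Proof.
have bz : boundary D !=set0 by exists p.
move=> Vq; have [bq _] := closestP z bz.
rewrite /normal_length (outer_normalE oD rV Vq bq) Re_dotmx_normalize normrM.
by rewrite ger0_norm ?invr_ge0 ?len_ge0 // mulrC.
Qed.

(** Seen from the closest point of w, r w is O(delta w). Seen from the closest point q of z, it is
    the linear term of r in w - q up to O(|w - q|^2), and |w - q| <= |z - w| + delta z. The linear
    term in z - q is O(delta z). *)
Lemma dirD_closest_le z w : len (z - p) < s / 4 -> len (w - p) < s / 4 ->
  `|dirD r (closest D z) (z - w)| <=
    (G + 2 * K) * (bdist D z + bdist D w + len (z - w) ^+ 2).
Proof.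
have bz : boundary D !=set0 by exists p.
move=> zs ws; have [bq zq] := closestP z bz; have [bq' wq'] := closestP w bz.
move: bq zq bq' wq'; move: (closest D z) (closest D w) => q q' bq zq bq' wq'.
have hz : bdist D z <= len (z - p) by exact: bdist_le.
have hw : bdist D w <= len (w - p) by exact: bdist_le.
have close u v : len (u - p) < s / 4 -> len (u - v) <= len (u - p) -> len (v - p) < s.
  move=> us uv; have := len_distD u v p; rewrite (lenC v u) => h.
  exact: quarter_add_lt s0 us uv h.
have qs : len (q - p) < s by apply: (close z) => //; rewrite zq.
have qs' : len (q' - p) < s by apply: (close w) => //; rewrite wq'.
have ws' : len (w - p) < s by exact: quarter_lt s0 ws.
have [Vq /andP[_ gG]] := grad_near qs; have [Vq' /andP[_ gG']] := grad_near qs'.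
have rq := defining_function_boundary oD rV Vq bq.
have rq' := defining_function_boundary oD rV Vq' bq'.
have t1 := taylor_near qs ws'; have t2 := taylor_near qs' ws'.
rewrite rq subr0 in t1; rewrite rq' subr0 in t2.
have E : dirD r q (z - w) = dirD r q (z - q) - dirD r q (w - q).
  by have := Re_dotmxBl (z - q) (w - q) (grad r q); rewrite opprB addrA subrK.
have G0 := ltW G_gt0.
have d1 : `|dirD r q (z - q)| <= G * bdist D z.
  by apply: (le_trans (dirD_le _ _ _)); rewrite zq mulrC ler_wpM2r // -zq len_ge0.
have d2 : `|dirD r q' (w - q')| <= G * bdist D w.
  by apply: (le_trans (dirD_le _ _ _)); rewrite wq' mulrC ler_wpM2r // -wq' len_ge0.
have w2 : 0 <= bdist D w by rewrite -wq' len_ge0.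
have h0 : 0 <= bdist D z by rewrite -zq len_ge0.
have w1 := sqr_le_self w2 (le_trans hw (le_trans (ltW ws') s1)).
have z1 := sqr_le_self h0 (le_trans hz (le_trans (ltW (quarter_lt s0 zs)) s1)).
have wq2 : len (w - q) ^+ 2 <= 2 * len (z - w) ^+ 2 + 2 * bdist D z.
  have h := len_distD z w q; rewrite zq (lenC w z) in h.
  exact: sqr_le_mul2 h (len_ge0 _) (len_ge0 _) h0 z1.
rewrite wq' in t2.
exact: (dirD_closest_arith E d1 t1 t2 d2 wq2 w1 G0 K0 (sqr_ge0 _) w2).
Qed.

End Peaks.

Section BoundaryPeaks.
Variables (R : realType) (d : nat) (D : set 'rV[C R]_d).
Implicit Types (u v w x y z p q : 'rV[C R]_d).

(** The peak H may depend on both z and w, through the sign of th and the direction a; the constants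
    and the set [B] must not. *)
Lemma boundary_peaks p : open D -> strongly_pseudoconvex_at D p ->
  exists (B : set 'rV[C R]_d) (b S c A s : R),
  [/\ [/\ 0 < c, 0 < A & 0 < s], [/\ 0 < b, b <= S & 1 <= S],
      forall x, len (x - p) < s -> B x
    & forall z w, D z -> D w -> len (z - p) < s -> len (w - p) < s ->
      [/\ 0 < bdist D z /\ bdist D z <= len (z - p),
          len (z - closest D z) = bdist D z,
          normal_length D z (z - w) <= A * (bdist D z + bdist D w + len (z - w) ^+ 2)
        & exists H, [/\ peak_at_boundary D H B b S,
            forall x, D x -> B x ->
              c * bdist D x + c * len (x - closest D z) ^+ 2 <= complex.Re (H x),
            complex.Re (H z) <= A * bdist D z
          & c * normal_length D z (z - w) <= `|complex.Re (H w) - complex.Re (H z)|]]].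
Proof.
move=> oD [bp [V [r [rV pos]]]].
have [m [c [K [G [g0 [s [[c0 K0 g00 s0 s1] hg ht hp]]]]]]] :=
  near_strongly_pseudoconvex oD bp rV pos.
have [kq kq0 hq] := quad_lipschitz m.
have bn : boundary D !=set0 by exists p.
have [a0 a0E] : exists a0, c + 4 * kq ^+ 2 / c + kq = a0 by eexists.
have a0l : c + 4 * kq ^+ 2 / c + kq <= a0 by rewrite a0E.
have G0 := G_gt0 g00 s0 hg.
have a00 := lt_le_trans c0 (a0_ge c0 kq0 a0l).
have c8 : 0 < c / 8 by exact: divr_gt0.
have s4 : 0 < s / 4 by exact: divr_gt0.
have d0 : 0 < 8 * kq + c by rewrite ltr_wpDl // mulr_ge0.
have lam0 : 0 < c / (8 * kq + c) by exact: divr_gt0.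
have pk q z th a := peak_near_boundary_peak oD bp c0 g00 s0 s1 kq0 hq hg hp a0l
  (q := q) (z := z) (th := th) (a := a).
have b0 : 0 < c * s ^+ 2 / 64 by rewrite divr_gt0 // mulr_gt0 // exprn_gt0.
have bS : c * s ^+ 2 / 64 <= 2 * G + 4 * kq + c + a0 + 1 /\ 1 <= 2 * G + 4 * kq + c + a0 + 1.
  have h : c * s ^+ 2 <= c by rewrite ler_piMr ?(ltW c0) // expr_le1 // ltW.
  have h0 : 0 <= c * s ^+ 2 by rewrite mulr_ge0 ?sqr_ge0 // ltW.
  move: h h0 G0 a00 kq0 c0; move: (c * s ^+ 2); clear => t *; split; lra.
exists [set x | len (x - p) < s], (c * s ^+ 2 / 64), (2 * G + 4 * kq + c + a0 + 1).
(* The radius s / 8 keeps the closest point of z within s / 4 of p. *)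
exists (Num.min (c / 4) (c / (8 * kq + c) * g0)), (Num.max (G + a0) ((G + 2 * K) / g0)), (s / 8).
have cm1 : Num.min (c / 4) (c / (8 * kq + c) * g0) <= c / 4 by rewrite ge_min lexx.
have cm2 : Num.min (c / 4) (c / (8 * kq + c) * g0) <= c / (8 * kq + c) * g0.
  by rewrite ge_min lexx orbT.
have cm0 : 0 < Num.min (c / 4) (c / (8 * kq + c) * g0).
  by rewrite lt_min; apply/andP; split; [exact: divr_gt0|exact: mulr_gt0].
have am1 : G + a0 <= Num.max (G + a0) ((G + 2 * K) / g0) by rewrite le_max lexx.
have am2 : (G + 2 * K) / g0 <= Num.max (G + a0) ((G + 2 * K) / g0) by rewrite le_max lexx orbT.
have am0 : 0 < Num.max (G + a0) ((G + 2 * K) / g0).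
  by apply: lt_le_trans am1; exact: addr_gt0.
move: cm1 cm2 cm0 am1 am2 am0; move: (Num.min _ _) (Num.max _ _) => c' A' cm1 cm2 cm0 am1 am2 am0.
split.
- by split => //; exact: divr_gt0.
- by split => //; case: bS.
- by move=> x /= xs; apply: (lt_trans xs); move: s0; clear; move=> *; lra.
move=> z w Dz Dw z8 w8.
have [bq zq] := closestP z bn.
have bz : bdist D z <= len (z - p) by exact: bdist_le.
have s84 a : a < s / 8 -> a < s / 4 by move: s0; clear; move=> *; lra.
have z4 := s84 _ z8; have w4 := s84 _ w8.
have q4 : len (closest D z - p) < s / 4.
  have := len_distD z (closest D z) p; rewrite (lenC _ z) zq => h.
  by move: h bz z8; move: (len (closest D z - p)) (len (z - p)) (bdist D z); clear; move=> *; lra.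
have qs := quarter_lt s0 q4.
have [Vq /andP[gg gG]] := hg _ qs.
have gq0 := lt_le_trans g00 gg.
have nE v := normal_length_closest oD bp rV v Vq.
have bz0 := bdist_gt0 oD bn Dz; have bw0 := bdist_gt0 oD bn Dw.
split => //.
  rewrite nE; have h1 := dirD_closest_le oD bp rV K0 g00 s0 s1 hg ht z4 w4.
  rewrite ler_pdivrMr //; apply: (le_trans h1).
  have W0 : 0 <= bdist D z + bdist D w + len (z - w) ^+ 2.
    exact: addr_ge0 (addr_ge0 (ltW bz0) (ltW bw0)) (sqr_ge0 _).
  rewrite mulrAC; apply: (ler_wpM2r W0).
  have GK : 0 <= (G + 2 * K) / g0 by rewrite divr_ge0 ?(ltW g00) // addr_ge0 ?(ltW G0) // mulr_ge0.
  have h2 : (G + 2 * K) / g0 * g0 <= A' * len (grad r (closest D z)).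
    exact: ler_pM GK (ltW g00) am2 gg.
  by rewrite mulfVK ?lt0r_neq0 // in h2.
have [th [a [th8 a1 hs]]] := peak_separation r c0 kq0 hq a0 (closest D z) z w.
exists (peak_near_boundary r m a0 (closest D z) z th a); split.
- exact: pk bq q4 z4 th8 a1.
- move=> x Dx /= xs; apply: le_trans (peak_lower c0 kq0 hq hp a0l z bq Dx qs xs th8 a1).
  apply: lerD; last exact: (ler_wpM2r (sqr_ge0 _) cm1).
  apply: (ler_wpM2r (ltW (bdist_gt0 oD bn Dx))).
  by apply: (le_trans cm1); move: c0; clear; move=> *; lra.
- have zq1 : len (z - closest D z) <= 1.
    by rewrite zq (le_trans bz) // ltW // (lt_le_trans (quarter_lt s0 z4)).
  apply: (le_trans (peak_center_le m c0 kq0 hg a0l th a qs zq1)).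
  by rewrite zq; exact: (ler_wpM2r (ltW bz0) am1).
apply: le_trans hs; rewrite nE mulrA ler_pdivrMr // mulrAC.
apply: (ler_wpM2r (normr_ge0 _)); apply: (le_trans cm2).
exact: (ler_wpM2l (ltW lam0) gg).
Qed.

End BoundaryPeaks.

(** * Logarithmic estimates *)

Section LogEstimates.
Variable R : realType.
Implicit Types x y t a h v N X L k : R.

Lemma ln_le_subr1 x : 0 < x -> ln x <= x - 1.
Proof.
by move=> x0; have := @le_ln1Dx R (x - 1); rewrite [1 + _]addrC subrK; apply; lra.
Qed.

Lemma ln_sub_ge t t' : 0 < t -> 0 < t' -> (t' - t) / t' <= ln t' - ln t.
Proof.
move=> t0 t'0; have := ln_le_subr1 (divr_gt0 t0 t'0).
by rewrite ln_div ?posrE // mulrBl divff ?lt0r_neq0 //; lra.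
Qed.

(** The function [psi] of [log_peak], with K in place of 24 S / b^2. *)
Definition log_defect K t : R := 2^-1 * (ln t - K * t).

(** The factor 5/16 is (1 - 3/8) / 2: the linear term takes at most 3/8 of the increment of ln. *)
Lemma log_defect_gap (K t t' : R) : 0 < t -> t <= t' -> K * t' <= 3 / 8 ->
  5 / 16 * ((t' - t) / t') <= log_defect K t' - log_defect K t.
Proof.
move=> t0 tt K0; have t'0 := lt_le_trans t0 tt.
have h1 := ln_sub_ge t0 t'0.
have d0 : 0 <= (t' - t) / t' by rewrite divr_ge0 ?subr_ge0 // ltW.
have h2 := ler_wpM2r d0 K0.
have E : K * t' * ((t' - t) / t') = K * t' - K * t.
  by move: (lt0r_neq0 t'0) => n; field.
rewrite E in h2; rewrite /log_defect.
by move: h1 h2; move: ((t' - t) / t') (K * t') (K * t) (ln t) (ln t'); clear; move=> *; lra.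
Qed.

Lemma log_defect_bounds (K t : R) : 0 <= K * t -> K * t <= 3 / 8 ->
  2^-1 * ln t - 3 / 16 <= log_defect K t <= 2^-1 * ln t.
Proof. by rewrite /log_defect => h1 h2; apply/andP; split; lra. Qed.

(** Here h is the peak value at one point and v that at the other. If v exceeds the level, the gap
    from h <= a / 2 to a already gives 5/16 times 1/2; if not, the relative increment between h and
    v is at least y / (N + y). *)
Lemma log_defect_dist (K h v a y N : R) : 0 <= K -> 0 < h -> 0 < v -> h <= N -> h <= a / 2 ->
  K * a <= 3 / 8 -> 0 <= y -> y <= `|v - h| ->
  5 / 32 * (y / (N + y)) <= `|log_defect K (Num.min v a) - log_defect K h|.
Proof.
move=> K0 h0 v0 hN ha Ka y0 yv.
have N0 := lt_le_trans h0 hN.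
have Ny : 0 < N + y by rewrite ltr_wpDr.
have q0 : 0 <= y / (N + y) by rewrite divr_ge0 // ltW.
have a0 : 0 < a by move: h0 ha; clear; lra.
have mono t : t <= a -> K * t <= 3 / 8 by move=> ta; apply: le_trans Ka; apply: ler_wpM2l.
have [va|va] := leP v a; last first.
  have ha' : h <= a by move: h0 ha; clear; lra.
  have g := log_defect_gap h0 ha' Ka; apply: le_trans (ler_norm _); apply: le_trans g.
  have q1 : y / (N + y) <= 1 by rewrite ler_pdivrMr // mul1r lerDr ltW.
  have q2 : 2^-1 <= (a - h) / a by rewrite ler_pdivlMr //; move: ha; clear; lra.
  by move: q1 q2; move: (y / _) ((a - h) / a); clear; move=> *; lra.
have [hv|hv] := leP h v.
  have g := log_defect_gap h0 hv (mono v va); apply: le_trans (ler_norm _); apply: le_trans g.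
  rewrite ger0_norm ?subr_ge0 // in yv.
  have q1 : y / (N + y) <= (v - h) / v.
    rewrite ler_pdivlMr // mulrAC ler_pdivrMr //.
    have h1 : h * y <= N * (v - h) by apply: ler_pM => //; exact: ltW.
    by move: h1; clear; lra.
  by move: q0 q1; move: (y / _) ((v - h) / v); clear; move=> *; lra.
have ha' : h <= a by move: h0 ha; clear; lra.
have g := log_defect_gap v0 (ltW hv) (mono h ha').
rewrite distrC; apply: le_trans (ler_norm _); apply: le_trans g.
rewrite distrC ger0_norm ?subr_ge0 ?(ltW hv) // in yv.
have q1 : y / (N + y) <= (h - v) / h.
  rewrite ler_pdivlMr // mulrAC ler_pdivrMr //.
  have h1 : y * h <= (h - v) * (N + y).
    apply: ler_pM => //; first exact: ltW.
    by apply: le_trans hN _; rewrite lerDl.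
  exact: h1.
by move: q0 q1; move: (y / _) ((h - v) / h); clear; move=> *; lra.
Qed.

Lemma ln_sqrt_pos x : 0 < x -> ln (Num.sqrt x) = 2^-1 * ln x.
Proof.
move=> x0; have s0 : 0 < Num.sqrt x by rewrite sqrtr_gt0.
have := lnM s0 s0; rewrite -expr2 sqr_sqrtr ?(ltW x0) // => ->; lra.
Qed.

(** X is at most 10 A times the dominant one among L, d1 and d2, and each of the three lower bounds
    on k serves one of these cases. *)
Lemma ln_ratio_upper (A C2 C3 X L k d1 d2 : R) : 0 < A -> 0 < d1 -> 0 < d2 -> 0 < X ->
  0 <= C2 -> 0 <= C3 -> 0 <= L ->
  X <= A * (d1 + d2 + L) ->
  2^-1 * (ln d2 - ln d1) - C2 <= k -> 2^-1 * (ln d1 - ln d2) - C2 <= k ->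
  (4 * (d1 + d2) <= L -> ln L - 2^-1 * ln d1 - 2^-1 * ln d2 - C3 <= k) ->
  ln X - 2^-1 * ln d1 - 2^-1 * ln d2 - (C2 + C3 + `|ln (10 * A)|) <= k.
Proof.
move=> A0 d10 d20 X0 C20 C30 L0 hX k1 k2 k3.
have key M : 0 < M -> X <= 10 * A * M -> ln X <= `|ln (10 * A)| + ln M.
  move=> M0 h; apply: (@le_trans _ _ (ln (10 * A * M))).
    by rewrite ler_ln ?posrE // ?mulr_gt0.
  by rewrite lnM ?posrE ?mulr_gt0 // lerD2r ler_norm.
have [hL|hL] := leP (4 * (d1 + d2)) L.
  have Lp : 0 < L by apply: lt_le_trans hL; rewrite mulr_gt0 // addr_gt0.
  have h : X <= 10 * A * L.
    have : A * (d1 + d2 + L) <= A * (10 * L) by apply: ler_wpM2l; [exact: ltW|lra].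
    by move: hX; clear; lra.
  by have := k3 hL; have := key _ Lp h; move: C20; clear; lra.
have [h12|h12] := leP d1 d2.
  have h : X <= 10 * A * d2.
    have : A * (d1 + d2 + L) <= A * (10 * d2) by apply: ler_wpM2l; [exact: ltW|lra].
    by move: hX; clear; lra.
  by have := key _ d20 h; move: k1 C30; clear; lra.
have h : X <= 10 * A * d1.
  have : A * (d1 + d2 + L) <= A * (10 * d1) by apply: ler_wpM2l; [exact: ltW|lra].
  by move: hX; clear; lra.
by have := key _ d10 h; move: k2 C30; clear; lra.
Qed.

(** If d1 exceeds d2 by a large factor, the half logarithm is at least 1. Otherwise d1 is at most a
    constant times sqrt (d1 d2), and the first bound can be written in terms of u. *)
Lemma ln_ratio_lower (A c C2 X k d1 d2 : R) : 0 < A -> 0 < c -> 0 < d1 -> 0 < d2 -> 0 < X ->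
  5 / 32 * (c * X / (A * d1 + c * X)) <= k ->
  2^-1 * (ln d1 - ln d2) - C2 <= k ->
  let u := X / (Num.sqrt d1 * Num.sqrt d2) in
  1 <= k \/ 5 / 32 * (c * u / (A * expR (C2 + 1) + c * u)) <= k.
Proof.
move=> A0 c0 d10 d20 X0 k1 k2 u.
have s1 : 0 < Num.sqrt d1 by rewrite sqrtr_gt0.
have s2 : 0 < Num.sqrt d2 by rewrite sqrtr_gt0.
have [h|h] := leP (C2 + 1) (2^-1 * (ln d1 - ln d2)); first by left; lra.
right; apply: le_trans k1; rewrite ler_pM2l //.
have sr : Num.sqrt d1 <= expR (C2 + 1) * Num.sqrt d2.
  rewrite -ler_ln ?posrE ?mulr_gt0 ?expR_gt0 // lnM ?posrE ?expR_gt0 // expRK.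
  by rewrite !ln_sqrt_pos //; move: h; clear; lra.
have d1E : d1 = Num.sqrt d1 * Num.sqrt d1 by rewrite -expr2 sqr_sqrtr // ltW.
have d1le : d1 <= expR (C2 + 1) * (Num.sqrt d1 * Num.sqrt d2).
  by rewrite {1}d1E mulrCA ler_pM2l.
have E0 := expR_gt0 (C2 + 1).
have u0 : 0 < u by rewrite divr_gt0 // mulr_gt0.
have XE : X = u * (Num.sqrt d1 * Num.sqrt d2).
  by rewrite mulfVK // lt0r_neq0 // mulr_gt0.
have p0 := mulr_gt0 s1 s2.
move: d1le XE p0; move: (Num.sqrt d1 * Num.sqrt d2) (expR _) E0 u u0 => S e e0 u' u'0 d1le XE S0.
have q1 : 0 < A * d1 + c * X by rewrite addr_gt0 // mulr_gt0.
have q2 : 0 < A * e + c * u' by rewrite addr_gt0 // mulr_gt0.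
rewrite ler_pdivlMr // mulrAC ler_pdivrMr // mulrDr mulrDr XE.
have h1 : A * d1 <= A * (e * S) by rewrite ler_pM2l.
have h2 : c * u' * (A * d1) <= c * u' * (A * (e * S)) by apply: ler_wpM2l => //; exact: ltW (mulr_gt0 c0 u'0).
have E3 : c * (u' * S) * (A * e) = c * u' * (A * (e * S)) by ring.
have E4 : c * (u' * S) * (c * u') = c * u' * (c * (u' * S)) by ring.
by rewrite E3 E4 lerD2r.
Qed.

(** For u >= T = 2 exp C1, 1 + c0 u is at most exp (- C1) u if c0 <= exp (- C1) / 2. For u < T, ln
    (1 + c0 u) <= c0 u is compared with the alternative 1 <= k if c0 <= 1 / T, and with the other
    one if c0 <= q. *)
Lemma ln1D_le_scaled (A c C1 C2 : R) : 0 < A -> 0 < c ->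
  exists2 c0, 0 < c0 & forall u k, 0 < u -> ln u - C1 <= k ->
    1 <= k \/ 5 / 32 * (c * u / (A * expR (C2 + 1) + c * u)) <= k ->
    ln (1 + c0 * u) <= k.
Proof.
move=> A0 c0.
have e0 := expR_gt0 (- C1); have e1 := expR_gt0 C1.
have e2 := mulr_gt0 A0 (expR_gt0 (C2 + 1)).
move: e2; move: (A * expR _) => A' A'0.
pose T := 2 * expR C1.
have T0 : 0 < T by exact: mulr_gt0.
pose q := 5 / 32 * (c / (A' + c * T)).
have q0 : 0 < q by rewrite mulr_gt0 // divr_gt0 // addr_gt0 // mulr_gt0.
exists (Num.min (expR (- C1) / 2) (Num.min T^-1 q)).
  by rewrite !lt_min q0 invr_gt0 T0 divr_gt0.
have m1 : Num.min (expR (- C1) / 2) (Num.min T^-1 q) <= expR (- C1) / 2 by rewrite ge_min lexx.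
have m2 : Num.min (expR (- C1) / 2) (Num.min T^-1 q) <= T^-1 by rewrite !ge_min lexx !orbT.
have m3 : Num.min (expR (- C1) / 2) (Num.min T^-1 q) <= q by rewrite !ge_min lexx !orbT.
have m0 : 0 < Num.min (expR (- C1) / 2) (Num.min T^-1 q) by rewrite !lt_min q0 invr_gt0 T0 divr_gt0.
move: m1 m2 m3 m0; move: (Num.min _ _) => t m1 m2 m3 m0 u k u0 k1 k2.
have tu0 : 0 < t * u by exact: mulr_gt0.
have [Tu|uT] := leP T u.
  apply: le_trans k1; rewrite -[C1 in X in _ <= X]expRK -ln_div ?posrE // ler_ln ?posrE ?divr_gt0 //; last first.
    by rewrite addr_gt0.
  have h1 : t * u <= expR (- C1) / 2 * u by rewrite ler_wpM2r // ltW.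
  have h2 : 1 <= expR (- C1) / 2 * u.
    have : expR (- C1) / 2 * T <= expR (- C1) / 2 * u by apply: ler_wpM2l => //; rewrite divr_ge0 // ltW.
    rewrite /T expRN; move: e1; move: (expR C1) => e e1.
    by have -> : e^-1 / 2 * (2 * e) = 1 by move: (lt0r_neq0 e1) => n; field.
  rewrite expRN in h1 h2; rewrite [u / _]mulrC.
  by move: h1 h2; rewrite mulrAC; move: ((expR C1)^-1 * u); clear; move=> *; lra.
have lnle : ln (1 + t * u) <= t * u by apply: le_ln1Dx; move: tu0; clear; lra.
apply: (le_trans lnle); case: k2 => [k2|k2]; apply: le_trans k2.
  have : t * u <= T^-1 * T by apply: ler_pM => //; exact: ltW.
  by rewrite mulVf // lt0r_neq0.
have h1 : t * u <= q * u by rewrite ler_wpM2r // ltW.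
apply: (le_trans h1); rewrite /q -!mulrA ler_pM2l // ler_pM2l // ler_pM2l // [_ * u]mulrC ler_pM2l //.
by rewrite lef_pV2 ?posrE ?addr_gt0 ?mulr_gt0 // lerD2l ler_pM2l // ltW.
Qed.

End LogEstimates.

(** * Lower bounds from one peak and from two peaks *)

Section PeakDifferences.
Variable R : realType.
Implicit Types (c A a K k : R).

Lemma ln_le_mul (A h t : R) : 0 < A -> 0 < t -> 0 < h -> h <= A * t ->
  ln h <= `|ln A| + ln t.
Proof.
move=> A0 t0 h0 hA; apply: (@le_trans _ _ (ln (A * t))).
  by rewrite ler_ln ?posrE // mulr_gt0.
by rewrite lnM ?posrE // lerD2r ler_norm.
Qed.

Lemma ln_ge_mul (c h t : R) : 0 < c -> 0 < t -> c * t <= h ->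
  ln t - `|ln c| <= ln h.
Proof.
move=> c0 t0 ch; apply: (@le_trans _ _ (ln (c * t))); last first.
  by rewrite ler_ln ?posrE ?mulr_gt0 // (lt_le_trans _ ch) // mulr_gt0.
by rewrite lnM ?posrE // addrC lerD2r; have := ler_norm (- ln c); rewrite normrN; lra.
Qed.

(** Up to a bounded term [log_defect] is half of ln; the peak value is at most A dz at its own
    centre and at least c dw at the other point. *)
Lemma log_defect_ratio (c A a K k hz hw dz dw : R) :
  0 < c -> 0 < A -> 0 < dz -> 0 < dw -> 0 < hz -> hz <= A * dz -> A * dz <= a / 2 ->
  c * dw <= hw -> c * dw <= a -> 0 <= K -> K * a <= 3 / 8 ->
  `|log_defect K (Num.min hz a) - log_defect K (Num.min hw a)| <= k ->
  2^-1 * (ln dw - ln dz) - (`|ln A| + `|ln c| + 1) <= k.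
Proof.
move=> c0 A0 dz0 dw0 hz0 hzA Aa chw ca K0 Ka; rewrite distrC => /(le_trans (ler_norm _)).
have a0 : 0 < a by have := mulr_gt0 A0 dz0; move: Aa; clear; lra.
have za : hz <= a by move: hzA Aa a0; clear; lra.
rewrite (min_l za).
have m0 : 0 < Num.min hw a by rewrite lt_min a0 andbT (lt_le_trans _ chw) // mulr_gt0.
have ma : Num.min hw a <= a by rewrite ge_min lexx orbT.
have mc : c * dw <= Num.min hw a by rewrite le_min chw.
move: m0 ma mc; move: (Num.min hw a) => v v0 va cv.
have mono t : t <= a -> K * t <= 3 / 8 by move=> ta; apply: le_trans Ka; exact: ler_wpM2l.
have /andP[b1 _] := log_defect_bounds (mulr_ge0 K0 (ltW v0)) (mono v va).
have /andP[_ b2] := log_defect_bounds (mulr_ge0 K0 (ltW hz0)) (mono hz za).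
have b3 := ln_le_mul A0 dz0 hz0 hzA; have b4 := ln_ge_mul c0 dw0 cv.
have n1 := normr_ge0 (ln A); have n2 := normr_ge0 (ln c).
move: b1 b2 b3 b4 n1 n2; move: (ln v) (ln hz) (ln dz) (ln dw) `|ln A| `|ln c| (log_defect K v) (log_defect K hz).
by clear; move=> *; lra.
Qed.

(** Each peak is at its level a at the other point, so the two increments, about ln (a / dz) / 2 and
    ln (a / dw) / 2, add up. *)
Lemma log_defect_separated (A a K k hz hw dz dw : R) :
  0 < A -> 0 < dz -> 0 < dw -> 0 < hz -> 0 < hw -> hz <= A * dz -> hw <= A * dw ->
  0 < a -> 0 <= K -> K * a <= 3 / 8 ->
  `|(log_defect K (Num.min hz a) - log_defect K a)
    - (log_defect K a - log_defect K (Num.min hw a))| <= k ->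
  ln a - 2^-1 * ln dz - 2^-1 * ln dw - (`|ln A| + 1) <= k.
Proof.
move=> A0 dz0 dw0 hz0 hw0 hzA hwA a0 K0 Ka; rewrite distrC => /(le_trans (ler_norm _)).
have mono t : t <= a -> K * t <= 3 / 8 by move=> ta; apply: le_trans Ka; exact: ler_wpM2l.
have /andP[b1 _] := log_defect_bounds (mulr_ge0 K0 (ltW a0)) Ka.
have low h t : 0 < h -> 0 < t -> h <= A * t ->
    log_defect K (Num.min h a) <= 2^-1 * (`|ln A| + ln t).
  move=> h0 t0 hA.
  have m0 : 0 < Num.min h a by rewrite lt_min h0.
  have ma : Num.min h a <= a by rewrite ge_min lexx orbT.
  have mh : Num.min h a <= A * t by rewrite ge_min hA.
  have /andP[_ b2] := log_defect_bounds (mulr_ge0 K0 (ltW m0)) (mono _ ma).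
  by apply: (le_trans b2); rewrite ler_pM2l //; exact: ln_le_mul.
have b2 := low _ _ hz0 dz0 hzA; have b3 := low _ _ hw0 dw0 hwA.
move: b1 b2 b3; move: (log_defect K (Num.min hz a)) (log_defect K (Num.min hw a)) (log_defect K a)
  (ln a) (ln dz) (ln dw) `|ln A|.
by clear; move=> *; lra.
Qed.

Variable d : nat.
Implicit Types z w q x : 'rV[C R]_d.

Lemma sublevel_separated z w q q' x : 0 < len (z - w) ->
  len (z - q) + len (w - q') <= len (z - w) / 4 ->
  len (x - q) <= len (z - w) / 4 -> len (x - q') <= len (z - w) / 4 -> False.
Proof.
have := len_distD q z w; have := len_distD x q w; have := len_distD q' x w.
rewrite (lenC q x) (lenC q' w).
move: (len (z - w)) (len (z - q)) (len (w - q')) (len (x - q)) (len (x - q')) (len (q - w)) (len (x - w)).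
by clear; move=> *; lra.
Qed.

Lemma le_of_mul_sqr (c t l e : R) : 0 < c -> 0 <= t -> 0 <= l -> 0 <= e ->
  e + c * t ^+ 2 <= c * l ^+ 2 / 16 -> t <= l / 4.
Proof.
move=> c0 t0 l0 e0 h.
rewrite -(ler_pXn2r (n := 2)) ?nnegrE ?divr_ge0 // -(ler_pM2l c0).
have -> : c * (l / 4) ^+ 2 = c * l ^+ 2 / 16 by field.
by move: h e0; clear; lra.
Qed.

End PeakDifferences.

Section Separation.
Variables (R : realType) (d : nat) (D : set 'rV[C R]_d).
Implicit Types (z w q x : 'rV[C R]_d).

Lemma log_peakE H (B : set 'rV[C R]_d) (b S a : R) x : B x ->
  log_peak H B b S a x = log_defect (24 * S / b ^+ 2) (Num.min (complex.Re (H x)) a).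
Proof. by move=> Bx; rewrite /log_peak; case: asboolP. Qed.

(** At the level a = c |z - w|^2 / 16, Re H <= a forces x within |z - w| / 4 of the centre of the
    peak. The last hypothesis and |z - w| <= 1 give delta z + delta w <= |z - w| / 4, so the
    sublevel sets are disjoint and each peak is above its level at the other point. *)
Lemma separated_peaks_bound (B : set 'rV[C R]_d) (b S c A a1 k : R) (delta : 'rV[C R]_d -> R) H1 H2 q1 q2 z w :
  0 < c -> 0 < A -> 0 < b -> 0 < S -> a1 <= b -> a1 <= b ^+ 3 / (64 * S ^+ 2) ->
  24 * S / b ^+ 2 * a1 <= 3 / 8 ->
  (forall x, D x -> 0 < delta x) ->
  peak_at_boundary D H1 B b S -> peak_at_boundary D H2 B b S ->
  (forall x, D x -> B x -> c * delta x + c * len (x - q1) ^+ 2 <= complex.Re (H1 x)) ->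
  (forall x, D x -> B x -> c * delta x + c * len (x - q2) ^+ 2 <= complex.Re (H2 x)) ->
  complex.Re (H1 z) <= A * delta z -> complex.Re (H2 w) <= A * delta w ->
  len (z - q1) = delta z -> len (w - q2) = delta w ->
  D z -> D w -> B z -> B w ->
  (forall g, infinitesimally_nonexpansive D g -> `|g z - g w| <= k) ->
  len (z - w) <= 1 -> c * len (z - w) ^+ 2 / 16 <= a1 ->
  4 * (delta z + delta w) <= len (z - w) ^+ 2 ->
  ln (len (z - w) ^+ 2) - 2^-1 * ln (delta z) - 2^-1 * ln (delta w)
    - (`|ln A| + `|ln (c / 16)| + 1) <= k.
Proof.
move=> c0 A0 b0 S0 a1b a1small Ka1 bd pk1 pk2 low1 low2 up1 up2 zq wq Dz Dw Bz Bw hk l1 ca1 far.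
have dz0 := bd _ Dz; have dw0 := bd _ Dw.
have L0 : 0 < len (z - w) ^+ 2.
  exact: lt_le_trans (mulr_gt0 (ltr0Sn R 3) (addr_gt0 dz0 dw0)) far.
have l0 : 0 < len (z - w).
  by rewrite lt_def len_ge0 andbT; apply: contraTN L0 => /eqP ->; rewrite expr0n ltxx.
have [a aE] : exists a, c * len (z - w) ^+ 2 / 16 = a by eexists.
rewrite aE in ca1.
have a0 : 0 < a by rewrite -aE divr_gt0 // mulr_gt0.
have K0 : 0 <= 24 * S / b ^+ 2 by rewrite divr_ge0 ?sqr_ge0 // mulr_ge0 // ltW.
have Ka : 24 * S / b ^+ 2 * a <= 3 / 8 by apply: le_trans Ka1; exact: ler_wpM2l.
have small : len (z - q1) + len (w - q2) <= len (z - w) / 4.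
  have L1 : len (z - w) ^+ 2 <= len (z - w) by apply: sqr_le_self => //; exact: ltW.
  rewrite zq wq; move: far L1; move: (delta z) (delta w) (len (z - w)) => t1 t2 l.
  by move: (l ^+ 2); clear; move=> *; lra.
have near1 x q (H : 'rV[C R]_d -> C R) : D x ->
    c * delta x + c * len (x - q) ^+ 2 <= complex.Re (H x) ->
    complex.Re (H x) <= a -> len (x - q) <= len (z - w) / 4.
  move=> Dx h1 h2; have h3 := le_trans h1 h2; rewrite -aE in h3.
  have e0 : 0 <= c * delta x by rewrite mulr_ge0 ?ltW // bd.
  exact: le_of_mul_sqr c0 (len_ge0 _) (len_ge0 _) e0 h3.
have disj x : D x -> B x -> complex.Re (H1 x) <= a -> B x -> complex.Re (H2 x) <= a -> False.
  move=> Dx Bx h1 _ h2.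
  exact: sublevel_separated l0 small (near1 _ _ _ Dx (low1 _ Dx Bx) h1)
    (near1 _ _ _ Dx (low2 _ Dx Bx) h2).
have asm := le_trans ca1 a1small; have ab := le_trans ca1 a1b.
have := log_peak_sub_nonexpansive pk1 pk2 a0 asm ab a0 asm ab disj.
move=> /hk; rewrite !log_peakE //.
have H2z : a < complex.Re (H2 z).
  rewrite ltNge; apply/negP => h; have h2 := near1 _ _ _ Dz (low2 _ Dz Bz) h.
  apply: (sublevel_separated l0 small _ h2).
  apply: le_trans small; rewrite lerDl; exact: len_ge0.
have H1w : a < complex.Re (H1 w).
  rewrite ltNge; apply/negP => h; have h2 := near1 _ _ _ Dw (low1 _ Dw Bw) h.
  apply: (sublevel_separated l0 small h2).
  apply: le_trans small; rewrite lerDr; exact: len_ge0.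
rewrite (min_r (ltW H2z)) (min_r (ltW H1w)) => hkk.
have pos (H : 'rV[C R]_d -> C R) q x : D x ->
    c * delta x + c * len (x - q) ^+ 2 <= complex.Re (H x) -> 0 < complex.Re (H x).
  by move=> Dx; apply: lt_le_trans; rewrite ltr_wpDr ?mulr_gt0 ?bd // mulr_ge0 ?sqr_ge0 // ltW.
have h := log_defect_separated A0 dz0 dw0 (pos _ _ _ Dz (low1 _ Dz Bz)) (pos _ _ _ Dw (low2 _ Dw Bw))
  up1 up2 a0 K0 Ka hkk.
have E : ln a = ln (c / 16) + ln (len (z - w) ^+ 2).
  by rewrite -aE mulrAC; exact: lnM (divr_gt0 c0 (ltr0Sn R 15)) L0.
rewrite E in h; have := ler_norm (- ln (c / 16)); rewrite normrN.
move: h; move: (ln (c / 16)) (ln (len _ ^+ 2)) (ln (delta z)) (ln (delta w)) `|ln A| `|ln (c / 16)|.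
by clear; move=> *; lra.
Qed.

End Separation.

(** * Assembly of the lower bounds *)

Theorem proposition1 (R : realType) (d : nat) (D : set 'rV[C R]_d)
    (p : 'rV[C R]_d) :
  is_domain D -> strongly_pseudoconvex_at D p ->
  exists (U : set 'rV[C R]_d) (c : R), nbhs p U /\ 0 < c /\
    forall z w, (D `&` U) z -> (D `&` U) w ->
      ((ln (1 + c * normal_length D z (z - w) /
                 (Num.sqrt (bdist D z) * Num.sqrt (bdist D w))))%:E
        <= kobayashi D z w)%E.
Proof.
move=> [_ oD _] sp; have bp := sp.1.
have bn : boundary D !=set0 by exists p.
have [B [b [S [c [A [s [[c0 A0 s0] [b0 bS S1] sB pk]]]]]]] := boundary_peaks oD sp.
have bd x : D x -> 0 < bdist D x by exact: bdist_gt0.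
have [delta deltaE] : exists delta, @bdist R d D = delta by eexists.
rewrite deltaE in bd pk *.
have S0 : 0 < S by exact: lt_le_trans S1.
have [a aE] : exists a, b ^+ 3 / (64 * S ^+ 2) = a by eexists.
have a0 : 0 < a by rewrite -aE divr_gt0 ?mulr_gt0 ?exprn_gt0.
have K0 : 0 <= 24 * S / b ^+ 2 by rewrite divr_ge0 ?sqr_ge0 // mulr_ge0 // ltW.
have Ka : 24 * S / b ^+ 2 * a <= 3 / 8.
  have -> : 24 * S / b ^+ 2 * a = 3 / 8 * (b / S).
    by rewrite -aE; move: (lt0r_neq0 b0) (lt0r_neq0 S0) => n1 n2; field; rewrite ?n1 ?n2.
  by rewrite ler_piMr // ler_pdivrMr // mul1r.
have ab : a <= b.
  rewrite -aE ler_pdivrMr ?mulr_gt0 ?exprn_gt0 // exprS ler_pM2l //.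
  have h : b ^+ 2 <= S ^+ 2 by rewrite lerXn2r // nnegrE ltW.
  by have := sqr_ge0 S; move: h; move: (b ^+ 2) (S ^+ 2); clear; move=> *; lra.
pose C2 := `|ln A| + `|ln c| + 1; pose C3 := `|ln A| + `|ln (c / 16)| + 1.
have C20 : 0 <= C2 by rewrite !addr_ge0.
have C30 : 0 <= C3 by rewrite !addr_ge0.
have [k0 k00 hk0] := ln1D_le_scaled (C2 + C3 + `|ln (10 * A)|) C2 A0 c0.
(* In this radius |z - w| <= 1, the peak values at their own points are below half of the level a,
   and c delta and c |z - w|^2 / 16 are at most a. *)
have [rho [rho0 rs r2 rA rc]] : exists rho : R,
    [/\ 0 < rho, rho <= s, rho <= 1 / 2, A * rho <= a / 2 & c * rho <= a].
  exists (Num.min (Num.min s (1 / 2)) (Num.min (a / 2 / A) (a / c))); split.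
  - by rewrite !lt_min s0 !divr_gt0.
  - by rewrite !ge_min lexx.
  - by rewrite !ge_min lexx !orbT.
  - by rewrite mulrC -ler_pdivlMr // !ge_min lexx !orbT.
  - by rewrite mulrC -ler_pdivlMr // !ge_min lexx !orbT.
exists [set x | len (x - p) < rho], k0; split; first by apply/nbhs_lenP; exists rho.
split=> // z w [Dz /= zr] [Dw /= wr].
have zs := lt_le_trans zr rs; have ws := lt_le_trans wr rs.
have [[dz0 dzp] zq X1 [H1 [pk1 low1 up1 sep1]]] := pk z w Dz Dw zs ws.
have [[dw0 dwp] wq _ [H2 [pk2 low2 up2 _]]] := pk w z Dw Dz ws zs.
have Bz := sB z zs; have Bw := sB w ws.
have kob g : infinitesimally_nonexpansive D g -> ((`|g z - g w|)%:E <= kobayashi D z w)%E.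
  by move=> hg; exact: kobayashi_ge.
have := kobayashi_ge0 D z w.
(* An infinite supremum makes the estimate trivial, and nonnegativity excludes the value -oo; from
   here on k is a real number. *)
move: kob; case: (kobayashi D z w) => [k kob k00'|_ _|_]; [|exact: leey|by rewrite leeNy_eq].
have {}kob g : infinitesimally_nonexpansive D g -> `|g z - g w| <= k.
  by move=> /kob; rewrite lee_fin.
rewrite lee_fin in k00' *.
have asm : a <= b ^+ 3 / (64 * S ^+ 2) by rewrite aE.
have pos (H : 'rV[C R]_d -> C R) q x : D x ->
    c * delta x + c * len (x - q) ^+ 2 <= complex.Re (H x) ->
    0 < complex.Re (H x) /\ c * delta x <= complex.Re (H x).
  move=> Dx h; have sq : 0 <= c * len (x - q) ^+ 2 by rewrite mulr_ge0 ?sqr_ge0 // ltW.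
  have dx : 0 < c * delta x by rewrite mulr_gt0 // bd.
  by move: h sq dx; move: (c * delta x) (c * _); clear; move=> *; split; lra.
have [H1z0 _] := pos _ _ _ Dz (low1 z Dz Bz); have [H2w0 _] := pos _ _ _ Dw (low2 w Dw Bw).
have [H1w0 H1w] := pos _ _ _ Dw (low1 w Dw Bw); have [_ H2z] := pos _ _ _ Dz (low2 z Dz Bz).
have small t : t < rho -> A * t <= a / 2 /\ c * t <= a.
  move=> tr; split; [apply: le_trans rA|apply: le_trans rc]; apply: ler_wpM2l; exact: ltW.
have [Az cz] := small _ (le_lt_trans dzp zr); have [Aw cw] := small _ (le_lt_trans dwp wr).
have n1 := kob _ (log_peak_nonexpansive pk1 a0 asm).
have n2 := kob _ (log_peak_nonexpansive pk2 a0 asm).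
rewrite !log_peakE // in n1 n2.
have r1 := log_defect_ratio c0 A0 dz0 dw0 H1z0 up1 Az H1w cw K0 Ka n1.
rewrite distrC in n2.
have r2' := log_defect_ratio c0 A0 dw0 dz0 H2w0 up2 Aw H2z cz K0 Ka n2.
have zw1 : len (z - w) <= 1.
  have := len_distD p z w; rewrite (lenC p w); move: zr wr r2.
  by move: (len (z - p)) (len (w - p)) (len (z - w)); clear; move=> *; lra.
have aL : c * len (z - w) ^+ 2 / 16 <= a.
  have L1 : len (z - w) ^+ 2 <= len (z - w) by apply: sqr_le_self => //; exact: len_ge0.
  have h : len (z - w) <= 2 * rho.
    have := len_distD p z w; rewrite (lenC p w); move: zr wr.
    by move: (len (z - p)) (len (w - p)) (len (z - w)); clear; move=> *; lra.
  have h2 : c * len (z - w) ^+ 2 <= c * (2 * rho) by apply: (ler_wpM2l (ltW c0)); exact: le_trans L1 h.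
  have h3 := mulr_gt0 c0 rho0.
  have E : c * (2 * rho) = 2 * (c * rho) by ring.
  by rewrite E in h2; move: h2 h3 rc; move: (c * rho) (c * len (z - w) ^+ 2); clear; move=> *; lra.
have r3 := separated_peaks_bound c0 A0 b0 S0 ab asm Ka bd pk1 pk2 low1 low2 up1 up2 zq wq
  Dz Dw Bz Bw kob zw1 aL.
have X0 : 0 <= normal_length D z (z - w) by exact: normr_ge0.
(* For X = 0 the left-hand side is ln 1 = 0; the logarithm of X is taken only for X > 0. *)
move: X0 X1 sep1; move: (normal_length D z (z - w)) => X; rewrite le_eqVlt => /orP[/eqP <-|X0] X1 sep1.
  by rewrite mulr0 mul0r addr0 ln1.
have f1 : 5 / 32 * (c * X / (A * delta z + c * X)) <= k.
  have cX : 0 <= c * X by exact: ltW (mulr_gt0 c0 X0).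
  have za : complex.Re (H1 z) <= a / 2 by exact: le_trans up1 Az.
  have h := log_defect_dist K0 H1z0 H1w0 up1 za Ka cX sep1.
  apply: (le_trans h); apply: le_trans n1; rewrite distrC (min_l (_ : complex.Re (H1 z) <= a)) //.
  by move: za a0; clear; lra.
have g1 := ln_ratio_upper A0 dz0 dw0 X0 C20 C30 (sqr_ge0 _) X1 r1 r2' r3.
have g2 := ln_ratio_lower A0 c0 dz0 dw0 X0 f1 r2'.
have sz : 0 < Num.sqrt (delta z) by rewrite sqrtr_gt0.
have sw : 0 < Num.sqrt (delta w) by rewrite sqrtr_gt0.
rewrite -mulrA; apply: hk0 g2; first by rewrite divr_gt0 // mulr_gt0.
have E1 := ln_div X0 (mulr_gt0 sz sw); have E2 := lnM sz sw.
rewrite E2 (ln_sqrt_pos dz0) (ln_sqrt_pos dw0) opprD addrA in E1.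
by rewrite E1.
Qed.
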